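(* Let $T>0$, $r\ge0$, $\rho\in[-1,1]$, $\alpha\ge0$, let $a=a(t)\ge r$ not depend on $H$, and let $b_1(t),b_2(t)$ satisfy $r\le b_1(t)\le b_2(t)$ on $[0,T]$. For $i=1,2$ let $P^{b_i}=P^{b_i}(S,t)$ be the solution of $$P_t+\Big(\mu(S,t)-(a(t)-r)\rho\frac{\sigma(S,t)}{b_i(t)}\Big)SP_S+\tfrac12\sigma^2(S,t)S^2P_{SS}-rP=-\alpha\sqrt{1-\rho^2}\,\sigma(S,t)S|P_S|,\quad P(S,T)=g(S),$$ where for each $i$ the data $(\mu,\sigma,a,b_i,g)$ satisfy the standing assumptions in the context. If $\rho P^{b_i}_S\ge0$ for $i=1$ or $i=2$, then $P^{b_1}\le P^{b_2}$; if $\rho P^{b_i}_S\le0$ for $i=1$ or $i=2$, then $P^{b_1}\ge P^{b_2}$.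
   Context: Model: non-traded asset $dS=\mu(S,t)Sdt+\sigma(S,t)SdZ$, traded asset $dH=a(t)Hdt+b(t)HdW$, with $Z,W$ of correlation $\rho$; when $a,b$ do not depend on $H$ the writer's price does not depend on $H$ and solves the displayed PDE. Solutions are understood as continuous viscosity solutions in the class of locally bounded $u$ with $u/(1+|\ln S|^k)\to0$ uniformly in $t$ as $|\ln S|\to\infty$ for some $k>0$. Standing assumptions (with $\tilde\mu=\mu-(a-r)\rho\sigma/b$): (1) there are $C_1,C_2>0$ with $|\sigma(S_1,t)-\sigma(S_2,t)|\le C_1|\ln S_1-\ln S_2|$, $\sigma(S,t)\le C_2\sqrt{S(1+\ln S)}$, $\sigma$ differentiable in $S$; (2) there are $K,C_5>0$ with $|\tilde\mu|\le K(1+|\ln S|)$, $|\tilde\mu(S_1,t)-\tilde\mu(S_2,t)|\le C_5|\ln S_1-\ln S_2|$, $\tilde\mu$ differentiable in $S$; (3) $g(S)\le L(1+(\ln S)^{2\lambda})$ for some $L>0,\lambda\ge1$; (4) $\mu,\sigma,a,b$ bounded; (5) there is $\delta>0$ with $\sigma^2(e^x,t)\xi_1^2+2\rho\sigma(e^x,t)b(t)\xi_1\xi_2+b^2(t)\xi_2^2\ge\delta\sqrt{\xi_1^2+\xi_2^2}$ for all $\xi\in\mathbb R^2$. The paper assumes throughout $a\ge r$.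
   Formalization: The bound in (5) is read as δ(ξ1²+ξ2²), since with the square root it is unsatisfiable; the bound on σ is read as C2·sqrt(1+|ln S|), the original being undefined for S<1/e; and σ≥0 is assumed, as the claim fails for negative σ. *)

(* Defs.v *)
From Stdlib Require Import Reals Lra.
From Coquelicot Require Import Coquelicot.
Open Scope R_scope.

(* x^y for x >= 0 with the convention 0^y = 0 (Stdlib's Rpower 0 y = 1). *)
Definition rpow (x y : R) : R := if Req_EM_T x 0 then 0 else Rpower x y.

Definition mu_tilde (r rho : R) (mu sigma : R -> R -> R) (a b : R -> R)
  (S t : R) : R :=
  mu S t - (a t - r) * rho * sigma S t / b t.

Definition standing (T r rho : R) (mu sigma : R -> R -> R) (a b : R -> R)
  (g : R -> R) : Prop :=
  (exists C1 C2 : R, 0 < C1 /\ 0 < C2 /\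
     (forall S1 S2 t, 0 < S1 -> 0 < S2 -> 0 <= t <= T ->
        Rabs (sigma S1 t - sigma S2 t) <= C1 * Rabs (ln S1 - ln S2)) /\
     (forall S t, 0 < S -> 0 <= t <= T ->
        sigma S t <= C2 * sqrt (1 + Rabs (ln S)))) /\
  (forall S t, 0 < S -> 0 <= t <= T -> ex_derive (fun s => sigma s t) S) /\
  (exists K C5 : R, 0 < K /\ 0 < C5 /\
     (forall S t, 0 < S -> 0 <= t <= T ->
        Rabs (mu_tilde r rho mu sigma a b S t) <= K * (1 + Rabs (ln S))) /\
     (forall S1 S2 t, 0 < S1 -> 0 < S2 -> 0 <= t <= T ->
        Rabs (mu_tilde r rho mu sigma a b S1 t - mu_tilde r rho mu sigma a b S2 t)
          <= C5 * Rabs (ln S1 - ln S2))) /\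
  (forall S t, 0 < S -> 0 <= t <= T ->
     ex_derive (fun s => mu_tilde r rho mu sigma a b s t) S) /\
  (exists L lam : R, 0 < L /\ 1 <= lam /\
     forall S, 0 < S -> g S <= L * (1 + rpow (Rabs (ln S)) (2 * lam))) /\
  (exists M : R, forall S t, 0 < S -> 0 <= t <= T ->
     Rabs (mu S t) <= M /\ Rabs (sigma S t) <= M /\
     Rabs (a t) <= M /\ Rabs (b t) <= M) /\
  (exists delta : R, 0 < delta /\
     forall S t xi1 xi2, 0 < S -> 0 <= t <= T ->
       sigma S t ^ 2 * xi1 ^ 2 + 2 * rho * sigma S t * b t * xi1 * xi2
         + b t ^ 2 * xi2 ^ 2 >= delta * (xi1 ^ 2 + xi2 ^ 2)).

Definition C12 (phi : R -> R -> R) : Prop :=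
  forall S t,
    ex_derive (fun s => phi S s) t /\
    ex_derive (fun s => phi s t) S /\
    ex_derive (fun s => Derive (fun s' => phi s' t) s) S /\
    continuous (fun p : R * R => phi (fst p) (snd p)) (S, t) /\
    continuous (fun p : R * R => Derive (fun s => phi (fst p) s) (snd p)) (S, t) /\
    continuous (fun p : R * R => Derive (fun s => phi s (snd p)) (fst p)) (S, t) /\
    continuous (fun p : R * R =>
      Derive (fun s => Derive (fun s' => phi s' (snd p)) s) (fst p)) (S, t).

(* The PDE operator (everything moved to the left-hand side):
   phi_t + mu~ S phi_S + 1/2 sigma^2 S^2 phi_SS - r v
     + alpha sqrt(1-rho^2) sigma S |phi_S|, with v the value of the solution. *)
Definition Lop (r rho alpha : R) (mu sigma : R -> R -> R) (a b : R -> R)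
  (phi : R -> R -> R) (S t v : R) : R :=
  let pt := Derive (fun s => phi S s) t in
  let pS := Derive (fun s => phi s t) S in
  let pSS := Derive (fun s => Derive (fun s' => phi s' t) s) S in
  pt + mu_tilde r rho mu sigma a b S t * S * pS
     + / 2 * sigma S t ^ 2 * S ^ 2 * pSS - r * v
     + alpha * sqrt (1 - rho ^ 2) * sigma S t * S * Rabs pS.

Definition loc_max (u phi : R -> R -> R) (S0 t0 : R) : Prop :=
  exists eps, 0 < eps /\ forall S t, Rabs (S - S0) < eps -> Rabs (t - t0) < eps ->
    u S t - phi S t <= u S0 t0 - phi S0 t0.

Definition loc_min (u phi : R -> R -> R) (S0 t0 : R) : Prop :=
  exists eps, 0 < eps /\ forall S t, Rabs (S - S0) < eps -> Rabs (t - t0) < eps ->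
    u S t - phi S t >= u S0 t0 - phi S0 t0.

Definition visc_sub (T r rho alpha : R) (mu sigma : R -> R -> R) (a b : R -> R)
  (u : R -> R -> R) : Prop :=
  forall phi S0 t0, C12 phi -> 0 < S0 -> 0 < t0 < T -> loc_max u phi S0 t0 ->
    Lop r rho alpha mu sigma a b phi S0 t0 (u S0 t0) >= 0.

Definition visc_super (T r rho alpha : R) (mu sigma : R -> R -> R) (a b : R -> R)
  (u : R -> R -> R) : Prop :=
  forall phi S0 t0, C12 phi -> 0 < S0 -> 0 < t0 < T -> loc_min u phi S0 t0 ->
    Lop r rho alpha mu sigma a b phi S0 t0 (u S0 t0) <= 0.

Definition cont_on_dom (T : R) (u : R -> R -> R) : Prop :=
  forall S0 t0, 0 < S0 -> 0 <= t0 <= T -> forall eps, 0 < eps ->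
    exists d, 0 < d /\ forall S t, 0 < S -> 0 <= t <= T ->
      Rabs (S - S0) < d -> Rabs (t - t0) < d -> Rabs (u S t - u S0 t0) < eps.

Definition growth_class (T : R) (u : R -> R -> R) : Prop :=
  (forall S0 t0, 0 < S0 -> 0 <= t0 <= T -> exists d M, 0 < d /\
     forall S t, 0 < S -> 0 <= t <= T -> Rabs (S - S0) < d -> Rabs (t - t0) < d ->
       Rabs (u S t) <= M) /\
  (exists k, 0 < k /\ forall eps, 0 < eps -> exists N, forall S t,
     0 < S -> 0 <= t <= T -> N < Rabs (ln S) ->
       Rabs (u S t) <= eps * (1 + rpow (Rabs (ln S)) k)).

Definition is_solution (T r rho alpha : R) (mu sigma : R -> R -> R) (a b : R -> R)
  (g : R -> R) (u : R -> R -> R) : Prop :=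
  cont_on_dom T u /\ growth_class T u /\
  visc_sub T r rho alpha mu sigma a b u /\
  visc_super T r rho alpha mu sigma a b u /\
  (forall S, 0 < S -> u S T = g S).

Definition rhoPS_nonneg (T rho : R) (u : R -> R -> R) : Prop :=
  forall S t, 0 < S -> 0 <= t < T ->
    ex_derive (fun s => u s t) S /\ 0 <= rho * Derive (fun s => u s t) S.

Definition rhoPS_nonpos (T rho : R) (u : R -> R -> R) : Prop :=
  forall S t, 0 < S -> 0 <= t < T ->
    ex_derive (fun s => u s t) S /\ rho * Derive (fun s => u s t) S <= 0.

(* Main.v *)
(* Monotonicity in [b] reduces to comparison: where [rho P_S] has a sign, the
   solution for one [b_i] is a viscosity sub- or supersolution of the equation
   for the other.

   The comparison principle must cope with coefficients that are arbitrary
   functions of time, so the variables can be doubled in space only, both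
   solutions being evaluated at the same time. Let [x = ln S], let time run
   forward, let [u1] be the discounted subsolution and [u2] minus the discounted
   supersolution (both made coercive by subtracting [be e^(K t) cosh x]), and let
   [M_p(t)] be the maximum of
     [u1(x,t) + u2(y,t) - k/2 (x - y)^2 - p (x + y)/2].
   The maximizers are monotone in [p], hence differentiable at almost every [p],
   and at such [p] the sup-convolutions have second order expansions there. These
   replace Jensen's lemma: they give paraboloids touching [u1] and [u2] with
   ordered second derivatives, whence the upper right Dini derivative of [M_p] at
   time [t] is small for almost every [p]. The exceptional null set depends on
   [t], so the estimate is integrated over [p] in [[0, delta]]; a common one-sided
   Lipschitz bound of the [M_p] allows dominated convergence, and then some [p]
   has [M_p(T)] close to [M_p(0)]. *)
Require Import Defs.
From HB Require structures.
From mathcomp Require finmap all_boot all_order all_algebra all_classical all_reals all_analysis.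
From mathcomp Require ring lra Rstruct.
From Stdlib Require Reals Lra.

(** Lebesgue's theorem on monotone functions enters twice. Besides the maximizers in [p] it serves
    in time: the coefficients depend on [t] in an arbitrary way, so the two slope bounds given by
    the equations cannot be integrated separately, and only their sum at one and the same time is
    small. Each bound makes [C t - f t] nondecreasing for the local excess [f] of [u1] or [u2]; at
    almost every time both excesses are differentiable, and there the two bounds can be added. One
    tilt parameter suffices for two space variables: up to a constant the penalty is the minimum
    over [z] of [k (x - z)^2 + k (y - z)^2 + p z], so [x] and [y] are attained in sup-convolutions
    at a common [z], and monotonicity of [z] in [p] passes to both. Discounting removes the zeroth
    order term. The correction [cosh x] dominates every power of [x], and its derivatives are
    bounded by itself, so a large rate [K] in [e^(K t)] makes it a supersolution for all
    coefficients bounded by [La]. *)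

Module Monotone.
Import finmap HB.structures all_boot all_order all_algebra all_classical all_reals all_analysis.
Import mathcomp.algebra_tactics.ring mathcomp.algebra_tactics.lra Rstruct.
Import Order.TTheory GRing.Theory Num.Theory numFieldNormedType.Exports.
Set Implicit Arguments. Unset Strict Implicit. Unset Printing Implicit Defensive.
Local Open Scope classical_set_scope.
Local Open Scope ring_scope.

(** * Differentiability of monotone functions *)

Section VitaliRational.
Variable R : realType.
Implicit Types (f : R -> R) (a b c d x : R).
Notation mu := (@lebesgue_measure R).

Lemma sum_increments_sorted f (s : seq (R * R)) c d :
  {homo f : x y / x <= y} -> c <= d ->
  pairwise (fun i j : R * R => i.2 < j.1) s ->
  all (fun i : R * R => [&& c < i.1, i.1 < i.2 & i.2 < d]) s ->
  \sum_(i <- s) (f i.2 - f i.1) <= f d - f c.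
Proof.
move=> mf; elim: s c => [|[a b] s IH] c cd /=.
  by rewrite big_nil subr_ge0 => _ _; exact: mf.
move=> /andP[abs ps] /andP[/and3P[/= ca ab bd] als].
rewrite big_cons /=.
have : \sum_(i <- s) (f i.2 - f i.1) <= f d - f b.
  apply: IH => //; first exact: ltW.
  apply/allP => i si; have /and3P[_ i12 i2d] := allP als _ si.
  by have /= -> := allP abs _ si; rewrite i12 i2d.
by have := mf _ _ (ltW ca); lra.
Qed.

Definition disjoint_itvs (s : seq (R * R)) := uniq s /\
  forall i j, i \in s -> j \in s -> i != j -> (i.2 < j.1) || (j.2 < i.1).

Lemma sum_increments f (s : seq (R * R)) c d :
  {homo f : x y / x <= y} -> c <= d -> disjoint_itvs s ->
  all (fun i : R * R => [&& c < i.1, i.1 < i.2 & i.2 < d]) s ->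
  \sum_(i <- s) (f i.2 - f i.1) <= f d - f c.
Proof.
move=> mf cd [us ds] als.
pose le1 := fun i j : R * R => i.1 <= j.1.
have le1t : total le1 by move=> i j; exact: le_total.
have le1tr : transitive le1 by move=> j i k; exact: le_trans.
have pm : perm_eq (sort le1 s) s by rewrite perm_sort.
rewrite -(perm_big _ pm); apply: sum_increments_sorted => //; last first.
  by rewrite (perm_all _ pm).
have := sort_sorted le1t s; rewrite (sorted_pairwise le1tr).
have {}us : uniq (sort le1 s) by rewrite sort_uniq.
have {}ds i j : i \in sort le1 s -> j \in sort le1 s -> i != j ->
  (i.2 < j.1) || (j.2 < i.1) by rewrite !mem_sort; exact: ds.
rewrite -(perm_all _ pm) in als.
elim: (sort le1 s) us ds als => [//|a t IH] /= /andP[ait ut] dt.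
move=> /andP[/and3P[ca ab bd] alt] /andP[lt pl].
rewrite IH ?andbT//; last first.
  by move=> i j it jt; apply: dt; rewrite inE ?it ?jt orbT.
apply/allP => a' it /=; have := allP lt _ it; rewrite /le1 => aa.
have /and3P[_ ab' _] := allP alt _ it.
have : a != a' by apply: contraNneq ait => ->.
move=> /(dt a a'); rewrite !inE eqxx it orbT => /(_ isT isT)/orP[//|ba].
by have := lt_trans ab' ba; rewrite ltNge aa.
Qed.

(* The codes that are not pairs [a < b] get the junk value [(0, 1)]. *)
Definition rat_itv (n : nat) : R * R :=
  if (unpickle n : option (rat * rat)) is Some (a, b)
  then if a < b then (ratr a, ratr b) else (0, 1) else (0, 1).

Lemma rat_itv_lt n : (rat_itv n).1 < (rat_itv n).2.
Proof.
rewrite /rat_itv; case: (unpickle n : option (rat * rat)) => [[a b]|] /=; last exact: ltr01.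
by case: ifPn => [ab|_] /=; [rewrite ltr_rat|exact: ltr01].
Qed.

Lemma rat_itvP (a b : rat) : a < b -> exists n, rat_itv n = (ratr a, ratr b).
Proof. by move=> ab; exists (pickle (a, b)); rewrite /rat_itv pickleK ab. Qed.

Definition rat_ball n : set R :=
  ball (((rat_itv n).1 + (rat_itv n).2) / 2) (((rat_itv n).2 - (rat_itv n).1) / 2).

Lemma radius_rat_ball n :
  (radius (rat_ball n))%:num = ((rat_itv n).2 - (rat_itv n).1) / 2.
Proof. by rewrite radius_ball_num//; have := rat_itv_lt n; lra. Qed.

Lemma rat_ballE n : rat_ball n = [set` `](rat_itv n).1, (rat_itv n).2[].
Proof.
rewrite /rat_ball ball_itv; case: (rat_itv n) => a b /=.
by have [-> ->] : (a + b) / 2 - (b - a) / 2 = a /\ (a + b) / 2 + (b - a) / 2 = b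
  by split; lra.
Qed.

Lemma closure_rat_ball n : closure (rat_ball n) = [set` `[(rat_itv n).1, (rat_itv n).2]].
Proof.
rewrite closure_ballE closed_ball_itv; last by have := rat_itv_lt n; lra.
case: (rat_itv n) => a b /=.
by have [-> ->] : (a + b) / 2 - (b - a) / 2 = a /\ (a + b) / 2 + (b - a) / 2 = b
  by split; lra.
Qed.

(** Intervals with rational endpoints form a sequence, which is the kind of family the Vitali
    covering theorem is applied to. The open set [O] confines the chosen intervals. *)
Lemma vitali_rational (P : R -> R -> Prop) (A O : set R) (e : R) :
  0 < e -> open O -> A `<=` O -> (mu A < +oo)%E ->
  (forall x, A x -> forall e : R, 0 < e -> exists a b : rat,
     [/\ ratr a < x, x < ratr b, ratr b - ratr a < e & P (ratr a) (ratr b)]) ->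
  exists s : seq (R * R),
    [/\ disjoint_itvs s,
        forall i, i \in s -> [/\ i.1 < i.2, P i.1 i.2 & [set` `[i.1, i.2]] `<=` O] &
        (mu (A `\` \big[setU/set0]_(i <- s) [set` `[i.1, i.2]]) < e%:E)%E].
Proof.
move=> e0 oO AO Afin AP.
pose F := [set n | P (rat_itv n).1 (rat_itv n).2 /\ closure (rat_ball n) `<=` O].
have cov : vitali_cover A rat_ball F.
  split; first by move=> i; exact: is_ball_ball.
  move=> x Ax r r0.
  have /nbhs_ballP[/= r1 r10 xO] : nbhs x O by exact: oO (AO _ Ax).
  have [|a [b [ax xb ba Pab]]] := AP x Ax (Num.min r r1).
    by rewrite lt_min r0.
  have [|n nab] := @rat_itvP a b; first by rewrite -(ltr_rat R); lra.
  move: ba; rewrite lt_min => /andP[bar bar1].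
  exists n; split.
  - rewrite /F /= closure_rat_ball nab /=; split => // y.
    rewrite /= in_itv /= => /andP[ay yb]; apply: xO.
    by rewrite /ball /= ltr_norml; apply/andP; split; lra.
  - by rewrite rat_ballE nab /= in_itv /= ax xb.
  - by rewrite radius_rat_ball nab /=; lra.
have rp n : 0 < (radius (rat_ball n))%:num.
  by rewrite radius_rat_ball; have := rat_itv_lt n; lra.
have [G [GF Gt Ge]] := vitali_theorem_corollary rp Afin cov e0.
exists [seq rat_itv n | n <- enum_fset G]; split.
- have dG n m : n \in enum_fset G -> m \in enum_fset G -> n != m ->
      ((rat_itv n).2 < (rat_itv m).1) || ((rat_itv m).2 < (rat_itv n).1).
    move=> nG mG nm; move/trivIsetP : Gt => /(_ _ _ nG mG nm) /=.
    rewrite !closure_rat_ball.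
    set p := rat_itv _; set q := rat_itv _ => pq.
    rewrite -[_ || _]negbK negb_or -!leNgt; apply/negP => /andP[qp pq'].
    have p12 : p.1 < p.2 by exact: rat_itv_lt.
    have q12 : q.1 < q.2 by exact: rat_itv_lt.
    (* If neither interval precedes the other, the larger of the left endpoints lies in both. *)
    suff : set0 (Num.max p.1 q.1) by [].
    rewrite -pq; split; rewrite /= in_itv /= ?le_max ?lexx ?orbT //= ge_max.
      by rewrite (ltW p12) qp.
    by rewrite (ltW q12) pq'.
  split.
    rewrite map_inj_in_uniq ?fset_uniq// => n m nG mG nm; apply/eqP.
    apply: contraT => /(dG _ _ nG mG); rewrite nm orbb => lt.
    by have := lt_trans lt (rat_itv_lt m); rewrite ltxx.
  move=> _ _ /mapP[n nG ->] /mapP[m mG ->] nm; apply: dG => //.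
  by apply: contraNneq nm => ->.
- move=> i /mapP[n nG ->]; have := rat_itv_lt n; have /= [Pn nO] := GF n nG.
  by rewrite -closure_rat_ball.
- rewrite big_map; rewrite (eq_bigr (closure \o rat_ball)) //.
  by move=> n _; rewrite /= closure_rat_ball.
Qed.

End VitaliRational.

(** * Steep and flat points of a monotone function *)

Section SteepFlat.
Variable R : realType.
Implicit Types (f : R -> R) (a b c d x : R).
Notation mu := (@lebesgue_measure R).
Notation om := (((@wlength R idfun)^*)%mu).

(** The intervals have [x] in their interior, so that they form a Vitali cover and their endpoints
    can be moved slightly. *)
Definition steep f (beta x : R) := forall e : R, 0 < e -> exists a b,
  [/\ a < x, x < b, b - a < e & beta * (b - a) < f b - f a].

Definition flat f (alpha x : R) := forall e : R, 0 < e -> exists a b,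
  [/\ a < x, x < b, b - a < e & f b - f a < alpha * (b - a)].

Lemma rat_between x y : x < y -> exists q : rat, x < ratr q < y.
Proof. by move=> /rat_in_itvoo[q]; rewrite in_itv /= => ?; exists q. Qed.

(** Moving the endpoints outwards does not decrease the increment of [f], and the strict inequality
    leaves room for the additional length. *)
Lemma steep_rat f (beta x : R) : {homo f : x y / x <= y} -> 0 < beta ->
  steep f beta x -> forall e : R, 0 < e -> exists a b : rat,
  [/\ ratr a < x, x < ratr b, ratr b - ratr a < e &
      beta * (ratr b - ratr a) < f (ratr b) - f (ratr a)].
Proof.
move=> mf b0 st e e0; have [a [b [ax xb bae st1]]] := st e e0.
pose eta := Num.min ((e - (b - a)) / 2) ((f b - f a - beta * (b - a)) / (2 * beta)).
have eta0 : 0 < eta by rewrite lt_min !divr_gt0//; lra.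
have [a' /andP[a'1 a'2]] : exists q : rat, a - eta < ratr q < a.
  by apply: rat_between; lra.
have [b' /andP[b'1 b'2]] : exists q : rat, b < ratr q < b + eta.
  by apply: rat_between; lra.
have e1 : eta <= (e - (b - a)) / 2 by rewrite ge_min lexx.
have e2 : eta <= (f b - f a - beta * (b - a)) / (2 * beta).
  by rewrite ge_min lexx orbT.
have {}e2 : 2 * (beta * eta) <= f b - f a - beta * (b - a).
  by move: e2; rewrite ler_pdivlMr ?mulr_gt0//; lra.
have ba' : beta * (ratr b' - ratr a') < beta * (b - a + 2 * eta).
  by rewrite ltr_pM2l//; lra.
exists a', b'; split; [lra|lra|lra|].
by have := mf _ _ (ltW a'2); have := mf _ _ (ltW b'1); lra.
Qed.

(** Here the endpoints move inwards, which does not increase the increment of [f]; [eta] is also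
    bounded by the distances from [x] to the endpoints, so that [x] stays inside. *)
Lemma flat_rat f (alpha x : R) : {homo f : x y / x <= y} -> 0 < alpha ->
  flat f alpha x -> forall e : R, 0 < e -> exists a b : rat,
  [/\ ratr a < x, x < ratr b, ratr b - ratr a < e &
      f (ratr b) - f (ratr a) < alpha * (ratr b - ratr a)].
Proof.
move=> mf b0 st e e0; have [a [b [ax xb bae st1]]] := st e e0.
pose eta := Num.min (Num.min (x - a) (b - x)) 
  ((alpha * (b - a) - (f b - f a)) / (2 * alpha)).
have eta0 : 0 < eta by rewrite !lt_min !divr_gt0//; lra.
have e1 : eta <= x - a by rewrite !ge_min lexx.
have e3 : eta <= b - x by rewrite !ge_min lexx orbT.
have e2 : eta <= (alpha * (b - a) - (f b - f a)) / (2 * alpha).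
  by rewrite ge_min lexx orbT.
have {}e2 : 2 * (alpha * eta) <= alpha * (b - a) - (f b - f a).
  by move: e2; rewrite ler_pdivlMr ?mulr_gt0//; lra.
have [a' /andP[a'1 a'2]] : exists q : rat, a < ratr q < a + eta.
  by apply: rat_between; lra.
have [b' /andP[b'1 b'2]] : exists q : rat, b - eta < ratr q < b.
  by apply: rat_between; lra.
have ba' : alpha * (b - a - 2 * eta) < alpha * (ratr b' - ratr a').
  by rewrite ltr_pM2l//; lra.
exists a', b'; split; [lra|lra|lra|].
by have := mf _ _ (ltW a'1); have := mf _ _ (ltW b'2); lra.
Qed.

Lemma om_bigU (I : eqType) (s : seq I) (F : I -> set R) :
  (om (\big[setU/set0]_(i <- s) F i) <= \sum_(i <- s) om (F i))%E.
Proof.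
elim: s => [|i s IH]; first by rewrite !big_nil outer_measure0.
by rewrite !big_cons; apply: (le_trans (outer_measureU2 _ _ _)); exact: leeD2l.
Qed.

Lemma om_itv (i : R * R) : i.1 < i.2 -> om [set` `[i.1, i.2]] = (i.2 - i.1)%:E.
Proof.
move=> i12; rewrite -[om _]/(mu [set` `[i.1, i.2]]) lebesgue_measure_itv /=.
by rewrite lte_fin i12.
Qed.

(* The increments of [f] over a Vitali cover by steep intervals add up to at
   most the increment of [f]. *)
Lemma om_steep f c d (beta : R) (A : set R) : {homo f : x y / x <= y} ->
  0 < beta -> c < d -> A `<=` [set` `]c, d[] ->
  (forall x, A x -> steep f beta x) ->
  (beta%:E * om A <= (f d - f c)%:E)%E.
Proof.
move=> mf b0 cd Acd Ast.
have Afin : (om A < +oo)%E.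
  apply: (@le_lt_trans _ _ (om [set` `[c, d]])).
    apply: le_outer_measure => x /Acd; rewrite /= !in_itv /= => /andP[cx xd].
    by rewrite !ltW.
  by rewrite (@om_itv (c, d))// ltry.
apply/lee_addgt0Pr => e e0.
have eb : 0 < e / beta by rewrite divr_gt0.
have oO : open [set` `]c, d[] by exact: interval_open.
have [s [ds sP sA]] := @vitali_rational R
  (fun a b => beta * (b - a) < f b - f a) _ _ _ eb oO Acd Afin
  (fun x Ax => steep_rat mf b0 (Ast x Ax)).
have fs : \sum_(i <- s) (f i.2 - f i.1) <= f d - f c.
  apply: sum_increments => //; first exact: ltW.
  apply/allP => i si; have [i12 _ icd] := sP i si.
  have : [set` `]c, d[] i.1 by apply: icd; rewrite /= in_itv /= lexx ltW.
  have : [set` `]c, d[] i.2 by apply: icd; rewrite /= in_itv /= lexx ltW.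
  by rewrite /= !in_itv /= => /andP[_ ->] /andP[-> _]; rewrite i12.
have bs : beta * \sum_(i <- s) (i.2 - i.1) <= \sum_(i <- s) (f i.2 - f i.1).
  rewrite mulr_sumr big_seq [leRHS]big_seq; apply: ler_sum => i si.
  by have [_ /ltW] := sP i si.
have omA : (om A <= (e / beta + \sum_(i <- s) (i.2 - i.1))%:E)%E.
  rewrite EFinD -sumEFin.
  set U := \big[setU/set0]_(i <- s) [set` `[i.1, i.2]] in sA.
  apply: (@le_trans _ _ (om ((A `\` U) `|` U))).
    by apply: le_outer_measure => x Ax; have [?|?] := pselect (U x); [right|left].
  apply: (le_trans (outer_measureU2 _ _ _)); apply: leeD; first exact: ltW.
  apply: (le_trans (om_bigU _ _)); rewrite big_seq [leRHS]big_seq.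
  by apply: lee_sum => i si; rewrite om_itv//; have [] := sP i si.
have : (beta%:E * om A <= beta%:E * (e / beta + \sum_(i <- s) (i.2 - i.1))%:E)%E.
  by rewrite lee_pmul2l// lte_fin.
move=> /le_trans; apply; rewrite -EFinM -EFinD lee_fin mulrDr.
rewrite [beta * (e / beta)]mulrC divfK ?gt_eqF//; lra.
Qed.

(** Cover the set [A] by flat intervals of total length at most [om A + e]. Each of them has
    increment at most [alpha] times its length, so by [om_steep] its steep points have outer measure
    at most [alpha / beta] times its length. Summing gives [beta m <= beta e + alpha (m + e)], which
    forces [m = 0]. Measurability of [A] is not known, hence outer measure throughout. *)
Lemma om_steep_flat f (alpha beta n : R) : {homo f : x y / x <= y} ->
  0 < alpha -> alpha < beta -> 
  om [set x | [/\ - n < x, x < n, steep f beta x & flat f alpha x]] = 0%E.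
Proof.
move=> mf a0 ab; set A := [set x | _].
have b0 : 0 < beta by lra.
have omi_fin : (om [set` `[(-n)%R, n]] < +oo)%E.
  rewrite -[om _]/(mu [set` `[(-n)%R, n]]) lebesgue_measure_itv /=.
  by case: ifP => _; rewrite ?ltry.
have Afin : (om A < +oo)%E.
  apply: le_lt_trans omi_fin.
  by apply: le_outer_measure => x [/ltW nx /ltW xn _ _]; rewrite /= in_itv /= nx.
have A0 : (0 <= om A)%E by exact: outer_measure_ge0.
have Anum : om A = (fine (om A))%:E by rewrite fineK// ge0_fin_numE.
set m := fine (om A) in Anum.
suff H : forall e : R, 0 < e -> beta * m <= beta * e + alpha * (m + e).
  rewrite Anum; congr (_%:E); apply/eqP; rewrite eq_le; apply/andP; split; last first.
    by rewrite -lee_fin -Anum.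
  rewrite leNgt; apply/negP => m0.
  have e0 : 0 < (beta - alpha) * m / (2 * (beta + alpha)).
    by rewrite divr_gt0// mulr_gt0//; lra.
  have := H _ e0; set e := _ / _ => He.
  have : (beta + alpha) * e = (beta - alpha) * m / 2.
    rewrite /e; field; lra.
  have : 0 < (beta - alpha) * m by rewrite mulr_gt0//; lra.
  lra.
move=> e e0.
(* An open set of nearly the same outer measure keeps the cover from being longer than
   [om A + e]. *)
have [W [oO AO muO]] := @outer_measure_open_le R A e e0.
have [s [ds sP sA]] := @vitali_rational R
  (fun a b => f b - f a < alpha * (b - a)) _ _ _ e0 oO AO Afin
  (fun x Ax => flat_rat mf a0 (let: And4 _ _ _ h := Ax in h)).
set U := \big[setU/set0]_(i <- s) [set` `[i.1, i.2]] in sA.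
have omU : ((\sum_(i <- s) (i.2 - i.1))%:E <= mu W)%E.
  case: ds => us ds; apply: (@le_trans _ _ (mu U)); last first.
    by apply: le_outer_measure => x; rewrite /U -bigcup_seq => -[i /sP[_ _]]; apply.
  rewrite /U -bigcup_seq measure_fin_bigcup//=; last 2 first.
    by exact: finite_seq.
    move=> i j si sj [x []]; rewrite /= !in_itv /= => /andP[ix xi] /andP[jx xj].
    apply/eqP; apply: contraT => /(ds i j si sj)/orP[h|h].
      by have := lt_le_trans h (le_trans jx xi); rewrite ltxx.
    by have := lt_le_trans h (le_trans ix xj); rewrite ltxx.
  rewrite -sumEFin fsbig_seq//; apply: lee_fsum => [|i si]; first exact: finite_seq.
  by have [i12 _ _] := sP i si; rewrite -om_itv.
have omAi i : i \in s ->
    (beta%:E * om (A `&` [set` `[i.1, i.2]]) <= (alpha * (i.2 - i.1))%:E)%E.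
  move=> si; have [i12 fi _] := sP i si.
  have : (beta%:E * om (A `&` [set` `]i.1, i.2[]) <= (f i.2 - f i.1)%:E)%E.
    by apply: om_steep => // x [[]].
  have : (om (A `&` [set` `[i.1, i.2]]) <= om (A `&` [set` `]i.1, i.2[]))%E.
    pose E : set R := [set i.1; i.2].
    apply: (@le_trans _ _ (om ((A `&` [set` `]i.1, i.2[]) `|` E))).
      apply: le_outer_measure => x [Ax]; rewrite /= !in_itv /= => /andP[].
      rewrite le_eqVlt => /predU1P[<- _|ix]; first by right; left.
      rewrite le_eqVlt => /predU1P[->|xi]; first by right; right.
      have xii : x \in `]i.1, i.2[ by rewrite in_itv /= ix xi.
      by left; split; [exact: Ax|exact: xii].
    apply: (le_trans (outer_measureU2 _ _ _)).
    rewrite -[leRHS]adde0; apply: leeD2l; rewrite le_eqVlt; apply/orP; left.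
    apply/eqP/(@countable_lebesgue_measure0 R E); apply: finite_set_countable.
    exact: finite_set2.
  have bE : (0 < beta%:E)%E by rewrite lte_fin.
  rewrite -(lee_pmul2l _ bE)// => /le_trans h /h /le_trans; apply.
  by rewrite lee_fin ltW.
have omA : (om A <= e%:E + \sum_(i <- s) om (A `&` [set` `[i.1, i.2]]))%E.
  apply: (@le_trans _ _ (om ((A `\` U) `|`
      \big[setU/set0]_(i <- s) (A `&` [set` `[i.1, i.2]])))).
    apply: le_outer_measure => x Ax; have [Ux|?] := pselect (U x); [right|by left].
    by move: Ux; rewrite /U -!bigcup_seq => -[i si xi]; exists i.
  apply: (le_trans (outer_measureU2 _ _ _)); apply: leeD; first exact: ltW.
  exact: om_bigU.
rewrite -lee_fin EFinM -Anum.
have bE : (0 < beta%:E)%E by rewrite lte_fin.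
move: omA; rewrite -(lee_pmul2l _ bE)// => /le_trans; apply.
rewrite ge0_muleDr//; last by apply: sume_ge0 => i _; exact: outer_measure_ge0.
rewrite EFinD EFinM leeD2l// ge0_sume_distrr; last first.
  by move=> i _; exact: outer_measure_ge0.
apply: (@le_trans _ _ (\sum_(i <- s) (alpha * (i.2 - i.1))%:E)%E).
  by rewrite big_seq [leRHS]big_seq; apply: lee_sum => i si; exact: omAi.
rewrite sumEFin -mulr_sumr lee_fin ler_pM2l//.
by rewrite -lee_fin; apply: (le_trans omU); rewrite (le_trans muO)// Anum -EFinD.
by rewrite lee_fin ltW.
Qed.

End SteepFlat.

(** * Lebesgue's differentiation theorem *)

Section MonotoneDifferentiation.
Variable R : realType.
Implicit Types (f : R -> R) (a b c d x : R).
Notation mu := (@lebesgue_measure R).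
Notation om := (((@wlength R idfun)^*)%mu).

(* For monotone [f] this is differentiability at [x], phrased with intervals
   having [x] in their interior. *)
Definition straddle_diff f (D x : R) := forall e : R, 0 < e -> exists2 d : R,
  0 < d & forall a b, a < x -> x < b -> b - a < d ->
    `|f b - f a - D * (b - a)| <= e * (b - a).

(** If no upper slope bound smaller than the lower slope can be separated from it by grid fractions,
    the upper and lower slopes at [x] coincide; finiteness comes from [x] not being steep at level
    [k + 1]. *)
Lemma straddle_diff_notin f x (k : nat) : {homo f : x y / x <= y} ->
  ~ steep f k.+1%:R x ->
  (forall i j : nat, ~ (steep f (i.+2%:R / j.+1%:R) x /\
                        flat f (i.+1%:R / j.+1%:R) x)) ->
  exists D, straddle_diff f D x.
Proof.
move=> mf nst nE.
(* The slopes that bound all short straddling increments; the infimum is the upper derivative at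
   [x], and it is the witness. *)
pose S := [set beta : R | 0 <= beta /\ exists2 e : R, 0 < e & forall a b,
  a < x -> x < b -> b - a < e -> f b - f a <= beta * (b - a)].
have nsteepS beta : 0 <= beta -> ~ steep f beta x -> S beta.
  move=> b0 ns; split => //; apply: contrapT => nS; apply: ns => e e0.
  apply: contrapT => nex; apply: nS; exists e => // a b ax xb ba.
  by rewrite leNgt; apply/negP => lt; apply: nex; exists a, b.
have S0 : S !=set0 by exists k.+1%:R; apply: nsteepS.
have lbS : has_lbound S by exists 0 => y [].
exists (inf S) => e e0.
have [b1 [b10 [e1 e10 H1]] b1lt] := inf_adherent e0 (conj S0 lbS).
suff [e2 e20 H2] : exists2 e2 : R, 0 < e2 & forall a b, a < x -> x < b ->
    b - a < e2 -> (inf S - e) * (b - a) <= f b - f a.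
  exists (Num.min e1 e2); first by rewrite lt_min e10.
  move=> a b ax xb; rewrite lt_min => /andP[ba1 ba2].
  have := H2 _ _ ax xb ba2; have := H1 _ _ ax xb ba1.
  have : b1 * (b - a) <= (inf S + e) * (b - a) by rewrite ler_wpM2r; lra.
  by move=> ? ? ?; rewrite ler_norml; apply/andP; split; lra.
apply: contrapT => nlow.
have fl : flat f (inf S - e) x.
  move=> d d0; apply: contrapT => nex; apply: nlow; exists d => // a b ax xb ba.
  by rewrite leNgt; apply/negP => lt; apply: nex; exists a, b.
have De : 0 < inf S - e.
  have [a [b [ax xb _ lt]]] := fl 1 ltr01.
  have := mf _ _ (ltW (lt_trans ax xb)).
  rewrite -subr_ge0 => /le_lt_trans/(_ lt).
  by rewrite pmulr_lgt0//; lra.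
(* The mesh [1 / (j + 1)] is below [e / 2], so two consecutive grid fractions fit strictly between
   [inf S - e], where [x] is flat, and [inf S], below which [x] is steep. *)
pose j := Num.truncn (2 / e); pose i := Num.truncn ((inf S - e) * j.+1%:R).
have j0 : 0 < j.+1%:R :> R by rewrite ltr0n.
have jP : 2 < e * j.+1%:R.
  by rewrite mulrC -ltr_pdivrMr//; exact: truncnS_gt.
have iP : i%:R <= (inf S - e) * j.+1%:R < i.+1%:R.
  by apply: truncn_itv; rewrite mulr_ge0// ltW.
apply: (nE i j); split.
  have bS : ~ S (i.+2%:R / j.+1%:R).
    move=> Sb; have := ge_inf lbS Sb.
    by rewrite ler_pdivlMr// -natr1 -natr1; move: iP => /andP[? ?]; lra.
  apply: contrapT => /nsteepS; apply: contra_not bS; apply.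
  by rewrite divr_ge0.
move=> d d0; have [a [b [ax xb ba lt]]] := fl d d0; exists a, b; split => //.
apply: (lt_le_trans lt); rewrite ler_pM2r//; last lra.
by rewrite ler_pdivlMr//; move: iP => /andP[? ?]; lra.
Qed.

Lemma negligible_bigcup2 (F : nat -> nat -> set R) :
  (forall i j, mu.-negligible (F i j)) -> mu.-negligible (\bigcup_i \bigcup_j F i j).
Proof. by move=> h; do 2 (apply: negligible_bigcup => ?). Qed.

(** The exceptional points are steep at every level ([A]) or have a gap between upper and lower
    slopes ([E]). Restricting to bounded intervals makes the increment of [f] finite, and countably
    many sets cover all cases. *)
Lemma monotone_straddle_diff f : {homo f : x y / x <= y} ->
  mu.-negligible [set x | ~ exists D, straddle_diff f D x].
Proof.
move=> mf.
pose A n := [set x | [/\ - n.+1%:R < x, x < n.+1%:R & forall k : nat, steep f k.+1%:R x]].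
pose E (n i j : nat) := [set x : R | [/\ - n.+1%:R < x, x < n.+1%:R,
  steep f (i.+2%:R / j.+1%:R) x & flat f (i.+1%:R / j.+1%:R) x]].
have negA n : mu.-negligible (A n).
  apply/negligible_outer_measure/eqP; rewrite eq_le outer_measure_ge0 andbT.
  apply/lee_addgt0Pr => e e0; rewrite add0e.
  pose w := f n.+1%:R - f (- n.+1%:R).
  have n0 : 0 < n.+1%:R :> R by rewrite ltr0n.
  have w0 : 0 <= w by rewrite subr_ge0; apply: mf; lra.
  (* A level so high that [om_steep] bounds the measure by [w / (k + 1) < e]. *)
  pose k := Num.truncn (w / e).
  have k0 : 0 < k.+1%:R :> R by rewrite ltr0n.
  have kP : w < k.+1%:R * e by rewrite -ltr_pdivrMr//; exact: truncnS_gt.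
  have : (k.+1%:R%:E * om (A n) <= w%:E)%E.
    apply: om_steep => //; first lra.
      by move=> x [x1 x2 _]; rewrite /= in_itv /= x1.
    by move=> x [].
  move=> /le_trans => /(_ (k.+1%:R * e)%:E); rewrite lee_fin => /(_ (ltW kP)).
  by rewrite EFinM lee_pmul2l// lte_fin.
have negE n i j : mu.-negligible (E n i j).
  apply/negligible_outer_measure; apply: om_steep_flat => //.
  by rewrite ltr_pM2r ?invr_gt0 ?ltr0n// ltr_nat.
have : mu.-negligible ((\bigcup_n A n) `|` \bigcup_n \bigcup_i \bigcup_j E n i j).
  apply: negligibleU; first exact: negligible_bigcup.
  by apply: negligible_bigcup => n; apply: negligible_bigcup2.
apply: negligibleS => x /= nd; apply: contrapT => /not_orP[nA nE]; apply: nd.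
pose n := Num.truncn `|x|.
have : `|x| < n.+1%:R by exact: truncnS_gt.
rewrite ltr_norml => /andP[x1 x2].
have [k nk] : exists k : nat, ~ steep f k.+1%:R x.
  by apply: contrapT => /forallNP h; apply: nA; exists n => //; split => // k;
    exact: contrapT (h k).
apply: (straddle_diff_notin mf nk) => i j [st fl]; apply: nE.
by exists n => //; exists i => //; exists j.
Qed.

(** For a nondecreasing function a lower slope bound off a null set integrates without absolute
    continuity: singular growth only helps. *)
Lemma increment_ge f c d (beta : R) (N : set R) : {homo f : x y / x <= y} ->
  mu.-negligible N -> c < d ->
  (forall x, c < x < d -> ~ N x -> steep f beta x) ->
  beta * (d - c) <= f d - f c.
Proof.
move=> mf negN cd st.
have [b0|b0] := leP beta 0.
  apply: (@le_trans _ _ 0); first by apply: mulr_le0_ge0 => //; lra.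
  by rewrite subr_ge0; apply: mf; exact: ltW.
have N0 : om N = 0%E by exact/negligible_outer_measure.
have : (beta%:E * om ([set` `]c, d[] `\` N) <= (f d - f c)%:E)%E.
  apply: (om_steep mf b0 cd) => x []; first by [].
  by rewrite /= in_itv /= => cxd nN; exact: st.
have : ((d - c)%:E <= om ([set` `]c, d[] `\` N))%E.
  have -> : (d - c)%:E = om [set` `]c, d[].
    by rewrite -[om _]/(mu [set` `]c, d[]) lebesgue_measure_itv /= lte_fin cd.
  apply: (@le_trans _ _ (om (([set` `]c, d[] `\` N) `|` N))).
    by apply: le_outer_measure => x xcd; have [?|?] := pselect (N x); [right|left].
  apply: (le_trans (outer_measureU2 _ _ _)).
    by rewrite -[leRHS]adde0; apply: leeD2l; rewrite le_eqVlt; apply/orP; left; exact/eqP.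
have bE : (0 < beta%:E)%E by rewrite lte_fin.
by rewrite -(lee_pmul2l _ bE)// => /le_trans h /h; rewrite -EFinM lee_fin.
Qed.

End MonotoneDifferentiation.

(** * Averaging a family of Dini estimates *)

Section Averaging.
Variable R : realType.
Notation mu := (@lebesgue_measure R).

Lemma lipschitz_continuous (K : R) (h : R -> R) :
  (forall p q, `|h p - h q| <= K * `|p - q|) -> continuous h.
Proof.
move=> hK p; apply/cvgrPdist_le => e e0.
have K0 : 0 < `|K| + 1 by rewrite ltr_wpDl.
near=> q; apply: (le_trans (hK p q)).
apply: (@le_trans _ _ ((`|K| + 1) * `|p - q|)).
  by apply: ler_wpM2r => //; have := ler_norm K; lra.
rewrite mulrC -ler_pdivlMr//; near: q.
have e1 : 0 < e / (`|K| + 1) by rewrite divr_gt0.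
exists (e / (`|K| + 1)) => //= q /=; exact: ltW.
Unshelve. all: by end_near. Qed.

Lemma lipschitz_integrable (K a b : R) (h : R -> R) :
  (forall p q, `|h p - h q| <= K * `|p - q|) ->
  mu.-integrable [set` `[a, b]] (EFin \o h).
Proof.
move=> hK; apply: continuous_compact_integrable; first exact: segment_compact.
exact/continuous_subspaceT/(lipschitz_continuous hK).
Qed.

(** An upper bound on [h] is enough for dominated convergence once [h] is replaced by its maximum
    with [kappa], which is eventually equal to [kappa] at almost every [p]. The factor 3/2 is slack
    for stopping at a finite [n]. *)
Lemma integral_eventually_lt (delta kappa C : R) (h : nat -> R -> R) (K : nat -> R) :
  0 < delta -> 0 < kappa ->
  (forall n p q, `|h n p - h n q| <= K n * `|p - q|) ->
  (forall n p, 0 <= p <= delta -> h n p <= C) ->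
  mu.-negligible [set p | 0 <= p <= delta /\
     ~ exists N, forall n, (N <= n)%N -> h n p <= kappa] ->
  exists n, \int[mu]_(p in [set` `[0, delta]]) h n p <= 3 / 2 * kappa * delta.
Proof.
move=> d0 k0 hK hC neg; set D := [set` `[0, delta]].
pose g n p := Num.max (h n p) kappa.
have gK n p q : `|g n p - g n q| <= K n * `|p - q|.
  apply: (le_trans _ (hK n p q)); rewrite /g.
  have /ler_normlP[h1 h2] := lexx `|h n p - h n q|.
  case: (leP (h n p) kappa); case: (leP (h n q) kappa) => ? ?;
    rewrite ?subrr ?normr0// ler_norml; apply/andP; split; lra.
have iD : measurable (D : set R) by exact: measurable_itv.
have [|||||_ _ /=] := @dominated_convergence _ _ R mu D iD (fun n => EFin \o g n)
   (cst kappa%:E) (cst (`|C| + kappa)%:E).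
- by move=> n; have /integrableP[] := @lipschitz_integrable (K n) 0 delta (g n) (gK n).
- exact: measurable_cst.
- apply: negligibleS neg => p /= /not_implyP[pD ncv].
  move: pD; rewrite /D /= in_itv /= => pD; split => // -[N HN]; apply: ncv.
  apply: cvg_near_cst; exists N => // n /= Nn.
  by rewrite /g; congr (_%:E); apply/max_idPr/HN.
- apply: (@lipschitz_integrable 0 0 delta (fun=> `|C| + kappa)) => p q.
  by rewrite subrr normr0 mul0r.
- apply: aeW => p n; rewrite /D /= in_itv /= => pD; rewrite lee_fin /g.
  have := hC n p pD; have := ler_norm C; case: (leP (h n p) kappa) => ? ? ?.
    by rewrite gtr0_norm//; have := normr_ge0 C; lra.
  by rewrite gtr0_norm; lra.
have muD : mu D = delta%:E by rewrite /D lebesgue_measure_itv /= lte_fin d0 sube0.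
have I0 : (\int[mu]_(x in D) cst kappa%:E x = (kappa * delta)%:E)%E.
  by rewrite integral_cst// EFinM; congr (_ * _)%E; exact: muD.
move=> cv; have {cv} : (\int[mu]_(x in D) (g n x)%:E)%E @[n --> \oo] --> (kappa * delta)%:E.
  by rewrite -I0; exact: cv.
move=> /fine_cvgP[_] /cvgrPdist_lt /(_ (kappa * delta / 2)) [|N _ /(_ N (leqnn N))].
  by rewrite divr_gt0// mulr_gt0.
rewrite /= => HN; exists N.
have le : \int[mu]_(p in D) h N p <= \int[mu]_(p in D) g N p.
  apply: le_Rintegral => //.
  - exact: lipschitz_integrable (hK N).
  - exact: lipschitz_integrable (gK N).
  - by move=> p _; rewrite /g le_max lexx.
apply: (le_trans le); move: HN; rewrite -/(Rintegral mu D (g N)).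
by move: (Rintegral _ _ _) => Y /ltr_normlP[h1 h2]; clear -h1 h2; lra.
Qed.

(** Continuity argument for the integral [I] of [M] over [p]. If the conclusion failed for every
    [p], then [I] would grow by at least [2 kappa T delta]; but it cannot grow faster than at rate
    [3/2 kappa delta], because the last time up to which this rate holds can be pushed further. *)
Lemma averaging (M : R -> R -> R) (delta T C K kappa : R) :
  0 < delta -> 0 < T -> 0 < kappa ->
  (forall p p' t, `|M p t - M p' t| <= K * `|p - p'|) ->
  (forall e : R, 0 < e -> exists2 d : R, 0 < d & forall p t s,
     0 <= t <= T -> 0 <= s <= T -> `|t - s| < d -> `|M p t - M p s| <= e) ->
  (forall p t s, 0 <= p <= delta -> 0 <= t -> t <= s -> s <= T ->
     M p s - M p t <= C * (s - t)) ->
  (forall t, 0 <= t < T -> mu.-negligible [set p | 0 <= p <= delta /\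
     ~ exists2 tau : R, 0 < tau & forall s, t <= s <= t + tau -> s <= T ->
         M p s <= M p t + kappa * (s - t)]) ->
  exists2 p, 0 <= p <= delta & M p T <= M p 0 + 2 * kappa * T.
Proof.
move=> d0 T0 k0 MK Mc MC Mae; apply: contrapT => nex.
have {}nex p : 0 <= p <= delta -> M p 0 + 2 * kappa * T < M p T.
  by move=> pd; rewrite ltNge; apply/negP => le; apply: nex; exists p.
set D := [set` `[0, delta]]; have mD : measurable (D : set R) by exact: measurable_itv.
have muD : fine (mu D) = delta.
  by rewrite /D lebesgue_measure_itv /= lte_fin d0 sube0.
pose I t := \int[mu]_(p in D) M p t.
have iM t : mu.-integrable D (EFin \o M ^~ t).
  exact: (@lipschitz_integrable K).
have iMB t s : mu.-integrable D (EFin \o (fun p => M p t - M p s)).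
  apply: (@lipschitz_integrable (K + K)) => p q; rewrite mulrDl.
  have -> : M p t - M p s - (M q t - M q s) = (M p t - M q t) - (M p s - M q s) by lra.
  by apply: (le_trans (ler_normB _ _)); apply: lerD.
have icst c : mu.-integrable D (EFin \o (fun=> c)).
  by apply: (@lipschitz_integrable 0) => p q; rewrite subrr normr0 mul0r.
have IB t s c : (forall p, 0 <= p <= delta -> M p t - M p s <= c) ->
    I t - I s <= c * delta.
  move=> h; rewrite /I -RintegralB//.
  apply: (@le_trans _ _ (\int[mu]_(p in D) c)).
    by apply: le_Rintegral => // p; rewrite /D /= in_itv /=; exact: h.
  by rewrite Rintegral_cst// muD.
have Ic e : 0 < e -> exists2 d : R, 0 < d & forall t s,
     0 <= t <= T -> 0 <= s <= T -> `|t - s| < d -> I t - I s <= e.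
  move=> e0; have [|d dd H] := Mc (e / delta); first by rewrite divr_gt0.
  exists d => // t s tT sT ts; have -> : e = e / delta * delta by rewrite divfK ?gt_eqF.
  by apply: IB => p _; have /ler_normlP[_] := H p t s tT sT ts.
have IT : 2 * kappa * T * delta <= I T - I 0.
  have h p : 0 <= p <= delta -> M p 0 - M p T <= - (2 * kappa * T).
    by move=> /nex; lra.
  by have := IB _ _ _ h; rewrite mulNr; move: (I T) (I 0) => x y; clear; lra.
pose S := [set t | 0 <= t <= T /\ I t <= I 0 + 3 / 2 * kappa * delta * t].
have S0 : S 0 by split; [rewrite lexx ltW|rewrite mulr0 addr0].
have Sub : has_ubound S by exists T => t [/andP[]].
have hS : has_sup S by split => //; exists 0.
pose t := sup S.
have t0 : 0 <= t by exact: ub_le_sup.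
have tT : t <= T by apply: ge_sup => [|s [/andP[]]//]; exists 0.
have St : I t <= I 0 + 3 / 2 * kappa * delta * t.
  apply/ler_addgt0Pr => e e0; have [d dd H] := Ic e e0.
  have [s [/andP[s0 sT] Ss] ts] := sup_adherent dd hS.
  have st : s <= t by apply: ub_le_sup => //; split => //; apply/andP.
  have := H t s; rewrite t0 tT s0 sT => /(_ isT isT).
  have tsd : t - s < d by rewrite -/t in ts; move: ts; clear; lra.
  rewrite ger0_norm ?subr_ge0// => /(_ tsd).
  have : kappa * delta * s <= kappa * delta * t by rewrite ler_wpM2l// ltW// mulr_gt0.
  by move: Ss; move: (I t) (I s) (I 0) => x y z; clear; lra.
have tlT : t < T.
  rewrite lt_neqAle tT andbT; apply/eqP => tT'.
  move: St IT; rewrite tT'.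
  have : 0 < kappa * delta * T by rewrite !mulr_gt0.
  by move: (I T) (I 0) => x y; clear; lra.
(* Times decreasing to [t]. The difference quotients at these times are bounded by [C], and at
   almost every [p] they are eventually at most [kappa]. *)
pose s n := t + (T - t) / n.+1%:R.
have st n : 0 < s n - t by rewrite /s addrC addKr divr_gt0// subr_gt0.
have sT n : s n <= T.
  rewrite /s -lerBrDl ler_pdivrMr// ler_peMr//; last by rewrite ler1n.
  by rewrite subr_ge0.
pose h n p := (s n - t)^-1 * (M p (s n) - M p t).
have [|||n hn] := @integral_eventually_lt delta kappa C h
    (fun n => (s n - t)^-1 * (K + K)) d0 k0.
- move=> n p q; rewrite /h -mulrBr normrM gtr0_norm ?invr_gt0// -mulrA.
  apply: ler_wpM2l; first by rewrite invr_ge0 ltW.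
  rewrite mulrDl.
  have -> : M p (s n) - M p t - (M q (s n) - M q t) =
    (M p (s n) - M q (s n)) - (M p t - M q t) by lra.
  by apply: (le_trans (ler_normB _ _)); apply: lerD.
- move=> n p pd; rewrite /h mulrC ler_pdivrMr//; apply: MC => //.
  by rewrite -subr_ge0 ltW.
- have := Mae t; rewrite t0 tlT => /(_ isT); apply: negligibleS => p /= [pd nN].
  split => // -[tau tau0 H]; apply: nN.
  pose N := Num.truncn ((T - t) / tau); exists N => n Nn.
  rewrite /h mulrC ler_pdivrMr// lerBlDl; apply: H => //.
  rewrite -subr_ge0 ltW//= /s lerD2l ler_pdivrMr// mulrC -ler_pdivrMr//.
  have /ltW/le_trans : (T - t) / tau < N.+1%:R by exact: truncnS_gt.
  by apply; rewrite ler_nat.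
have Isn : I (s n) - I t <= 3 / 2 * kappa * delta * (s n - t).
  rewrite mulrC -ler_pdivrMl//; apply: le_trans hn.
  by rewrite /h RintegralZl// RintegralB.
have : s n <= t.
  apply: ub_le_sup => //; split.
    by rewrite sT andbT; apply: (le_trans t0); rewrite -subr_ge0 ltW.
  by move: St Isn; move: (I t) (I 0) (I (s n)) => x y z; clear; lra.
by have := st n; lra.
Qed.

End Averaging.

(** * The measure-theoretic results for the Stdlib reals *)

Import Stdlib.Reals.Reals Stdlib.micromega.Lra.
Local Open Scope R_scope.

Definition null (E : R -> Prop) : Prop :=
  (@lebesgue_measure Rdefinitions.R).-negligible E.

Lemma null_or (E F : R -> Prop) : null E -> null F -> null (fun x => E x \/ F x).
Proof. by move=> nE nF; exact: negligibleU nE nF. Qed.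

Lemma null_sub (E F : R -> Prop) : (forall x, E x -> F x) -> null F -> null E.
Proof. by move=> EF; exact: negligibleS. Qed.

Lemma homo_stdlib (f : R -> R) : (forall x y, x <= y -> f x <= f y) ->
  {homo f : x y / (x <= y)%O}.
Proof. by move=> h x y /RleP xy; apply/RleP/h. Qed.

Lemma monotone_diff (f : R -> R) : (forall x y, x <= y -> f x <= f y) ->
  null (fun x => ~ exists D, forall e, 0 < e -> exists d, 0 < d /\ forall a b,
    a < x -> x < b -> b - a < d -> Rabs (f b - f a - D * (b - a)) <= e * (b - a)).
Proof.
move=> mf; apply: negligibleS (monotone_straddle_diff (homo_stdlib mf)).
move=> x /= nd [D HD]; apply: nd; exists D => e /RltP e0.
have [d /RltP d0 H] := HD e e0; exists d; split=> // a b /RltP ax /RltP xb /RltP ba.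
by have /RleP := H a b ax xb ba; rewrite RabsE.
Qed.

Lemma monotone_increment_ge (f : R -> R) (c d beta : R) (N : R -> Prop) :
  (forall x y, x <= y -> f x <= f y) -> null N -> c < d ->
  (forall x, c < x < d -> ~ N x -> forall e, 0 < e -> exists a b,
     [/\ a < x, x < b, b - a < e & beta * (b - a) < f b - f a]) ->
  beta * (d - c) <= f d - f c.
Proof.
move=> mf nN cd H; apply/RleP; apply: (increment_ge (homo_stdlib mf) nN).
  exact/RltP.
move=> x /andP[/RltP cx /RltP xd] nNx e /RltP e0.
have [a [b [/RltP ax /RltP xb /RltP ba /RltP st]]] := H x (conj cx xd) nNx e e0.
by exists a, b.
Qed.

Lemma averaging_stdlib (M : R -> R -> R) (delta T C K kappa : R) :
  0 < delta -> 0 < T -> 0 < kappa ->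
  (forall p p' t, Rabs (M p t - M p' t) <= K * Rabs (p - p')) ->
  (forall e, 0 < e -> exists d, 0 < d /\ forall p t s,
     0 <= t <= T -> 0 <= s <= T -> Rabs (t - s) < d -> Rabs (M p t - M p s) <= e) ->
  (forall p t s, 0 <= p <= delta -> 0 <= t -> t <= s -> s <= T ->
     M p s - M p t <= C * (s - t)) ->
  (forall t, 0 <= t < T -> null (fun p => 0 <= p <= delta /\
     ~ exists tau, 0 < tau /\ forall s, t <= s <= t + tau -> s <= T ->
         M p s <= M p t + kappa * (s - t))) ->
  exists p, 0 <= p <= delta /\ M p T <= M p 0 + 2 * kappa * T.
Proof.
move=> /RltP d0 /RltP T0 /RltP k0 MK Mc MC Mn.
have [||||p] := @averaging Rdefinitions.R M delta T C K kappa d0 T0 k0.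
- by move=> p p' t; have /RleP := MK p p' t; rewrite !RabsE.
- move=> e /RltP e0; have [d [/RltP dd H]] := Mc e e0; exists d => // p t s.
  move=> /andP[/RleP t0 /RleP tT] /andP[/RleP s0 /RleP sT] /RltP ts.
  by rewrite -RabsE; apply/RleP/H => //; rewrite RabsE.
- move=> p t s /andP[/RleP p0 /RleP pd] /RleP t0 /RleP ts /RleP sT.
  exact/RleP/MC.
- move=> t /andP[/RleP t0 /RltP tT]; apply: negligibleS (Mn t (conj t0 tT)).
  move=> p /= [/andP[/RleP p0 /RleP pd] nt]; split => // -[tau [/RltP tau0 H]].
  apply: nt; exists tau => // s /andP[/RleP ts /RleP st] /RleP sT.
  exact/RleP/H.
move=> /andP[/RleP p0 /RleP pd] /RleP H; exists p; split => //.
Qed.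

End Monotone.

From Stdlib Require Import Reals Lra Lia Psatz Classical ClassicalEpsilon.
From Coquelicot Require Import Coquelicot.
Import Monotone.
Local Open Scope R_scope.

(** * Slopes of test functions in time *)

Definition C1_pair (psi psi1 : R -> R) : Prop :=
  (forall s, is_derive psi s (psi1 s)) /\ (forall s, continuous psi1 s).

Definition touch_above (f psi : R -> R) (t : R) : Prop :=
  exists e, 0 < e /\ forall s, Rabs (s - t) < e -> f s <= f t + (psi s - psi t).

(** Maximize [f - psi], where [psi] has slope above [C] everywhere. Since nothing is assumed about
    touching at the endpoint [t1], a high power of [(s - t0) / tau] is added to make the maximum
    interior. Only touching times with [0 < f t] arise, as [psi] is nonnegative. *)
Lemma slope_bound (f : R -> R) (t0 t1 C : R) : t0 < t1 -> 0 <= C ->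
  (forall t, t0 <= t <= t1 -> continuity_pt f t) -> f t0 <= 0 ->
  (forall t psi psi1, t0 < t < t1 -> 0 < f t -> C1_pair psi psi1 ->
     touch_above f psi t -> psi1 t <= C) ->
  f t1 <= C * (t1 - t0).
Proof.
intros ht hC fc f0 H.
destruct (Rle_lt_dec (f t1) (C * (t1 - t0))) as [h|h]; [exact h|exfalso].
set (tau := t1 - t0) in *.
assert (htau : 0 < tau) by (unfold tau; lra).
(* A quarter of the excess at [t1]: [f t1 = C tau + 4 ga]. At [t1 - et] the extra linear term, the
   loss of continuity and the power term each cost at most one [ga]; at [t1] the power term alone
   costs [4 ga]. *)
set (ga := (f t1 - C * tau) / 4).
assert (hga : 0 < ga) by (unfold ga; lra).
set (ka := ga / tau).
assert (hka : 0 < ka) by (unfold ka; apply Rdiv_lt_0_compat; lra).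
assert (katau : ka * tau = ga) by (unfold ka; field; lra).
destruct (fc t1) with (eps := ga) as [d [hd Hd]]; [unfold tau in *; lra|lra|].
set (et := Rmin (d / 2) (tau / 2)).
assert (het : 0 < et) by (unfold et; apply Rmin_pos; lra).
assert (het1 : et <= d / 2) by apply Rmin_l.
assert (het2 : et <= tau / 2) by apply Rmin_r.
assert (fe : f t1 - ga < f (t1 - et)).
{ specialize (Hd (t1 - et)). unfold dist, R_met in Hd; simpl in Hd. unfold Rdist in Hd.
  assert (Hd' : Rabs (f (t1 - et) - f t1) < ga).
  { apply Hd. split.
    - split; [exact I|lra].
    - rewrite Rabs_left; lra. }
  apply Rabs_def2 in Hd'; lra. }
set (q := 1 - et / tau).
assert (hq : Rabs q < 1).
{ unfold q. assert (0 < et / tau) by (apply Rdiv_lt_0_compat; lra).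
  assert (et / tau <= / 2). { apply Rmult_le_reg_r with tau; [lra|]. unfold Rdiv; rewrite Rmult_assoc, Rinv_l by lra. lra. }
  rewrite Rabs_pos_eq; lra. }
(* The exponent makes the power less than 1/4 at [t1 - et], while it equals 1 at [t1]. *)
destruct (pow_lt_1_zero q hq (/ 4)) as [n Hn]; [lra|].
specialize (Hn (S n) (Nat.le_succ_diag_r n)).
set (psi := fun s => (C + ka) * (s - t0) + 4 * ga * ((s - t0) / tau) ^ (S n)).
set (psi1 := fun s => (C + ka) + 4 * ga * (INR (S n) * ((s - t0) / tau) ^ n / tau)).
assert (hpsi : C1_pair psi psi1).
{ split; intro s.
  - unfold psi, psi1. auto_derive; [exact I|].
    change (match n with 0%nat => 1 | S _ => INR n + 1 end) with (INR (S n)). unfold Rminus, Rdiv. ring.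
  - unfold psi1. apply (ex_derive_continuous (K := R_AbsRing) (V := R_NormedModule)).
    auto_derive. exact I. }
destruct (continuity_ab_maj (fun s => f s - psi s) t0 t1) as [tm [Hm htm]]; [lra| |].
{ intros c hc. apply continuity_pt_minus; [apply fc; exact hc|].
  apply derivable_continuous_pt. exists (psi1 c). apply is_derive_Reals. apply hpsi. }
assert (gt0 : f t0 - psi t0 <= 0).
{ unfold psi. replace (t0 - t0) with 0 by ring. unfold Rdiv at 1. rewrite Rmult_0_l, pow_i by lia. lra. }
assert (gt1 : f t1 - psi t1 < 0).
{ unfold psi. replace ((t1 - t0) / tau) with 1 by (unfold tau; field; unfold tau in htau; lra).
  rewrite pow1. fold tau. unfold ga in *. nra. }
assert (gte : 0 < f (t1 - et) - psi (t1 - et)).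
{ unfold psi. replace ((t1 - et - t0) / tau) with q by (unfold q, tau; field; unfold tau in htau; lra).
  apply Rabs_def2 in Hn. replace (t1 - et - t0) with (tau - et) by (unfold tau; ring).
  assert ((C + ka) * (tau - et) <= C * tau + ga).
  { rewrite <- katau. nra. }
  assert (f t1 = C * tau + 4 * ga) by (unfold ga; field). nra. }
assert (gm : 0 < f tm - psi tm).
{ eapply Rlt_le_trans; [exact gte|]. apply Hm. unfold tau in *; lra. }
assert (htm' : t0 < tm < t1).
{ split.
  - destruct (Rle_lt_or_eq_dec _ _ (proj1 htm)) as [l|e]; [exact l|]. subst tm. lra.
  - destruct (Rle_lt_or_eq_dec _ _ (proj2 htm)) as [l|e]; [exact l|]. subst tm. lra. }
assert (hpow : 0 <= ((tm - t0) / tau)) by (apply Rlt_le, Rdiv_lt_0_compat; lra).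
assert (psi1 tm <= C).
{ apply (H tm psi psi1 htm').
  - assert (0 <= psi tm); [|lra]. unfold psi.
    assert (0 <= ((tm - t0) / tau) ^ (S n)) by (apply pow_le; exact hpow). nra.
  - exact hpsi.
  - exists (Rmin (tm - t0) (t1 - tm)). split; [apply Rmin_pos; lra|].
    intros s hs.
    assert (Rmin (tm - t0) (t1 - tm) <= tm - t0) by apply Rmin_l.
    assert (Rmin (tm - t0) (t1 - tm) <= t1 - tm) by apply Rmin_r.
    apply Rabs_def2 in hs.
    assert (f s - psi s <= f tm - psi tm) by (apply Hm; lra). lra. }
unfold psi1 in *.
assert (0 <= INR (S n) * ((tm - t0) / tau) ^ n / tau).
{ apply Rmult_le_pos; [|left; apply Rinv_0_lt_compat; lra].
  apply Rmult_le_pos; [apply pos_INR|apply pow_le; exact hpow]. }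
nra.
Qed.

(** * A C^1 majorant of a function that is o(|s|) *)

Section Modulus.
Variables (g : R -> R) (d1 : R).
Hypothesis g_le1 : forall s, Rabs s <= d1 -> g s <= Rabs s.
Hypothesis g_little_o : forall e, 0 < e -> exists d, 0 < d /\
  forall s, Rabs s < d -> g s <= e * Rabs s.

(* The infimum at [r] of the nondecreasing affine functions [r => A + B r] such
   that [g s <= (A + B |s|) |s|]: a concave modulus for [g s / |s|]. *)
Let affine_above (r y : R) : Prop := exists A B, 0 <= A /\ 0 <= B /\
  (forall s, Rabs s <= d1 -> g s <= (A + B * Rabs s) * Rabs s) /\ y = A + B * r.

Let w (r : R) : R := real (Glb_Rbar (affine_above r)).

Let w_glb (r : R) : 0 <= r -> is_glb_Rbar (affine_above r) (w r).
Proof.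
intro hr. unfold w. pose proof (Glb_Rbar_correct (affine_above r)) as [Hl Hg].
assert (h1 : affine_above r 1).
{ exists 1, 0. repeat split; try lra. intros s hs. rewrite Rmult_0_l, Rplus_0_r, Rmult_1_l. auto. }
assert (h0 : is_lb_Rbar (affine_above r) 0).
{ intros y [A [B [hA [hB [_ ->]]]]]. simpl. nra. }
specialize (Hg 0 h0). specialize (Hl 1 h1) as Hl1.
destruct (Glb_Rbar (affine_above r)) as [v| |] eqn:E; simpl in *; try contradiction.
rewrite <- E. apply Glb_Rbar_correct.
Qed.

Let w_le (r A B : R) : 0 <= r -> 0 <= A -> 0 <= B ->
  (forall s, Rabs s <= d1 -> g s <= (A + B * Rabs s) * Rabs s) -> w r <= A + B * r.
Proof.
intros hr hA hB h. destruct (w_glb r hr) as [Hl _]. apply (Hl (A + B * r)).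
exists A, B. auto.
Qed.

Let w_ge (r y : R) : 0 <= r -> (forall A B, 0 <= A -> 0 <= B ->
  (forall s, Rabs s <= d1 -> g s <= (A + B * Rabs s) * Rabs s) -> y <= A + B * r) -> y <= w r.
Proof.
intros hr h. destruct (w_glb r hr) as [_ Hg]. apply (Hg y).
intros z [A [B [hA [hB [H ->]]]]]. simpl. auto.
Qed.

Let w_nonneg (r : R) : 0 <= r -> 0 <= w r.
Proof. intro hr. apply w_ge; [exact hr|]. intros A B hA hB _. nra. Qed.

Let w_mono (r r' : R) : 0 <= r -> r <= r' -> w r <= w r'.
Proof.
intros hr h. apply w_ge; [lra|]. intros A B hA hB H.
apply Rle_trans with (A + B * r); [apply w_le; auto|nra].
Qed.

(** The quotient [w r / r] is nonincreasing, as it is for every [A + B r] with [A] nonnegative.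
    Together with monotonicity this gives continuity away from 0 and the lower bound on the integral
    of [w]. *)
Let w_star (r r' : R) : 0 < r -> r <= r' -> w r' * r <= w r * r'.
Proof.
intros hr h. assert (w r' * (r / r') <= w r).
{ apply w_ge; [lra|]. intros A B hA hB H.
  assert (w r' <= A + B * r') by (apply w_le; auto; lra).
  assert (0 < r / r') by (apply Rdiv_lt_0_compat; lra).
  apply Rle_trans with ((A + B * r') * (r / r')); [nra|].
  replace ((A + B * r') * (r / r')) with (A * (r / r') + B * r) by (field; lra).
  assert (r / r' <= 1). { apply Rmult_le_reg_r with r'; [lra|]. unfold Rdiv. rewrite Rmult_assoc, Rinv_l by lra. lra. }
  nra. }
apply Rmult_le_compat_r with (r := r') in H; [|lra].
replace (w r' * (r / r') * r') with (w r' * r) in H by (field; lra). exact H.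
Qed.

Let w_small (e : R) : 0 < e -> exists d, 0 < d /\ forall r, 0 <= r < d -> w r <= e.
Proof.
intro he. destruct (g_little_o (e / 2)) as [d [hd H]]; [lra|].
exists (d * (e / 2)). split; [nra|]. intros r hr.
(* The competitor [A = e / 2], [B = / d]: for [|s| < d] the little-o bound suffices, and for
   [|s| >= d] one has [|s| <= |s|^2 / d]. *)
apply Rle_trans with (e / 2 + / d * r).
- apply w_le; try lra; [left; apply Rinv_0_lt_compat; lra|].
  intros s hs. destruct (Rlt_le_dec (Rabs s) d) as [h|h].
  + apply Rle_trans with (1 := H s h). pose proof (Rabs_pos s).
    assert (0 < / d) by (apply Rinv_0_lt_compat; lra).
    assert (0 <= / d * Rabs s * Rabs s) by (repeat apply Rmult_le_pos; lra). nra.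
  + apply Rle_trans with (1 := g_le1 s hs). pose proof (Rabs_pos s).
    assert (1 <= / d * Rabs s).
    { apply Rmult_le_reg_l with d; [lra|]. rewrite <- Rmult_assoc, Rinv_r by lra. lra. }
    nra.
- assert (/ d * r <= e / 2); [|lra].
  apply Rmult_le_reg_l with d; [lra|]. rewrite <- Rmult_assoc, Rinv_r by lra. lra.
Qed.

Let w0 : w 0 = 0.
Proof.
apply Rle_antisym; [|apply w_nonneg; lra].
apply le_epsilon. intros e he. destruct (w_small e he) as [d [hd H]].
rewrite Rplus_0_l. apply H. lra.
Qed.

Let wp (r : R) : R := if Rle_dec 0 r then w r else 0.

Let wp_cont (r : R) : continuity_pt wp r.
Proof.
intros e he.
destruct (Rtotal_order r 0) as [hr|[hr|hr]].
- exists (- r). split; [lra|]. intros x [_ hx]. simpl in *. unfold Rdist in *.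
  apply Rabs_def2 in hx. unfold wp. destruct (Rle_dec 0 x); [lra|]. destruct (Rle_dec 0 r); [lra|].
  rewrite Rminus_diag, Rabs_R0. exact he.
- subst r. destruct (w_small (e / 2)) as [d [hd H]]; [lra|].
  exists d. split; [exact hd|]. intros x [_ hx]. simpl in *. unfold Rdist in *.
  apply Rabs_def2 in hx. unfold wp at 2. destruct (Rle_dec 0 0) as [_|]; [|lra]. rewrite w0.
  unfold wp. destruct (Rle_dec 0 x) as [h|h].
  + rewrite Rminus_0_r, Rabs_pos_eq by (apply w_nonneg; lra).
    apply Rle_lt_trans with (e / 2); [apply H; lra|lra].
  + rewrite Rminus_0_r, Rabs_R0. exact he.
- pose proof (w_nonneg r (Rlt_le _ _ hr)) as hw.
  set (d := Rmin (r / 2) (r * e / (2 * (w r + 1)))).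
  assert (hd2 : 0 < r * e / (2 * (w r + 1))) by (apply Rdiv_lt_0_compat; nra).
  assert (hd : 0 < d) by (apply Rmin_pos; lra).
  assert (d1' : d <= r / 2) by apply Rmin_l.
  assert (d2' : d * (2 * (w r + 1)) <= r * e).
  { apply Rle_trans with (r * e / (2 * (w r + 1)) * (2 * (w r + 1))).
    - apply Rmult_le_compat_r; [lra|apply Rmin_r].
    - right. field. lra. }
  exists d. split; [exact hd|]. intros x [_ hx]. simpl in *. unfold Rdist in *.
  apply Rabs_def2 in hx. unfold wp. destruct (Rle_dec 0 x) as [hx0|]; [|lra].
  destruct (Rle_dec 0 r) as [_|]; [|lra].
  pose proof (w_nonneg x hx0).
  destruct (Rle_lt_dec r x) as [h|h].
  + pose proof (w_mono r x (Rlt_le _ _ hr) h). pose proof (w_star r x hr h).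
    rewrite Rabs_pos_eq by lra. apply Rmult_lt_reg_r with r; [lra|]. nra.
  + pose proof (w_mono x r hx0 (Rlt_le _ _ h)). assert (hx1 : 0 < x) by lra.
    pose proof (w_star x r hx1 (Rlt_le _ _ h)).
    rewrite Rabs_left1 by lra. apply Rmult_lt_reg_r with r; [lra|]. nra.
Qed.

(** By [w_star] the integral of [w] over [[0, s]] is at least [s * w s / 2]; the factor 2
    compensates for the half. As [wp] vanishes on negative arguments, [H s + H (- s)] treats both
    signs at once. *)
Let H (s : R) : R := RInt (fun r => 2 * wp r) 0 s.

Let wp2_cont (r : R) : continuous (fun r => 2 * wp r) r.
Proof. apply continuity_pt_filterlim. apply continuity_pt_mult; [apply continuity_pt_const; intros ? ?; reflexivity|apply wp_cont]. Qed.

Let H_derive (s : R) : is_derive H s (2 * wp s).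
Proof.
unfold H. apply (is_derive_RInt (fun r => 2 * wp r) _ 0).
- exists posreal_one. intros y _. apply (RInt_correct (fun r => 2 * wp r)).
  apply (ex_RInt_continuous (fun r => 2 * wp r)). intros z _. apply wp2_cont.
- apply wp2_cont.
Qed.

Let H_neg (s : R) : s <= 0 -> H s = 0.
Proof.
intro hs. unfold H. rewrite (RInt_ext _ (fun _ => 0)).
- rewrite RInt_const. unfold scal; simpl; unfold mult; simpl. ring.
- intros x hx. rewrite Rmin_right, Rmax_left in hx by lra.
  unfold wp. destruct (Rle_dec 0 x); [lra|change (2 * 0 = 0); ring].
Qed.

Let H_pos (s : R) : 0 < s -> s * w s <= H s.
Proof.
intro hs. unfold H.
assert (e : is_RInt (fun r => 2 * (w s / s) * r) 0 s (s * w s)).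
{ replace (s * w s) with (w s / s * s ^ 2 - w s / s * 0 ^ 2) by (field; lra).
  apply (is_RInt_derive (fun r => w s / s * r ^ 2)).
  - intros x _. auto_derive; [exact I|]. ring.
  - intros x _. apply (ex_derive_continuous (K := R_AbsRing) (V := R_NormedModule)). auto_derive. exact I. }
rewrite <- (is_RInt_unique _ _ _ _ e).
apply RInt_le; [lra|eexists; exact e| |].
- apply (ex_RInt_continuous (fun r => 2 * wp r)). intros z _. apply wp2_cont.
- intros x hx. unfold wp. destruct (Rle_dec 0 x) as [_|]; [|lra].
  pose proof (w_star x s (proj1 hx) (Rlt_le _ _ (proj2 hx))).
  assert (w s / s * x <= w x); [|lra].
  apply Rmult_le_reg_r with s; [lra|]. replace (w s / s * x * s) with (w s * x) by (field; lra). lra.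
Qed.

Lemma C1_majorant_aux : exists h h1, C1_pair h h1 /\ h 0 = 0 /\ h1 0 = 0 /\
  forall s, Rabs s <= d1 -> g s <= h s.
Proof.
exists (fun s => H s + H (- s)), (fun s => 2 * wp s - 2 * wp (- s)).
assert (H0 : H 0 = 0) by (apply H_neg; lra).
split; [split; intro s|].
- apply (is_derive_plus H (fun s => H (- s)) s (2 * wp s) (- (2 * wp (- s)))).
  + apply H_derive.
  + replace (- (2 * wp (- s))) with (scal (-1) (2 * wp (- s))) by (unfold scal; simpl; unfold mult; simpl; ring).
    apply (is_derive_comp H Ropp); [apply H_derive|]. auto_derive; [exact I|ring].
- apply (continuous_minus (fun s => 2 * wp s) (fun s => 2 * wp (- s))); [apply wp2_cont|].
  apply (continuous_comp Ropp (fun s => 2 * wp s)); [|apply wp2_cont].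
  apply (ex_derive_continuous (K := R_AbsRing) (V := R_NormedModule)). auto_derive. exact I.
- split; [rewrite Ropp_0, H0; ring|]. split; [rewrite Ropp_0; ring|].
  intros s hs.
  assert (key : forall r, 0 < r <= d1 -> forall z, Rabs z = r -> g z <= r * w r).
  { intros r hr z hz. rewrite (Rmult_comm r). apply Rmult_le_reg_r with (/ r); [apply Rinv_0_lt_compat; lra|].
    replace (w r * r * / r) with (w r) by (field; lra).
    apply w_ge; [lra|]. intros A B hA hB h. specialize (h z). rewrite hz in h.
    apply Rmult_le_reg_r with r; [lra|]. replace (g z * / r * r) with (g z) by (field; lra). apply h. lra. }
  destruct (Rtotal_order s 0) as [h|[h|h]].
  + rewrite (H_neg s) by lra. rewrite Rplus_0_l. apply Rle_trans with (- s * w (- s)); [|apply H_pos; lra].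
    rewrite Rabs_left in hs by lra. apply key; [lra|apply Rabs_left; lra].
  + subst s. rewrite Ropp_0, H0. pose proof (g_le1 0 hs). rewrite Rabs_R0 in *. lra.
  + rewrite (H_neg (- s)) by lra. rewrite Rplus_0_r. apply Rle_trans with (s * w s); [|apply H_pos; lra].
    rewrite Rabs_pos_eq in hs by lra. apply key; [lra|apply Rabs_pos_eq; lra].
Qed.
End Modulus.

(* Turns differentiability at a single point into a C^1 test function touching there. *)
Lemma C1_majorant (g : R -> R) :
  (forall e, 0 < e -> exists d, 0 < d /\ forall s, Rabs s < d -> g s <= e * Rabs s) ->
  exists h h1, C1_pair h h1 /\ h 0 = 0 /\ h1 0 = 0 /\
    exists d, 0 < d /\ forall s, Rabs s < d -> g s <= h s.
Proof.
intro hg. destruct (hg 1) as [d [hd Hd]]; [lra|].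
destruct (C1_majorant_aux g (d / 2)) as [h [h1 [hh [h0 [h10 Hh]]]]].
- intros s hs. rewrite <- (Rmult_1_l (Rabs s)). apply Hd. lra.
- exact hg.
- exists h, h1. repeat split; try apply hh; try assumption.
  exists (d / 2). split; [lra|]. intros s hs. apply Hh. lra.
Qed.

(** * Touching functions at points of differentiability in time *)

Definition straddle_deriv (F : R -> R) (D x : R) : Prop :=
  forall e, 0 < e -> exists d, 0 < d /\ forall a b, a < x -> x < b -> b - a < d ->
    Rabs (F b - F a - D * (b - a)) <= e * (b - a).

Lemma continuity_pt_small (F : R -> R) (x e : R) : continuity_pt F x -> 0 < e ->
  exists d, 0 < d /\ forall y, Rabs (y - x) < d -> Rabs (F y - F x) < e.
Proof.
intros h he. destruct (h e he) as [d [hd H]]. exists d. split; [exact hd|].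
intros y hy. destruct (Req_dec x y) as [->|n].
- rewrite Rminus_diag, Rabs_R0. exact he.
- apply (H y). split; [split; [exact I|exact n]|exact hy].
Qed.

(** Apply the straddling estimate between [s] and a point at distance [k] beyond [x], and let [k]
    tend to 0; continuity at [x] replaces the auxiliary endpoint by [x]. *)
Lemma straddle_deriv_expansion (F : R -> R) (D x : R) : continuity_pt F x ->
  straddle_deriv F D x -> forall e, 0 < e -> exists d, 0 < d /\
    forall s, Rabs (s - x) < d -> Rabs (F s - F x - D * (s - x)) <= e * Rabs (s - x).
Proof.
intros hc hD e he. destruct (hD e he) as [d [hd H]]. exists (d / 2). split; [lra|].
intros s hs. apply le_epsilon. intros eta heta.
destruct (continuity_pt_small F x (eta / 2) hc) as [d' [hd' H']]; [lra|].
pose proof (Rabs_pos D) as hDp.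
set (k := Rmin (d / 2) (Rmin (d' / 2) (eta / (2 * (e + Rabs D + 1))))).
assert (hk0 : 0 < eta / (2 * (e + Rabs D + 1))) by (apply Rdiv_lt_0_compat; lra).
assert (hk : 0 < k) by (repeat apply Rmin_pos; lra).
assert (k1 : k <= d / 2) by apply Rmin_l.
assert (k2 : k <= d' / 2) by (eapply Rle_trans; [apply Rmin_r|apply Rmin_l]).
assert (k3 : k * (2 * (e + Rabs D + 1)) <= eta).
{ apply Rle_trans with (eta / (2 * (e + Rabs D + 1)) * (2 * (e + Rabs D + 1))).
  - apply Rmult_le_compat_r; [lra|]. eapply Rle_trans; [apply Rmin_r|apply Rmin_r].
  - right. field. lra. }
assert (hDk : Rabs (D * k) <= Rabs D * k) by (rewrite Rabs_mult, (Rabs_pos_eq k) by lra; lra).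
apply Rabs_le_between in hDk.
destruct (Rtotal_order s x) as [h|[h|h]].
- rewrite (Rabs_left (s - x)) in * by lra.
  assert (h1 : Rabs (F (x + k) - F x) < eta / 2) by (apply H'; rewrite Rabs_pos_eq; lra).
  specialize (H s (x + k)). apply Rabs_def2 in h1.
  assert (h2 : Rabs (F (x + k) - F s - D * (x + k - s)) <= e * (x + k - s)) by (apply H; lra).
  apply Rabs_le_between in h2. apply Rabs_le. nra.
- subst s. rewrite !Rminus_diag, Rmult_0_r, Rminus_0_r, Rabs_R0. lra.
- rewrite (Rabs_pos_eq (s - x)) in * by lra.
  assert (h1 : Rabs (F (x - k) - F x) < eta / 2) by (apply H'; rewrite Rabs_left; lra).
  specialize (H (x - k) s). apply Rabs_def2 in h1.
  assert (h2 : Rabs (F s - F (x - k) - D * (s - (x - k))) <= e * (s - (x - k))) by (apply H; lra).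
  apply Rabs_le_between in h2. apply Rabs_le. nra.
Qed.

Definition clamp (a b t : R) : R := Rmax a (Rmin b t).

Lemma clamp_in (a b t : R) : a <= b -> a <= clamp a b t <= b.
Proof. intro h. unfold clamp, Rmax, Rmin. repeat destruct Rle_dec; lra. Qed.

Lemma clamp_id (a b t : R) : a <= t <= b -> clamp a b t = t.
Proof. intro h. unfold clamp, Rmax, Rmin. repeat destruct Rle_dec; lra. Qed.

Lemma clamp_mono (a b s t : R) : s <= t -> 0 <= clamp a b t - clamp a b s <= t - s.
Proof. intro h. unfold clamp, Rmax, Rmin. repeat destruct Rle_dec; lra. Qed.

Lemma slope_bound_lipschitz (f : R -> R) (t0 t1 C : R) : 0 <= C ->
  (forall t, t0 <= t <= t1 -> continuity_pt f t) ->
  (forall t psi psi1, t0 < t < t1 -> C1_pair psi psi1 -> touch_above f psi t -> psi1 t <= C) ->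
  forall s t, t0 <= s -> s <= t -> t <= t1 -> f t - f s <= C * (t - s).
Proof.
intros hC hf H s t h0 hst h1. destruct (Req_dec s t) as [->|n]; [lra|].
apply (slope_bound (fun z => f z - f s) s t C); [lra|exact hC| |lra|].
- intros z hz. apply continuity_pt_minus; [apply hf; lra|].
  apply continuity_pt_const. intros ? ?; reflexivity.
- intros z psi psi1 hz _ hp [e [he Ht]]. apply (H z psi psi1); [lra|exact hp|].
  exists e. split; [exact he|]. intros y hy. specialize (Ht y hy). lra.
Qed.

(** The remainder of the expansion of [f] at [x] is o(|s|), so [C1_majorant] turns it into a test
    function whose slope is exactly the derivative [C - D] of [f]. *)
Lemma straddle_touch (f : R -> R) (t0 t1 C D x : R) : 0 <= C -> t0 < x < t1 ->
  continuity_pt f x ->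
  straddle_deriv (fun t => C * t - f (clamp t0 t1 t)) D x ->
  exists psi psi1, C1_pair psi psi1 /\ touch_above f psi x /\ psi1 x = C - D.
Proof.
intros hC hx hf hD.
set (F := fun t => C * t - f (clamp t0 t1 t)) in *.
assert (hF : continuity_pt F x).
{ intros e he. destruct (continuity_pt_small f x (e / 2) hf) as [d [hd H]]; [lra|].
  exists (Rmin d (e / (2 * (C + 1)))). split.
  - apply Rmin_pos; [lra|]. apply Rdiv_lt_0_compat; lra.
  - intros y [_ hy]. simpl in *. unfold Rdist in *.
    assert (hy1 : Rabs (y - x) < d) by (eapply Rlt_le_trans; [exact hy|apply Rmin_l]).
    assert (hy2 : Rabs (y - x) < e / (2 * (C + 1))) by (eapply Rlt_le_trans; [exact hy|apply Rmin_r]).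
    assert (hy3 : Rabs (y - x) * (2 * (C + 1)) < e).
    { apply Rmult_lt_compat_r with (r := 2 * (C + 1)) in hy2; [|lra].
      replace (e / (2 * (C + 1)) * (2 * (C + 1))) with e in hy2 by (field; lra). exact hy2. }
    assert (hcl : Rabs (clamp t0 t1 y - x) <= Rabs (y - x)).
    { rewrite <- (clamp_id t0 t1 x) at 1 by lra.
      destruct (Rle_lt_dec x y) as [h|h].
      - pose proof (clamp_mono t0 t1 x y h). rewrite !Rabs_pos_eq; lra.
      - pose proof (clamp_mono t0 t1 y x (Rlt_le _ _ h)). rewrite !Rabs_left1; lra. }
    assert (h1 : Rabs (f (clamp t0 t1 y) - f x) < e / 2) by (apply H; lra).
    unfold F. rewrite (clamp_id t0 t1 x) by lra.
    pose proof (Rabs_pos (y - x)).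
    apply Rabs_def2 in h1. destruct (Rabs_def2 (y - x) (Rabs (y - x) + (e / 2 - Rabs (y - x) * (C + 1)) / (C + 1))) as [g1 g2].
    { assert (0 < (e / 2 - Rabs (y - x) * (C + 1)) / (C + 1)) by (apply Rdiv_lt_0_compat; lra). lra. }
    assert (g3 : Rabs (y - x) + (e / 2 - Rabs (y - x) * (C + 1)) / (C + 1) = e / 2 / (C + 1)) by (field; lra).
    rewrite g3 in *.
    assert (g4 : C * (e / 2 / (C + 1)) <= e / 2).
    { apply Rmult_le_reg_r with (C + 1); [lra|].
      replace (C * (e / 2 / (C + 1)) * (C + 1)) with (C * (e / 2)) by (field; lra). nra. }
    apply Rabs_def1; nra. }
pose proof (straddle_deriv_expansion F D x hF hD) as hexp.
set (g := fun s => f (x + s) - f x - (C - D) * s).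
destruct (C1_majorant g) as [h [h1 [[hh hh1] [h0 [h10 [d [hd Hd]]]]]]].
{ intros e he. destruct (hexp e he) as [d [hd H]].
  exists (Rmin d (Rmin (x - t0) (t1 - x))). split; [repeat apply Rmin_pos; lra|].
  intros s hs.
  assert (s1 : Rabs s < d) by (eapply Rlt_le_trans; [exact hs|apply Rmin_l]).
  assert (s2 : Rabs s < x - t0) by (eapply Rlt_le_trans; [exact hs|eapply Rle_trans; [apply Rmin_r|apply Rmin_l]]).
  assert (s3 : Rabs s < t1 - x) by (eapply Rlt_le_trans; [exact hs|eapply Rle_trans; [apply Rmin_r|apply Rmin_r]]).
  specialize (H (x + s)). replace (x + s - x) with s in H by ring. specialize (H s1).
  apply Rabs_def2 in s2. apply Rabs_def2 in s3. unfold F in H.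
  rewrite !clamp_id in H by lra. apply Rabs_le_between in H. unfold g. lra. }
exists (fun s => (C - D) * s + h (s - x)), (fun s => (C - D) + h1 (s - x)).
split; [split; intro s|split].
- apply (is_derive_plus (fun s => (C - D) * s) (fun s => h (s - x)) s (C - D) (h1 (s - x))).
  + auto_derive; [exact I|ring].
  + replace (h1 (s - x)) with (scal 1 (h1 (s - x))) by (unfold scal; simpl; unfold mult; simpl; ring).
    apply (is_derive_comp h (fun s => s - x)); [apply hh|]. auto_derive; [exact I|reflexivity].
- apply (continuous_plus (fun _ => C - D) (fun s => h1 (s - x))); [apply continuous_const|].
  apply (continuous_comp (fun s => s - x) h1); [|apply hh1].
  apply (ex_derive_continuous (K := R_AbsRing) (V := R_NormedModule)). auto_derive. exact I.
- exists d. split; [exact hd|]. intros s hs. specialize (Hd (s - x) hs).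
  unfold g in Hd. replace (x + (s - x)) with s in Hd by ring.
  rewrite Rminus_diag, h0. lra.
- rewrite Rminus_diag, h10. ring.
Qed.

(* Wherever both [f] and [g] are differentiable, the two touching functions live
   at the same time, so only the sum [A t + B t] matters. *)
Lemma sum_slope_bound (f g A B : R -> R) (t0 t1 C eta : R) : t0 < t1 -> 0 <= C ->
  (forall t, t0 <= t <= t1 -> continuity_pt f t) ->
  (forall t, t0 <= t <= t1 -> continuity_pt g t) ->
  (forall t psi psi1, t0 < t < t1 -> C1_pair psi psi1 -> touch_above f psi t -> psi1 t <= A t) ->
  (forall t psi psi1, t0 < t < t1 -> C1_pair psi psi1 -> touch_above g psi t -> psi1 t <= B t) ->
  (forall t, t0 < t < t1 -> A t <= C /\ B t <= C /\ A t + B t <= eta) ->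
  f t1 + g t1 <= f t0 + g t0 + eta * (t1 - t0).
Proof.
intros ht hC fc gc fA gB hAB.
(* The slope bound [C] makes [C t - u t] nondecreasing on [[t0, t1]]; clamping extends it to a
   monotone function on the line. *)
assert (mono : forall u U, (forall t, t0 <= t <= t1 -> continuity_pt u t) ->
  (forall t psi psi1, t0 < t < t1 -> C1_pair psi psi1 -> touch_above u psi t -> psi1 t <= U t) ->
  (forall t, t0 < t < t1 -> U t <= C) ->
  forall s t, s <= t -> C * s - u (clamp t0 t1 s) <= C * t - u (clamp t0 t1 t)).
{ intros u U uc uU hU s t hst.
  pose proof (clamp_in t0 t1 s (Rlt_le _ _ ht)). pose proof (clamp_in t0 t1 t (Rlt_le _ _ ht)).
  pose proof (clamp_mono t0 t1 s t hst).
  assert (u (clamp t0 t1 t) - u (clamp t0 t1 s) <= C * (clamp t0 t1 t - clamp t0 t1 s)).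
  { apply (slope_bound_lipschitz u t0 t1 C hC uc); try lra.
    intros z psi psi1 hz hp hto. apply Rle_trans with (U z); [eapply uU; eauto|auto]. }
  nra. }
assert (mf := mono f A fc fA (fun t h => proj1 (hAB t h))).
assert (mg := mono g B gc gB (fun t h => proj1 (proj2 (hAB t h)))). clear mono.
set (F := fun t => C * t - f (clamp t0 t1 t)) in *.
set (G := fun t => C * t - g (clamp t0 t1 t)) in *.
assert (key : forall k, 0 < k -> (2 * C - eta - k) * (t1 - t0) <= (F t1 + G t1) - (F t0 + G t0)).
{ intros k hk.
  apply (monotone_increment_ge (f := fun t => F t + G t)
    (N := fun x => ~ (exists D, straddle_deriv F D x) \/ ~ (exists D, straddle_deriv G D x))).
  - intros x y h. specialize (mf x y h). specialize (mg x y h). unfold F, G. lra.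
  - apply null_or; [exact (monotone_diff mf)|exact (monotone_diff mg)].
  - exact ht.
  - intros x hx nN e he. apply not_or_and in nN. destruct nN as [nF nG].
    apply NNPP in nF. apply NNPP in nG. destruct nF as [DF hF]. destruct nG as [DG hG].
    (* The two touching functions give [C - DF <= A x] and [C - DG <= B x], hence
       [DF + DG >= 2 C - eta] at this one time. *)
    destruct (straddle_touch f t0 t1 C DF x hC hx) as [p [p1 [hp [hpt hpe]]]]; [apply fc; lra|exact hF|].
    destruct (straddle_touch g t0 t1 C DG x hC hx) as [q [q1 [hq [hqt hqe]]]]; [apply gc; lra|exact hG|].
    specialize (fA x p p1 hx hp hpt). specialize (gB x q q1 hx hq hqt).
    destruct (hAB x hx) as [_ [_ hs]].
    destruct (hF (k / 4)) as [d1 [hd1 H1]]; [lra|]. destruct (hG (k / 4)) as [d2 [hd2 H2]]; [lra|].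
    set (h := Rmin (e / 4) (Rmin (d1 / 4) (d2 / 4))).
    assert (hh : 0 < h) by (repeat apply Rmin_pos; lra).
    assert (k1 : h <= e / 4) by apply Rmin_l.
    assert (k2 : h <= d1 / 4) by (eapply Rle_trans; [apply Rmin_r|apply Rmin_l]).
    assert (k3 : h <= d2 / 4) by (eapply Rle_trans; [apply Rmin_r|apply Rmin_r]).
    exists (x - h), (x + h).
    specialize (H1 (x - h) (x + h)). specialize (H2 (x - h) (x + h)).
    assert (I1 := proj1 (Rabs_le_between _ _) (H1 ltac:(lra) ltac:(lra) ltac:(lra))).
    assert (I2 := proj1 (Rabs_le_between _ _) (H2 ltac:(lra) ltac:(lra) ltac:(lra))).
    split; try lra.
    replace (x + h - (x - h)) with (2 * h) in * by ring. nra. }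
assert (e1 : F t1 + G t1 - (F t0 + G t0) = 2 * C * (t1 - t0) - (f t1 + g t1 - (f t0 + g t0))).
{ unfold F, G. rewrite !clamp_id by lra. ring. }
apply le_epsilon. intros e he.
specialize (key (e / (t1 - t0))). rewrite e1 in key.
assert (he1 : 0 < e / (t1 - t0)) by (apply Rdiv_lt_0_compat; lra).
specialize (key he1).
assert (e2 : e / (t1 - t0) * (t1 - t0) = e) by (field; lra). nra.
Qed.

Lemma choice_fun {A B : Type} (P : A -> B -> Prop) :
  (forall a, exists b, P a b) -> exists f, forall a, P a (f a).
Proof.
intro h. exists (fun a => proj1_sig (constructive_indefinite_description _ (h a))).
intro a. exact (proj2_sig (constructive_indefinite_description _ (h a))).
Qed.

Definition cont2 (u : R -> R -> R) : Prop := forall x t, continuity_2d_pt u x t.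

Lemma cont2_slice (u : R -> R -> R) (t : R) : cont2 u -> forall x, continuity_pt (fun x => u x t) x.
Proof.
intros h x e he. destruct (h x t (mkposreal e he)) as [d Hd].
exists d. split; [apply cond_pos|]. intros y [_ hy]. apply Hd; [exact hy|].
rewrite Rminus_diag, Rabs_R0. apply cond_pos.
Qed.

Lemma cont2_uniform (u : R -> R -> R) (l r a b e : R) : cont2 u -> 0 < e ->
  exists d, 0 < d /\ forall x y s t, l <= x <= r -> l <= y <= r -> a <= s <= b -> a <= t <= b ->
    Rabs (x - y) < d -> Rabs (s - t) < d -> Rabs (u x s - u y t) < e.
Proof.
intros h he.
destruct (uniform_continuity_2d u l r a b (fun x y _ _ => h x y) (mkposreal e he)) as [d Hd].
exists d. split; [apply cond_pos|]. intros. apply Hd; auto.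
Qed.

Definition quad (A P X x0 x : R) : R := A + P * (x - x0) + X / 2 * (x - x0) ^ 2.

Lemma quad_continuous (A P X x0 : R) x : continuity_pt (quad A P X x0) x.
Proof.
apply derivable_continuous_pt. exists (P + X * (x - x0)). apply is_derive_Reals.
unfold quad. auto_derive; [exact I|]. simpl. field.
Qed.

(** * Subsolutions and barriers *)

(* The test functions of the viscosity notion, reduced to the jets that are
   quadratic in space and continuously differentiable in time. *)
Definition subsol (T : R) (F : R -> R -> R -> R -> R) (u : R -> R -> R) : Prop :=
  forall x0 t0 p X psi psi1, 0 < t0 < T -> C1_pair psi psi1 ->
    (exists e, 0 < e /\ forall x t, Rabs (x - x0) < e -> Rabs (t - t0) < e ->
       u x t <= u x0 t0 + (psi t - psi t0) + p * (x - x0) + X / 2 * (x - x0) ^ 2) ->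
    psi1 t0 <= F x0 t0 p X.

Lemma partial_max (u : R -> R -> R) (Q : R -> R) (l r : R) : cont2 u ->
  (forall x, continuity_pt Q x) -> l <= r -> exists f : R -> R,
    (forall t, continuity_pt f t) /\
    (forall t x, l <= x <= r -> u x t - Q x <= f t) /\
    (forall t, exists x, l <= x <= r /\ f t = u x t - Q x).
Proof.
intros hu hQ hlr.
destruct (choice_fun (fun t x => l <= x <= r /\ forall y, l <= y <= r -> u y t - Q y <= u x t - Q x)) as [X HX].
{ intro t. destruct (continuity_ab_maj (fun x => u x t - Q x) l r hlr) as [x [Hx hx]].
  - intros c _. apply continuity_pt_minus; [apply (cont2_slice u t hu)|apply hQ].
  - exists x. split; [exact hx|exact Hx]. }
exists (fun t => u (X t) t - Q (X t)). split; [|split].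
- intros t e he.
  destruct (cont2_uniform u l r (t - 1) (t + 1) e hu he) as [d [hd Hd]].
  exists (Rmin d 1). split; [apply Rmin_pos; lra|]. intros s [_ hs]. simpl in *. unfold Rdist in *.
  assert (h1 : Rabs (s - t) < d) by (eapply Rlt_le_trans; [exact hs|apply Rmin_l]).
  assert (h2 : Rabs (s - t) < 1) by (eapply Rlt_le_trans; [exact hs|apply Rmin_r]).
  apply Rabs_def2 in h2. destruct (HX s) as [xs Hs]. destruct (HX t) as [xt Ht].
  assert (z : forall x, Rabs (x - x) < d) by (intro x; rewrite Rminus_diag, Rabs_R0; exact hd).
  pose proof (Hd (X s) (X s) s t xs xs ltac:(lra) ltac:(lra) (z _) h1) as a1.
  pose proof (Hd (X t) (X t) s t xt xt ltac:(lra) ltac:(lra) (z _) h1) as a2.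
  apply Rabs_def2 in a1. apply Rabs_def2 in a2.
  specialize (Hs (X t) xt). specialize (Ht (X s) xs). apply Rabs_def1; lra.
- intros t x hx. apply (HX t). exact hx.
- intro t. exists (X t). split; [apply HX|reflexivity].
Qed.

(** A function of time touching the partial maximum [f], added to the paraboloid, touches [u] at the
    maximizer [xm]. The maximizer must be interior for this to be a neighborhood statement in
    space. *)
Lemma touch_partial_max (T : R) F u (A P X x0 l r : R) (f psi psi1 : R -> R) (t xm : R) :
  subsol T F u -> 0 < t < T -> C1_pair psi psi1 -> touch_above f psi t ->
  (forall t x, l <= x <= r -> u x t - quad A P X x0 x <= f t) ->
  l < xm < r -> f t = u xm t - quad A P X x0 xm ->
  psi1 t <= F xm t (P + X * (xm - x0)) X.
Proof.
intros hu ht hpsi [e [he He]] hf hx hm.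
apply (hu xm t _ X psi psi1 ht hpsi).
exists (Rmin e (Rmin (xm - l) (r - xm))). split; [repeat apply Rmin_pos; lra|].
intros x s hxs hs.
assert (h1 : Rabs (s - t) < e) by (eapply Rlt_le_trans; [exact hs|apply Rmin_l]).
assert (h2 : Rabs (x - xm) < xm - l) by (eapply Rlt_le_trans; [exact hxs|eapply Rle_trans; [apply Rmin_r|apply Rmin_l]]).
assert (h3 : Rabs (x - xm) < r - xm) by (eapply Rlt_le_trans; [exact hxs|eapply Rle_trans; [apply Rmin_r|apply Rmin_r]]).
apply Rabs_def2 in h2. apply Rabs_def2 in h3.
specialize (He s h1). specialize (hf s x ltac:(lra)). unfold quad in *. nra.
Qed.

(** The maximum over [[l, r]] of the excess of [u] over the paraboloid satisfies [slope_bound]: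
    where the excess is positive, the maximizer is off the lateral boundary and the equation bounds
    the slope by [C]. *)
Lemma barrier (T : R) F u (A P X x0 l r t0 t1 C : R) : cont2 u -> subsol T F u ->
  0 <= t0 -> t0 <= t1 -> t1 <= T -> l <= r -> 0 <= C ->
  (forall x, l <= x <= r -> u x t0 <= quad A P X x0 x) ->
  (forall t, t0 <= t <= t1 -> u l t <= quad A P X x0 l /\ u r t <= quad A P X x0 r) ->
  (forall x t, l < x < r -> t0 < t < t1 -> F x t (P + X * (x - x0)) X <= C) ->
  forall x, l <= x <= r -> u x t1 <= quad A P X x0 x + C * (t1 - t0).
Proof.
intros cu hu h0 h01 h1 hlr hC hi hb hF x hx.
destruct (Req_dec t0 t1) as [<-|n]; [specialize (hi x hx); lra|].
destruct (partial_max u (quad A P X x0) l r cu (quad_continuous A P X x0) hlr) as [f [fc [fge fm]]].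
assert (f t1 <= C * (t1 - t0)).
{ apply slope_bound; [lra|exact hC|intros; apply fc| |].
  - destruct (fm t0) as [y [hy ->]]. specialize (hi y hy). lra.
  - intros t psi psi1 ht hft hpsi hto. destruct (fm t) as [y [hy e]].
    destruct (hb t) as [b1 b2]; [lra|].
    assert (hy' : l < y < r).
    { split.
      - destruct (Rle_lt_or_eq_dec _ _ (proj1 hy)) as [|E]; [assumption|subst y; lra].
      - destruct (Rle_lt_or_eq_dec _ _ (proj2 hy)) as [|E]; [assumption|subst y; lra]. }
    apply Rle_trans with (F y t (P + X * (y - x0)) X); [|apply hF; [exact hy'|exact ht]].
    eapply touch_partial_max with (f := f); eauto. lra. }
specialize (fge t1 x hx). lra.
Qed.

(* Near a strict touching point at time [t0] the excess of [u] over the touching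
   paraboloid grows at most at the rate given by the equation at that point. *)
Lemma local_excess (T : R) F u (A P X x0 l m K t0 k : R) : cont2 u -> subsol T F u ->
  0 <= t0 -> t0 < T -> 0 < l -> 0 < m -> 0 <= K -> 0 < k ->
  (forall x, Rabs (x - x0) <= l -> u x t0 <= quad A P X x0 x - m * (x - x0) ^ 2) ->
  u x0 t0 = A ->
  (forall x t, 0 < t < T -> Rabs (x - x0) <= l ->
     F x t (P + X * (x - x0)) X <= F x0 t P X + K * Rabs (x - x0)) ->
  exists f tau, 0 < tau /\ t0 + tau <= T /\ (forall t, continuity_pt f t) /\
    (forall t x, Rabs (x - x0) <= l -> u x t <= quad A P X x0 x + f t) /\ f t0 <= 0 /\
    (forall t psi psi1, t0 < t < t0 + tau -> C1_pair psi psi1 -> touch_above f psi t ->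
       psi1 t <= F x0 t P X + k).
Proof.
intros cu hu h0 hT hl hm hK hk hq hA hF.
destruct (partial_max u (quad A P X x0) (x0 - l) (x0 + l) cu (quad_continuous A P X x0)) as [f [fc [fge fm]]]; [lra|].
(* Within distance [l1] the variation in [x] of the equation costs at most [k]. *)
set (l1 := Rmin (l / 2) (k / (K + 1))).
assert (hl1 : 0 < l1) by (apply Rmin_pos; [lra|apply Rdiv_lt_0_compat; lra]).
assert (l1l : l1 <= l / 2) by apply Rmin_l.
assert (l1k : K * l1 <= k).
{ apply Rle_trans with (K * (k / (K + 1))).
  - apply Rmult_le_compat_l; [lra|apply Rmin_r].
  - apply Rmult_le_reg_r with (K + 1); [lra|]. replace (K * (k / (K + 1)) * (K + 1)) with (K * k) by (field; lra). nra. }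
(* Two values of [u] move by this much each, in total [m * l1 ^ 2 / 2]; the margin
   [m * (x - x0) ^ 2] then keeps the maximizer within [l1] of [x0] for short times. *)
assert (he : 0 < m * l1 ^ 2 / 4) by (apply Rdiv_lt_0_compat; [apply Rmult_lt_0_compat; [lra|apply pow_lt; lra]|lra]).
destruct (cont2_uniform u (x0 - l) (x0 + l) (t0 - 1) (t0 + 1) _ cu he) as [d [hd Hd]].
set (tau := Rmin (Rmin (d / 2) (/ 2)) (T - t0)).
exists f, tau.
assert (htau : 0 < tau) by (repeat apply Rmin_pos; lra).
assert (tau1 : tau <= d / 2) by (eapply Rle_trans; [apply Rmin_l|apply Rmin_l]).
assert (tau2 : tau <= / 2) by (eapply Rle_trans; [apply Rmin_l|apply Rmin_r]).
assert (tau3 : tau <= T - t0) by apply Rmin_r.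
assert (habs : forall x, Rabs (x - x0) <= l <-> x0 - l <= x <= x0 + l).
{ intro x. rewrite Rabs_le_between. lra. }
split; [exact htau|]. split; [lra|]. split; [exact fc|]. split; [|split].
- intros t x hx. apply habs in hx. specialize (fge t x hx). lra.
- destruct (fm t0) as [y [hy ->]]. apply habs in hy. specialize (hq y hy). pose proof (pow2_ge_0 (y - x0)). nra.
- intros t psi psi1 ht hpsi hto. destruct (fm t) as [y [hy e]].
  assert (z : forall x, Rabs (x - x) < d) by (intro x; rewrite Rminus_diag, Rabs_R0; exact hd).
  assert (htd : Rabs (t - t0) < d) by (rewrite Rabs_pos_eq; lra).
  pose proof (Hd y y t t0 hy hy ltac:(lra) ltac:(lra) (z y) htd) as a1.
  pose proof (Hd x0 x0 t t0 ltac:(lra) ltac:(lra) ltac:(lra) ltac:(lra) (z x0) htd) as a2.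
  pose proof (fge t x0 ltac:(lra)) as a3.
  pose proof (hq y (proj2 (habs y) hy)) as a4.
  apply Rabs_def2 in a1. apply Rabs_def2 in a2.
  assert (q0 : quad A P X x0 x0 = A) by (unfold quad; ring).
  assert (ym : m * (y - x0) ^ 2 <= m * (l1 ^ 2 / 2)) by (rewrite q0 in a3; lra).
  apply Rmult_le_reg_l in ym; [|lra].
  assert (yl : Rabs (y - x0) < l1).
  { apply Rnot_le_lt. intro c. assert (l1 ^ 2 <= (y - x0) ^ 2).
    { rewrite <- (pow2_abs (y - x0)). apply pow_incr. lra. }
    assert (0 < l1 ^ 2) by (apply pow_lt; lra). lra. }
  apply Rle_trans with (F y t (P + X * (y - x0)) X).
  + eapply touch_partial_max with (f := f); eauto; [lra|]. apply Rabs_def2 in yl. lra.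
  + eapply Rle_trans; [apply hF; [lra|lra]|]. nra.
Qed.

(** Each local excess separately has only the slope bound [C + k], which does not shrink;
    [sum_slope_bound] uses the smallness of the sum of the two Hamiltonians at equal times. *)
Lemma local_sum (T : R) F1 F2 u1 u2 (A1 P1 X1 x0 A2 P2 X2 y0 l m K C eta t0 k : R) :
  cont2 u1 -> cont2 u2 -> subsol T F1 u1 -> subsol T F2 u2 ->
  0 <= t0 -> t0 < T -> 0 < l -> 0 < m -> 0 <= K -> 0 <= C -> 0 < k ->
  (forall x, Rabs (x - x0) <= l -> u1 x t0 <= quad A1 P1 X1 x0 x - m * (x - x0) ^ 2) ->
  u1 x0 t0 = A1 ->
  (forall y, Rabs (y - y0) <= l -> u2 y t0 <= quad A2 P2 X2 y0 y - m * (y - y0) ^ 2) ->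
  u2 y0 t0 = A2 ->
  (forall x t, 0 < t < T -> Rabs (x - x0) <= l ->
     F1 x t (P1 + X1 * (x - x0)) X1 <= F1 x0 t P1 X1 + K * Rabs (x - x0)) ->
  (forall y t, 0 < t < T -> Rabs (y - y0) <= l ->
     F2 y t (P2 + X2 * (y - y0)) X2 <= F2 y0 t P2 X2 + K * Rabs (y - y0)) ->
  (forall t, 0 < t < T -> F1 x0 t P1 X1 <= C /\ F2 y0 t P2 X2 <= C /\
     F1 x0 t P1 X1 + F2 y0 t P2 X2 <= eta) ->
  exists tau, 0 < tau /\ forall t, t0 <= t <= t0 + tau -> t <= T ->
    forall x y, Rabs (x - x0) <= l -> Rabs (y - y0) <= l ->
    u1 x t + u2 y t <= quad A1 P1 X1 x0 x + quad A2 P2 X2 y0 y + (eta + k) * (t - t0).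
Proof.
intros c1 c2 h1 h2 ht0 hT hl hm hK hC hk q1 a1 q2 a2 k1 k2 hFF.
destruct (local_excess T F1 u1 A1 P1 X1 x0 l m K t0 (k / 2)) as [f [d1 [hd1 [dT1 [fc [fge [f0 ft]]]]]]]; try assumption; [lra|].
destruct (local_excess T F2 u2 A2 P2 X2 y0 l m K t0 (k / 2)) as [g [d2 [hd2 [dT2 [gc [gge [g0 gt]]]]]]]; try assumption; [lra|].
exists (Rmin d1 d2). split; [apply Rmin_pos; lra|].
intros t ht htT x y hx hy.
assert (td1 : Rmin d1 d2 <= d1) by apply Rmin_l. assert (td2 : Rmin d1 d2 <= d2) by apply Rmin_r.
assert (f t + g t <= (eta + k) * (t - t0)).
{ destruct (Req_dec t0 t) as [<-|n]; [lra|].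
  assert (f t + g t <= f t0 + g t0 + (eta + k) * (t - t0)); [|lra].
  apply (sum_slope_bound f g (fun s => F1 x0 s P1 X1 + k / 2) (fun s => F2 y0 s P2 X2 + k / 2) t0 t (C + k)); try lra.
  - intros; apply fc.
  - intros; apply gc.
  - intros s psi psi1 hs. apply ft. lra.
  - intros s psi psi1 hs. apply gt. lra.
  - intros s hs. destruct (hFF s) as [b1 [b2 b3]]; [lra|]. lra. }
specialize (fge t x hx). specialize (gge t y hy). lra.
Qed.

(** * Expansions at differentiability points of the maximizers *)

Definition deriv0 (x : R -> R) (D : R) : Prop :=
  forall e, 0 < e -> exists d, 0 < d /\ forall r, Rabs r < d -> Rabs (x r - x 0 - D * r) <= e * Rabs r.

(* [x] is a point where the sup-convolution of [f] at [z] is attained. *)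
Definition prox (f : R -> R) (k z x : R) : Prop :=
  forall xi, f xi - k * (xi - z) ^ 2 <= f x - k * (x - z) ^ 2.

Section ProxExpansion.
Variables (f x z : R -> R) (k al ze d0 : R).
Hypothesis k_pos : 0 < k.
Hypothesis al_nonneg : 0 <= al.
Hypothesis ze_pos : 0 < ze.
Hypothesis d0_pos : 0 < d0.
Hypothesis z_mono : forall r s, r <= s -> z s <= z r.
Hypothesis hprox : forall r, Rabs r < d0 -> prox f k (z r) (x r).
Hypothesis x_deriv : deriv0 x (- al).
Hypothesis z_deriv : deriv0 z (- ze).

(* The sup-convolution of [f], made convex by adding [k z^2], along the curve. *)
Let U (r : R) : R := f (x r) - k * (x r - z r) ^ 2 + k * z r ^ 2.

(** As a function of [z], the convexified sup-convolution is a supremum of the affine functions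
    [f xi - k xi^2 + 2 k xi z], so [2 k x] is a subgradient. *)
Let U_subgradient (r s : R) : Rabs s < d0 -> U r - U s <= 2 * k * x r * (z r - z s).
Proof. intro hs. specialize (hprox s hs (x r)). unfold U. nra. Qed.

(** Sums the subgradient inequality over the nodes [i * r / N], a Riemann-Stieltjes sum of [2 k x]
    against [z], with [x] replaced by its expansion at 0. Summation by parts leaves only values of
    [z], because increments of [z] between neighboring nodes are not controlled by the derivative at
    0. The [match] stands for an empty sum at [i = 0], since [sum_f_R0] always has a term. *)
Let chain (r e : R) (N : nat) : (0 < N)%nat -> Rabs r < d0 -> 0 <= e ->
  (forall s, Rabs s <= Rabs r -> Rabs (x s - x 0 + al * s) <= e * Rabs r) ->
  forall i, (i <= N)%nat ->
  U (INR i * (r / INR N)) - U 0 <=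
   2 * k * (x 0 * (z (INR i * (r / INR N)) - z 0)
     - al * (INR i * (r / INR N) * (z (INR i * (r / INR N)) - z 0)
              - (r / INR N) * match i with O => 0 | S j => sum_f_R0 (fun j => z (INR j * (r / INR N)) - z 0) j end)
     + e * Rabs r * Rabs (z (INR i * (r / INR N)) - z 0)).
Proof.
intros hN hr he hx. assert (hNp : 0 < INR N) by (apply lt_0_INR; exact hN).
set (h := r / INR N).
assert (hh : forall i, (i <= N)%nat -> Rabs (INR i * h) <= Rabs r).
{ intros i hi. rewrite Rabs_mult, (Rabs_pos_eq (INR i)) by apply pos_INR.
  unfold h, Rdiv. rewrite Rabs_mult, Rabs_inv, (Rabs_pos_eq (INR N)) by lra.
  apply le_INR in hi. apply Rmult_le_reg_r with (INR N); [lra|].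
  replace (INR i * (Rabs r * / INR N) * INR N) with (INR i * Rabs r) by (field; lra).
  pose proof (Rabs_pos r). nra. }
induction i as [|i IH]; intro hi.
- simpl. rewrite !Rmult_0_l, !Rminus_diag, Rabs_R0. lra.
- assert (hi' : (i <= N)%nat) by lia. specialize (IH hi').
  assert (E : match S i with O => 0 | S j => sum_f_R0 (fun j => z (INR j * h) - z 0) j end =
    match i with O => 0 | S j => sum_f_R0 (fun j => z (INR j * h) - z 0) j end + (z (INR i * h) - z 0)).
  { destruct i; simpl; ring. }
  rewrite E. clear E.
  set (S := match i with O => 0 | S j => sum_f_R0 (fun j => z (INR j * h) - z 0) j end) in *.
  pose proof (U_subgradient (INR (Datatypes.S i) * h) (INR i * h)
    (Rle_lt_trans _ _ _ (hh i hi') hr)) as hs.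
  pose proof (hx _ (hh _ hi)) as hxi.
  set (zi := z (INR i * h)) in *. set (zs := z (INR (Datatypes.S i) * h)) in *.
  set (xs := x (INR (Datatypes.S i) * h)) in *.
  rewrite S_INR in *.
  (* Monotonicity of [z] makes its increments add up to [|z - z 0|], so the errors telescope. *)
  assert (key : (xs - x 0 + al * ((INR i + 1) * h)) * (zs - zi) <= e * Rabs r * (Rabs (zs - z 0) - Rabs (zi - z 0))).
  { assert (hz : Rabs (zs - zi) = Rabs (zs - z 0) - Rabs (zi - z 0)).
    { assert (zm : forall s t, s <= t -> z t <= z s) by exact z_mono.
      pose proof (pos_INR i) as pi.
      destruct (Rle_lt_dec 0 h) as [h0|h0].
      - assert (zs <= zi) by (apply zm; rewrite ?S_INR; nra).
        assert (zi <= z 0) by (apply zm; nra).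
        rewrite !Rabs_left1 by lra. ring.
      - assert (zi <= zs) by (apply zm; rewrite ?S_INR; nra).
        assert (z 0 <= zi) by (apply zm; nra).
        rewrite !Rabs_pos_eq by lra. ring. }
    rewrite <- hz. apply Rle_trans with (1 := Rle_abs _). rewrite Rabs_mult.
    apply Rmult_le_compat_r; [apply Rabs_pos|exact hxi]. }
  nra.
Qed.

(** In the limit of fine meshes the Stieltjes sum of [2 k (- al s)] against [- ze s] is
    [k * al * ze * r ^ 2]; the rest is the linear term and small errors. *)
Let U_upper (kap : R) : 0 < kap -> exists d, 0 < d /\ d <= d0 /\ forall r, Rabs r < d ->
  U r <= U 0 + 2 * k * x 0 * (z r - z 0) + (k * al * ze + kap) * r ^ 2.
Proof.
intro hkap.
set (e := Rmin 1 (kap / (2 * k * (2 * al + ze + 2)))).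
assert (hden : 0 < 2 * k * (2 * al + ze + 2)) by nra.
assert (he : 0 < e) by (apply Rmin_pos; [lra|apply Rdiv_lt_0_compat; lra]).
assert (he1 : e <= 1) by apply Rmin_l.
assert (he2 : e * (2 * k * (2 * al + ze + 2)) <= kap).
{ apply Rle_trans with (kap / (2 * k * (2 * al + ze + 2)) * (2 * k * (2 * al + ze + 2))).
  - apply Rmult_le_compat_r; [lra|apply Rmin_r].
  - right. field. split; lra. }
destruct (x_deriv e he) as [dx [hdx Hx]]. destruct (z_deriv e he) as [dz [hdz Hz]].
exists (Rmin d0 (Rmin dx dz)). split; [repeat apply Rmin_pos; assumption|]. split; [apply Rmin_l|].
intros r hr.
assert (r0 : Rabs r < d0) by (eapply Rlt_le_trans; [exact hr|apply Rmin_l]).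
assert (rx : Rabs r < dx) by (eapply Rlt_le_trans; [exact hr|eapply Rle_trans; [apply Rmin_r|apply Rmin_l]]).
assert (rz : Rabs r < dz) by (eapply Rlt_le_trans; [exact hr|eapply Rle_trans; [apply Rmin_r|apply Rmin_r]]).
assert (hxs : forall s, Rabs s <= Rabs r -> Rabs (x s - x 0 + al * s) <= e * Rabs r).
{ intros s hs. replace (x s - x 0 + al * s) with (x s - x 0 - - al * s) by ring.
  apply Rle_trans with (e * Rabs s); [apply Hx; lra|]. apply Rmult_le_compat_l; lra. }
apply le_epsilon. intros eta heta.
(* The triangular sum [h^2 n (n + 1) / 2] with [N = n + 1] equals [r^2 / 2 - r^2 / (2 N)]; [N] is
   large enough for the defect to stay below [eta]. *)
destruct (nfloor_ex (k * al * ze * r ^ 2 / eta)) as [n [_ Hn]].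
{ apply Rdiv_le_0_compat; [|exact heta]. apply Rmult_le_pos; [repeat apply Rmult_le_pos; lra|apply pow2_ge_0]. }
set (N := S n). assert (hN : (0 < N)%nat) by (unfold N; lia).
assert (hNp : 0 < INR N) by (apply lt_0_INR; exact hN).
assert (hNe : k * al * ze * r ^ 2 / INR N <= eta).
{ apply Rmult_le_reg_r with (INR N); [lra|].
  replace (k * al * ze * r ^ 2 / INR N * INR N) with (k * al * ze * r ^ 2) by (field; lra).
  apply Rlt_le. unfold N. rewrite S_INR. apply Rmult_lt_compat_r with (r := eta) in Hn; [|exact heta].
  replace (k * al * ze * r ^ 2 / eta * eta) with (k * al * ze * r ^ 2) in Hn by (field; lra). lra. }
pose proof (chain r e (S n) hN r0 (Rlt_le _ _ he) hxs (S n) (Nat.le_refl _)) as hc.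
cbv iota in hc. fold N in hc. set (h := r / INR N) in *.
replace (INR N * h) with r in hc by (unfold h; field; lra).
assert (hsum : forall j, (j < N)%nat -> h * sum_f_R0 (fun j => z (INR j * h) - z 0) j <=
   - ze * h ^ 2 * (INR j * (INR j + 1) / 2) + e * h ^ 2 * (INR j * (INR j + 1) / 2)).
{ induction j as [|j IH]; intro hj.
  - simpl. rewrite Rmult_0_l, Rminus_diag. lra.
  - specialize (IH ltac:(lia)). rewrite tech5. rewrite S_INR in *.
    assert (hjr : Rabs ((INR j + 1) * h) < dz).
    { apply Rle_lt_trans with (Rabs r); [|exact rz].
      pose proof (pos_INR j). rewrite Rabs_mult, (Rabs_pos_eq (INR j + 1)) by lra.
      unfold h, Rdiv. rewrite Rabs_mult, Rabs_inv, (Rabs_pos_eq (INR N)) by lra.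
      apply lt_INR in hj. rewrite S_INR in hj. apply Rmult_le_reg_r with (INR N); [lra|].
      replace ((INR j + 1) * (Rabs r * / INR N) * INR N) with ((INR j + 1) * Rabs r) by (field; lra).
      pose proof (Rabs_pos r). nra. }
    pose proof (Hz _ hjr) as hz.
    assert (hz2 : h * (z ((INR j + 1) * h) - z 0 + ze * ((INR j + 1) * h)) <= e * h ^ 2 * (INR j + 1)).
    { apply Rle_trans with (1 := Rle_abs _). rewrite Rabs_mult.
      apply Rle_trans with (Rabs h * (e * Rabs ((INR j + 1) * h))).
      - apply Rmult_le_compat_l; [apply Rabs_pos|].
        replace (z ((INR j + 1) * h) - z 0 + ze * ((INR j + 1) * h)) with (z ((INR j + 1) * h) - z 0 - - ze * ((INR j + 1) * h)) by ring.
        exact hz.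
      - pose proof (pos_INR j). rewrite Rabs_mult, (Rabs_pos_eq (INR j + 1)) by lra.
        rewrite <- (pow2_abs h). right. ring. }
    nra. }
specialize (hsum n ltac:(unfold N; lia)).
set (S := sum_f_R0 (fun j => z (INR j * h) - z 0) n) in *.
assert (hnh : (INR n + 1) * h = r) by (unfold h, N; rewrite S_INR; field; pose proof (pos_INR n); lra).
assert (hS : h * S <= - ze * (r ^ 2 / 2 - r ^ 2 / INR N / 2) + e * (r ^ 2 / 2)).
{ assert (e1 : h ^ 2 * (INR n * (INR n + 1) / 2) = r ^ 2 / 2 - r ^ 2 / INR N / 2).
  { rewrite <- hnh. unfold N. rewrite S_INR. field. pose proof (pos_INR n). lra. }
  assert (e2 : 0 <= r ^ 2 / INR N / 2).
  { apply Rdiv_le_0_compat; [|lra]. apply Rdiv_le_0_compat; [apply pow2_ge_0|lra]. }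
  rewrite !Rmult_assoc in hsum. rewrite e1 in hsum. nra. }
assert (hzr : Rabs (z r - z 0 + ze * r) <= e * Rabs r).
{ replace (z r - z 0 + ze * r) with (z r - z 0 - - ze * r) by ring. apply Hz. exact rz. }
assert (hrr : - (r * (z r - z 0)) <= ze * r ^ 2 + e * r ^ 2).
{ assert (- r * (z r - z 0 + ze * r) <= Rabs r * (e * Rabs r)).
  { apply Rle_trans with (1 := Rle_abs _). rewrite Rabs_mult, Rabs_Ropp.
    apply Rmult_le_compat_l; [apply Rabs_pos|exact hzr]. }
  replace (Rabs r * (e * Rabs r)) with (e * r ^ 2) in H by (rewrite <- (pow2_abs r); ring). nra. }
assert (hza : Rabs r * Rabs (z r - z 0) <= (ze + e) * r ^ 2).
{ rewrite <- (pow2_abs r).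
  assert (Rabs (z r - z 0) <= (ze + e) * Rabs r); [|pose proof (Rabs_pos r); nra].
  replace (z r - z 0) with ((z r - z 0 + ze * r) + - (ze * r)) by ring.
  apply Rle_trans with (1 := Rabs_triang _ _). rewrite Rabs_Ropp, Rabs_mult, (Rabs_pos_eq ze) by lra. lra. }
pose proof (pow2_ge_0 r) as hr2.
assert (hEta : al * (ze * (r ^ 2 / INR N / 2)) * (2 * k) <= eta).
{ apply Rle_trans with (2 := hNe). right. field. lra. }
assert (b1 : - al * (r * (z r - z 0) - h * S) <= al * (ze * r ^ 2 + e * r ^ 2) + al * (- ze * (r ^ 2 / 2 - r ^ 2 / INR N / 2) + e * (r ^ 2 / 2))).
{ nra. }
assert (b2 : e * Rabs r * Rabs (z r - z 0) <= e * ((ze + e) * r ^ 2)) by nra.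
assert (b3 : e * ((ze + e) * r ^ 2) <= e * ((ze + 1) * r ^ 2)) by nra.
assert (b4 : e * (2 * k * (2 * al + ze + 2)) * r ^ 2 <= kap * r ^ 2) by nra.
assert (b5 : 2 * k * (- al * (r * (z r - z 0) - h * S) + e * Rabs r * Rabs (z r - z 0)) <=
  2 * k * (al * (ze * r ^ 2 + e * r ^ 2) + al * (- ze * (r ^ 2 / 2 - r ^ 2 / INR N / 2) + e * (r ^ 2 / 2)) + e * ((ze + 1) * r ^ 2))).
{ apply Rmult_le_compat_l; lra. }
assert (b6 : 0 <= k * e * r ^ 2) by (apply Rmult_le_pos; [nra|lra]).
assert (b7 : 0 <= al * (k * e * r ^ 2)) by (apply Rmult_le_pos; lra).
nra.
Qed.

(** Optimality of [x r] in the sup-convolution at [z r] bounds [f xi] for every [r]; taking [r]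
    proportional to [xi - x 0] gives the paraboloid. Adding [kap] to [al] covers the case where the
    maximizer is stationary. *)
Lemma prox_expansion (kap eta : R) : 0 < kap -> 0 < eta -> exists l, 0 < l /\
  forall xi, Rabs (xi - x 0) <= l ->
  f xi <= quad (f (x 0)) (2 * k * (x 0 - z 0)) (2 * k * (1 - ze / (al + kap)) + eta) (x 0) xi.
Proof.
intros hkap heta. set (a := al + kap). assert (ha : 0 < a) by (unfold a; lra).
destruct (U_upper (eta * a ^ 2 / 4)) as [d [hd [hdd0 Hd]]].
{ apply Rdiv_lt_0_compat; [|lra]. apply Rmult_lt_0_compat; [lra|apply pow_lt; lra]. }
assert (he : 0 < eta * a / (8 * k)) by (apply Rdiv_lt_0_compat; nra).
destruct (z_deriv _ he) as [dz [hdz Hz]].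
exists (Rmin d dz * a / 2).
assert (hm : 0 < Rmin d dz) by (apply Rmin_pos; lra).
split; [nra|]. intros xi hxi.
(* To first order [x r] equals [xi] when [al] is replaced by [a]. *)
set (t := xi - x 0) in *. set (r := - t / a).
assert (hr : Rabs r < Rmin d dz).
{ unfold r, Rdiv. rewrite Rabs_mult, Rabs_Ropp, Rabs_inv, (Rabs_pos_eq a) by lra.
  apply Rmult_lt_reg_r with a; [lra|]. rewrite Rmult_assoc, Rinv_l, Rmult_1_r by lra. nra. }
assert (r1 : Rabs r < d) by (eapply Rlt_le_trans; [exact hr|apply Rmin_l]).
assert (r2 : Rabs r < dz) by (eapply Rlt_le_trans; [exact hr|apply Rmin_r]).
assert (r3 : Rabs r < d0) by lra.
pose proof (hprox r r3 xi) as hp. specialize (Hd r r1). specialize (Hz r r2).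
assert (ta : t = - (a * r)) by (unfold r; field; lra).
assert (hzt : - (2 * k * t * (z r - z 0 + ze * r)) <= eta / 4 * t ^ 2).
{ replace (- (2 * k * t * (z r - z 0 + ze * r))) with ((- 2 * k * t) * (z r - z 0 - - ze * r)) by ring.
  apply Rle_trans with (1 := Rle_abs _). rewrite Rabs_mult.
  apply Rle_trans with (Rabs (- 2 * k * t) * (eta * a / (8 * k) * Rabs r)).
  - apply Rmult_le_compat_l; [apply Rabs_pos|exact Hz].
  - replace (- 2 * k * t) with (2 * k * a * r) by (rewrite ta; ring).
    rewrite Rabs_mult, (Rabs_pos_eq (2 * k * a)) by nra.
    replace (2 * k * a * Rabs r * (eta * a / (8 * k) * Rabs r)) with (eta / 4 * (a ^ 2 * Rabs r ^ 2)) by (field; lra).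
    rewrite pow2_abs, ta. right. ring. }
assert (Hf : f xi <= f (x 0) + 2 * k * (x 0 - z 0) * t + k * t ^ 2 - 2 * k * t * (z r - z 0) + (k * al * ze + eta * a ^ 2 / 4) * r ^ 2).
{ replace xi with (x 0 + t) in * by (unfold t; ring). unfold U in Hd. nra. }
assert (h2 : (k * al * ze) * r ^ 2 <= k * a * ze * r ^ 2).
{ pose proof (pow2_ge_0 r). apply Rmult_le_compat_r; [lra|]. unfold a.
  assert (0 <= k * kap * ze) by (repeat apply Rmult_le_pos; lra). lra. }
assert (h3 : k * a * ze * r ^ 2 = k * (ze / a) * t ^ 2) by (rewrite ta; field; lra).
assert (h4 : eta * a ^ 2 / 4 * r ^ 2 = eta / 4 * t ^ 2) by (rewrite ta; field).
assert (h5 : 2 * k * t * (ze * r) = - (2 * k * (ze / a) * t ^ 2)) by (rewrite ta; field; lra).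
unfold quad. fold t. nra.
Qed.
End ProxExpansion.

(** * Doubled maxima and their dependence on the tilt *)

Definition Phi (f1 f2 : R -> R) (k p x y : R) : R :=
  f1 x + f2 y - k / 2 * (x - y) ^ 2 - p * (x + y) / 2.

Definition is_max (f1 f2 : R -> R) (k p x y : R) : Prop :=
  forall x' y', Phi f1 f2 k p x' y' <= Phi f1 f2 k p x y.

(** The optimal [z] in the splitting of the penalty below. *)
Definition mid (k p x y : R) : R := (x + y) / 2 - p / (4 * k).

(* Completing the square in [z] splits the penalty of [Phi] into
   [k (x - z)^2 + k (y - z)^2 + p z]. *)
Lemma Phi_split (f1 f2 : R -> R) (k p x y z : R) : 0 < k ->
  f1 x - k * (x - z) ^ 2 + (f2 y - k * (y - z) ^ 2) - p * z =
  Phi f1 f2 k p x y + p ^ 2 / (8 * k) - 2 * k * (z - mid k p x y) ^ 2.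
Proof. intro hk. unfold Phi, mid. field. lra. Qed.

Lemma is_max_split (f1 f2 : R -> R) (k p x y : R) : 0 < k -> is_max f1 f2 k p x y ->
  let z := mid k p x y in forall x' y' z',
  f1 x' - k * (x' - z') ^ 2 + (f2 y' - k * (y' - z') ^ 2) - p * z' + 2 * k * (z' - mid k p x' y') ^ 2 <=
  f1 x - k * (x - z) ^ 2 + (f2 y - k * (y - z) ^ 2) - p * z.
Proof.
intros hk hm z x' y' z'. pose proof (Phi_split f1 f2 k p x' y' z' hk).
pose proof (Phi_split f1 f2 k p x y z hk). specialize (hm x' y').
unfold z in *. rewrite Rminus_diag in H0. lra.
Qed.

Lemma is_max_prox (f1 f2 : R -> R) (k p x y : R) : 0 < k -> is_max f1 f2 k p x y ->
  prox f1 k (mid k p x y) x /\ prox f2 k (mid k p x y) y.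
Proof.
intros hk hm. pose proof (is_max_split f1 f2 k p x y hk hm) as H. simpl in H.
split; intro xi.
- specialize (H xi y (mid k p x y)).
  assert (0 <= (mid k p x y - mid k p xi y) ^ 2) by apply pow2_ge_0. simpl in *. nra.
- specialize (H x xi (mid k p x y)).
  assert (0 <= (mid k p x y - mid k p x xi) ^ 2) by apply pow2_ge_0. simpl in *. nra.
Qed.

Lemma prox_mono (f : R -> R) (k z z' x x' : R) : 0 < k -> prox f k z x -> prox f k z' x' ->
  z' < z -> x' <= x.
Proof.
intros hk h h' hz. specialize (h x'). specialize (h' x).
assert (h2 : 0 <= k * ((x - x') * (z - z'))) by nra.
apply Rnot_lt_le. intro hx. assert (0 < k * ((x' - x) * (z - z'))) by (repeat apply Rmult_lt_0_compat; lra).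
lra.
Qed.

(** Exchanging the competitors of the two maximum problems shows that [mid] does not increase with
    [p]. Equality would force the same [x] and [y], and then the [p] in [mid] contradicts it.
    Strictness is needed because two points attained at the same [z] need not be ordered. *)
Lemma is_max_mono (f1 f2 : R -> R) (k p p' x y x' y' : R) : 0 < k -> p < p' ->
  is_max f1 f2 k p x y -> is_max f1 f2 k p' x' y' -> x' <= x /\ y' <= y.
Proof.
intros hk hp h h'.
pose proof (is_max_split f1 f2 k p x y hk h) as H. simpl in H.
pose proof (is_max_split f1 f2 k p' x' y' hk h') as H'. simpl in H'.
destruct (is_max_prox _ _ _ _ _ _ hk h) as [p1 p2].
destruct (is_max_prox _ _ _ _ _ _ hk h') as [p1' p2'].
assert (hz : mid k p' x' y' < mid k p x y).
{ assert (hz : mid k p' x' y' <= mid k p x y).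
  { specialize (H x' y' (mid k p' x' y')). specialize (H' x y (mid k p x y)).
    assert (a1 : 0 <= (mid k p' x' y' - mid k p x' y') ^ 2) by apply pow2_ge_0.
    assert (a2 : 0 <= (mid k p x y - mid k p' x y) ^ 2) by apply pow2_ge_0.
    set (z := mid k p x y) in *. set (z' := mid k p' x' y') in *.
    simpl in *. nra. }
  destruct (Rle_lt_or_eq_dec _ _ hz) as [l|e]; [exact l|exfalso].
  rewrite e in *. set (z := mid k p x y) in *.
  assert (hx : x' = x).
  { specialize (H x' y z). specialize (p1' x).
    assert (a : k * (z - mid k p x' y) ^ 2 <= 0) by (simpl in *; nra).
    assert (b : z - mid k p x' y = 0).
    { apply Rsqr_0_uniq. unfold Rsqr. assert (0 <= (z - mid k p x' y) * (z - mid k p x' y)) by apply Rle_0_sqr.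
      simpl in a. nra. }
    unfold z, mid in b. lra. }
  assert (hy : y' = y).
  { specialize (H x y' z). specialize (p2' y).
    assert (a : k * (z - mid k p x y') ^ 2 <= 0) by (simpl in *; nra).
    assert (b : z - mid k p x y' = 0).
    { apply Rsqr_0_uniq. unfold Rsqr. assert (0 <= (z - mid k p x y') * (z - mid k p x y')) by apply Rle_0_sqr.
      simpl in a. nra. }
    unfold z, mid in b. lra. }
  subst x' y'. unfold z, mid in e.
  assert (p / (4 * k) < p' / (4 * k)).
  { apply Rmult_lt_compat_r; [apply Rinv_0_lt_compat; lra|exact hp]. }
  lra. }
split; eapply prox_mono; eauto.
Qed.

Lemma deriv0_lin (x y : R -> R) (a b c d : R) :
  deriv0 x a -> deriv0 y b -> deriv0 (fun r => (x r + y r) / 2 - (c + r) / d) ((a + b) / 2 - / d).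
Proof.
intros hx hy e he. destruct (hx e he) as [d1 [h1 H1]]. destruct (hy e he) as [d2 [h2 H2]].
exists (Rmin d1 d2). split; [apply Rmin_pos; lra|]. intros r hr.
assert (r1 : Rabs r < d1) by (eapply Rlt_le_trans; [exact hr|apply Rmin_l]).
assert (r2 : Rabs r < d2) by (eapply Rlt_le_trans; [exact hr|apply Rmin_r]).
specialize (H1 r r1). specialize (H2 r r2).
apply Rabs_le_between in H1. apply Rabs_le_between in H2.
apply Rabs_le. unfold Rdiv. rewrite Rplus_0_r. lra.
Qed.

(** Both expansions are taken along the common curve [z], whose speed [ze] is positive thanks to the
    tilt. The two openings involve the same [ze], which is what orders them jointly. *)
Lemma good_expansion (f1 f2 X Y : R -> R) (k p0 d0 al be : R) : 0 < k -> 0 < d0 ->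
  0 <= al -> 0 <= be ->
  (forall r s, r <= s -> X s <= X r) -> (forall r s, r <= s -> Y s <= Y r) ->
  (forall r, Rabs r < d0 -> is_max f1 f2 k (p0 + r) (X r) (Y r)) ->
  deriv0 X (- al) -> deriv0 Y (- be) ->
  exists X1 X2 m l, 0 < m /\ 0 < l /\
    (forall xi, Rabs (xi - X 0) <= l ->
       f1 xi <= quad (f1 (X 0)) (k * (X 0 - Y 0) + p0 / 2) X1 (X 0) xi - m * (xi - X 0) ^ 2) /\
    (forall eta, Rabs (eta - Y 0) <= l ->
       f2 eta <= quad (f2 (Y 0)) (k * (Y 0 - X 0) + p0 / 2) X2 (Y 0) eta - m * (eta - Y 0) ^ 2) /\
    (forall xi eta, X1 * xi ^ 2 + X2 * eta ^ 2 <= k * (xi - eta) ^ 2).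
Proof.
intros hk hd hal hbe mX mY hmax dX dY.
set (z := fun r => (X r + Y r) / 2 - (p0 + r) / (4 * k)).
set (ze := (al + be) / 2 + / (4 * k)).
assert (h4k : 0 < / (4 * k)) by (apply Rinv_0_lt_compat; lra).
assert (hze : 0 < ze) by (unfold ze; lra).
assert (mz : forall r s, r <= s -> z s <= z r).
{ intros r s h. specialize (mX r s h). specialize (mY r s h). unfold z, Rdiv. nra. }
assert (dz : deriv0 z (- ze)).
{ replace (- ze) with ((- al + - be) / 2 - / (4 * k)) by (unfold ze; field; lra).
  apply deriv0_lin; assumption. }
assert (z0 : z 0 = (X 0 + Y 0) / 2 - p0 / (4 * k)) by (unfold z; rewrite Rplus_0_r; reflexivity).
(* Here [2 ze = al + be + / (2 k)]; two copies of [kap] use half of the last term, and the other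
   half pays for the margins [m]. *)
set (kap := / (8 * k)). assert (hkap : 0 < kap) by (apply Rinv_0_lt_compat; lra).
assert (kk : / (4 * k) = 2 * kap) by (unfold kap; field; lra).
set (a := al + kap). set (b := be + kap).
assert (ha : 0 < a) by (unfold a; lra). assert (hb : 0 < b) by (unfold b; lra).
set (m := Rmin (/ (16 * a)) (/ (16 * b))).
assert (hm : 0 < m) by (apply Rmin_pos; apply Rinv_0_lt_compat; lra).
assert (ma : m * (16 * a) <= 1).
{ apply Rle_trans with (/ (16 * a) * (16 * a)); [apply Rmult_le_compat_r; [lra|apply Rmin_l]|right; field; lra]. }
assert (mb : m * (16 * b) <= 1).
{ apply Rle_trans with (/ (16 * b) * (16 * b)); [apply Rmult_le_compat_r; [lra|apply Rmin_r]|right; field; lra]. }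
destruct (prox_expansion f1 X z k al ze d0) with (kap := kap) (eta := m) as [l1 [hl1 H1]]; try assumption.
{ intros r hr. apply (is_max_prox f1 f2 k (p0 + r) (X r) (Y r) hk (hmax r hr)). }
destruct (prox_expansion f2 Y z k be ze d0) with (kap := kap) (eta := m) as [l2 [hl2 H2]]; try assumption.
{ intros r hr. apply (is_max_prox f1 f2 k (p0 + r) (X r) (Y r) hk (hmax r hr)). }
fold a in H1. fold b in H2.
exists (2 * k * (1 - ze / a) + 4 * m), (2 * k * (1 - ze / b) + 4 * m), m, (Rmin l1 l2).
split; [exact hm|]. split; [apply Rmin_pos; assumption|].
assert (e1 : 2 * k * (X 0 - z 0) = k * (X 0 - Y 0) + p0 / 2) by (rewrite z0; field; lra).
assert (e2 : 2 * k * (Y 0 - z 0) = k * (Y 0 - X 0) + p0 / 2) by (rewrite z0; field; lra).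
rewrite e1 in H1. rewrite e2 in H2.
split; [|split].
- intros xi hxi. assert (hxi' : Rabs (xi - X 0) <= l1) by (eapply Rle_trans; [exact hxi|apply Rmin_l]).
  specialize (H1 xi hxi'). unfold quad in *. pose proof (pow2_ge_0 (xi - X 0)). nra.
- intros xi hxi. assert (hxi' : Rabs (xi - Y 0) <= l2) by (eapply Rle_trans; [exact hxi|apply Rmin_r]).
  specialize (H2 xi hxi'). unfold quad in *. pose proof (pow2_ge_0 (xi - Y 0)). nra.
- (* With [2 ze = a + b + / (4 k)] and AM-GM: [(b / a) xi^2 + (a / b) eta^2 >= 2 xi eta]. *)
  intros xi eta.
  assert (hz : ze = (a + b + / (4 * k)) / 2) by (unfold ze, a, b; rewrite kk; lra).
  assert (q1 : 2 * k * (1 - ze / a) * xi ^ 2 = k * xi ^ 2 - k * (b / a) * xi ^ 2 - / (4 * a) * xi ^ 2).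
  { rewrite hz. field. lra. }
  assert (q2 : 2 * k * (1 - ze / b) * eta ^ 2 = k * eta ^ 2 - k * (a / b) * eta ^ 2 - / (4 * b) * eta ^ 2).
  { rewrite hz. field. lra. }
  assert (q3 : 2 * xi * eta <= (b / a) * xi ^ 2 + (a / b) * eta ^ 2).
  { assert (0 <= (b * xi - a * eta) ^ 2 / (a * b)).
    { apply Rdiv_le_0_compat; [apply pow2_ge_0|nra]. }
    replace ((b * xi - a * eta) ^ 2 / (a * b)) with ((b / a) * xi ^ 2 + (a / b) * eta ^ 2 - 2 * xi * eta) in H by (field; lra). lra. }
  assert (q4 : 4 * m * xi ^ 2 <= / (4 * a) * xi ^ 2).
  { apply Rmult_le_compat_r; [apply pow2_ge_0|]. apply Rmult_le_reg_r with (4 * a); [lra|].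
    rewrite Rinv_l by lra. lra. }
  assert (q5 : 4 * m * eta ^ 2 <= / (4 * b) * eta ^ 2).
  { apply Rmult_le_compat_r; [apply pow2_ge_0|]. apply Rmult_le_reg_r with (4 * b); [lra|].
    rewrite Rinv_l by lra. lra. }
  nra.
Qed.

(** * Maxima on rectangles *)

Lemma max_rectangle (u : R -> R -> R) (a b c d : R) : cont2 u -> a <= b -> c <= d ->
  exists x y, a <= x <= b /\ c <= y <= d /\
    forall x' y', a <= x' <= b -> c <= y' <= d -> u x' y' <= u x y.
Proof.
intros hu hab hcd.
destruct (partial_max u (fun _ => 0) a b hu) as [f [fc [fge fm]]]; [|exact hab|].
{ intro x. apply continuity_pt_const. intros ? ?; reflexivity. }
destruct (continuity_ab_maj f c d hcd) as [y [hy hyd]]; [intros; apply fc|].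
destruct (fm y) as [x [hx e]]. exists x, y. split; [exact hx|]. split; [exact hyd|].
intros x' y' hx' hy'. specialize (fge y' x' hx'). specialize (hy y' hy'). lra.
Qed.

(** Four rectangles cover the box outside the [l]-square around the maximizer, and compactness gives
    a gap on each. *)
Lemma strict_max_gap (u : R -> R -> R) (r x0 y0 l : R) : cont2 u -> 0 < l ->
  Rabs x0 <= r -> Rabs y0 <= r ->
  (forall x y, Rabs x <= r -> Rabs y <= r -> u x0 y0 <= u x y -> x = x0 /\ y = y0) ->
  exists ga, 0 < ga /\ forall x y, Rabs x <= r -> Rabs y <= r -> u x0 y0 - ga < u x y ->
    Rabs (x - x0) < l /\ Rabs (y - y0) < l.
Proof.
intros hu hl hx0 hy0 huniq.
assert (rect : forall a b c d, - r <= a -> b <= r -> - r <= c -> d <= r ->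
  ~ (a <= x0 <= b /\ c <= y0 <= d) -> exists ga, 0 < ga /\
    forall x y, a <= x <= b -> c <= y <= d -> u x y <= u x0 y0 - ga).
{ intros a b c d h1 h2 h3 h4 hn.
  destruct (Rle_lt_dec a b) as [hab|hab]; [|exists 1; split; [lra|intros; lra]].
  destruct (Rle_lt_dec c d) as [hcd|hcd]; [|exists 1; split; [lra|intros; lra]].
  destruct (max_rectangle u a b c d hu hab hcd) as [x [y [hx [hy H]]]].
  assert (hlt : u x y < u x0 y0).
  { apply Rnot_le_lt. intro h. destruct (huniq x y) as [-> ->]; try assumption.
    - apply Rabs_le. lra.
    - apply Rabs_le. lra.
    - apply hn. split; assumption. }
  exists (u x0 y0 - u x y). split; [lra|]. intros x' y' hx' hy'. specialize (H x' y' hx' hy'). lra. }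
apply Rabs_le_between in hx0. apply Rabs_le_between in hy0.
destruct (rect (- r) (x0 - l) (- r) r) as [g1 [hg1 G1]]; try lra.
destruct (rect (x0 + l) r (- r) r) as [g2 [hg2 G2]]; try lra.
destruct (rect (- r) r (- r) (y0 - l)) as [g3 [hg3 G3]]; try lra.
destruct (rect (- r) r (y0 + l) r) as [g4 [hg4 G4]]; try lra.
exists (Rmin (Rmin g1 g2) (Rmin g3 g4)). split; [repeat apply Rmin_pos; assumption|].
intros x y hx hy hxy. apply Rabs_le_between in hx. apply Rabs_le_between in hy.
assert (Rmin (Rmin g1 g2) (Rmin g3 g4) <= g1) by (eapply Rle_trans; [apply Rmin_l|apply Rmin_l]).
assert (Rmin (Rmin g1 g2) (Rmin g3 g4) <= g2) by (eapply Rle_trans; [apply Rmin_l|apply Rmin_r]).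
assert (Rmin (Rmin g1 g2) (Rmin g3 g4) <= g3) by (eapply Rle_trans; [apply Rmin_r|apply Rmin_l]).
assert (Rmin (Rmin g1 g2) (Rmin g3 g4) <= g4) by (eapply Rle_trans; [apply Rmin_r|apply Rmin_r]).
split.
- apply Rnot_le_lt. intro h. destruct (Rle_lt_dec x x0) as [c|c].
  + rewrite Rabs_left1 in h by lra. specialize (G1 x y ltac:(lra) ltac:(lra)). lra.
  + rewrite Rabs_pos_eq in h by lra. specialize (G2 x y ltac:(lra) ltac:(lra)). lra.
- apply Rnot_le_lt. intro h. destruct (Rle_lt_dec y y0) as [c|c].
  + rewrite Rabs_left1 in h by lra. specialize (G3 x y ltac:(lra) ltac:(lra)). lra.
  + rewrite Rabs_pos_eq in h by lra. specialize (G4 x y ltac:(lra) ltac:(lra)). lra.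
Qed.

Lemma Phi_cont2 (f1 f2 : R -> R) (k p : R) : (forall x, continuity_pt f1 x) ->
  (forall x, continuity_pt f2 x) -> cont2 (Phi f1 f2 k p).
Proof.
intros h1 h2 x y. unfold Phi.
apply continuity_2d_pt_minus; [apply continuity_2d_pt_minus; [apply continuity_2d_pt_plus|]|].
- apply (continuity_1d_2d_pt_comp f1 (fun x y => x)); [apply h1|apply continuity_2d_pt_id1].
- apply (continuity_1d_2d_pt_comp f2 (fun x y => y)); [apply h2|apply continuity_2d_pt_id2].
- apply (continuity_1d_2d_pt_comp (fun d => k / 2 * d ^ 2) (fun x y => x - y)).
  + apply derivable_continuous_pt. exists (k * (x - y)). apply is_derive_Reals. auto_derive; [exact I|]. simpl. field.
  + apply continuity_2d_pt_minus; [apply continuity_2d_pt_id1|apply continuity_2d_pt_id2].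
- apply (continuity_1d_2d_pt_comp (fun d => p * d / 2) (fun x y => x + y)).
  + apply derivable_continuous_pt. exists (p / 2). apply is_derive_Reals. auto_derive; [exact I|]. simpl. field.
  + apply continuity_2d_pt_plus; [apply continuity_2d_pt_id1|apply continuity_2d_pt_id2].
Qed.

(** A monotone function with a finite straddling derivative has no jump at [x], which supplies the
    continuity required by [straddle_deriv_expansion]. *)
Lemma straddle_deriv_mono (F : R -> R) (D x : R) : (forall a b, a <= b -> F a <= F b) ->
  straddle_deriv F D x -> 0 <= D /\ forall e, 0 < e -> exists d, 0 < d /\
    forall s, Rabs (s - x) < d -> Rabs (F s - F x - D * (s - x)) <= e * Rabs (s - x).
Proof.
intros hm hD.
assert (hpos : forall e, 0 < e -> exists d, 0 < d /\ forall h, 0 < h < d ->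
  0 <= F (x + h) - F (x - h) <= (D + e) * (2 * h)).
{ intros e he. destruct (hD e he) as [d [hd H]]. exists (d / 2). split; [lra|]. intros h hh.
  specialize (H (x - h) (x + h) ltac:(lra) ltac:(lra) ltac:(lra)). apply Rabs_le_between in H.
  specialize (hm (x - h) (x + h) ltac:(lra)). lra. }
split.
- apply le_epsilon. intros e he. destruct (hpos e he) as [d [hd H]]. specialize (H (d / 2) ltac:(lra)). nra.
- apply straddle_deriv_expansion; [|exact hD].
  intros e he. destruct (hpos 1 ltac:(lra)) as [d [hd H]].
  assert (hD1 : 0 < 2 * (Rabs D + 1)) by (pose proof (Rabs_pos D); lra).
  set (h := Rmin (d / 2) (e / 2 / (2 * (Rabs D + 1)))).
  assert (hh : 0 < h) by (apply Rmin_pos; [lra|apply Rdiv_lt_0_compat; lra]).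
  assert (h1 : h <= d / 2) by apply Rmin_l.
  assert (h2 : h * (2 * (Rabs D + 1)) <= e / 2).
  { apply Rle_trans with (e / 2 / (2 * (Rabs D + 1)) * (2 * (Rabs D + 1))); [apply Rmult_le_compat_r; [lra|apply Rmin_r]|right; field; lra]. }
  exists h. split; [exact hh|]. intros y [_ hy]. simpl in *. unfold Rdist in *. apply Rabs_def2 in hy.
  specialize (H h ltac:(lra)). pose proof (Rle_abs D).
  pose proof (hm y (x + h) ltac:(lra)). pose proof (hm (x - h) y ltac:(lra)).
  pose proof (hm x (x + h) ltac:(lra)). pose proof (hm (x - h) x ltac:(lra)).
  apply Rabs_def1; nra.
Qed.

(** * Comparison in logarithmic coordinates *)

(** The usual factor 1/2 of the second order term is contained in [s]; see [log_s]. *)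
Definition ham (s b c : R -> R -> R) (x t p X : R) : R :=
  s x t ^ 2 * X + b x t * p + c x t * Rabs p.

(* No regularity in time is assumed, not even measurability. *)
Definition coeffs_ok (T L La : R) (s : R -> R -> R) : Prop :=
  forall x y t, 0 < t < T -> Rabs (s x t) <= La /\ Rabs (s x t - s y t) <= L * Rabs (x - y).

Section Ham.
Variables (T L La : R) (s b c : R -> R -> R).
Hypothesis L_pos : 0 <= L.
Hypothesis La_pos : 0 <= La.
Hypothesis s_ok : coeffs_ok T L La s.
Hypothesis b_ok : coeffs_ok T L La b.
Hypothesis c_ok : coeffs_ok T L La c.

Lemma abs_prod_le (a b' A B' : R) : Rabs a <= A -> Rabs b' <= B' -> a * b' <= A * B'.
Proof.
intros h1 h2. apply Rle_trans with (1 := Rle_abs _). rewrite Rabs_mult.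
apply Rmult_le_compat; auto using Rabs_pos.
Qed.

Lemma sqr_le_abs (a A : R) : Rabs a <= A -> a ^ 2 <= A ^ 2.
Proof. intro h. rewrite <- (pow2_abs a). apply pow_incr. split; [apply Rabs_pos|exact h]. Qed.

Lemma ham_le (x t p X P Y : R) : 0 < t < T -> Rabs p <= P -> Rabs X <= Y ->
  ham s b c x t p X <= La ^ 2 * Y + 2 * La * P.
Proof.
intros ht hp hX. unfold ham.
assert (h1 : s x t ^ 2 * X <= La ^ 2 * Y).
{ apply abs_prod_le; [|exact hX]. rewrite Rabs_pos_eq by apply pow2_ge_0. apply sqr_le_abs, s_ok; [exact x|exact ht]. }
assert (h2 : b x t * p <= La * P) by (apply abs_prod_le; [apply (b_ok x x t ht)|exact hp]).
assert (h3 : c x t * Rabs p <= La * P).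
{ apply abs_prod_le; [apply (c_ok x x t ht)|]. rewrite Rabs_Rabsolu. exact hp. }
lra.
Qed.

Lemma ham_lipschitz (x0 P X l : R) : 0 <= l -> exists K, 0 <= K /\ forall x t, 0 < t < T ->
  ham s b c x t (P + X * (x - x0)) X <= ham s b c x0 t P X + K * Rabs (x - x0).
Proof.
intro hl. exists (2 * La * L * Rabs X + 2 * L * Rabs P + 2 * La * Rabs X).
pose proof (Rabs_pos X) as hX. pose proof (Rabs_pos P) as hP.
split; [repeat apply Rplus_le_le_0_compat; repeat apply Rmult_le_pos; lra|].
intros x t ht. unfold ham. pose proof (Rabs_pos (x - x0)) as hx.
destruct (s_ok x x0 t ht) as [s1 s2]. destruct (s_ok x0 x0 t ht) as [s3 _].
destruct (b_ok x x0 t ht) as [b1 b2]. destruct (c_ok x x0 t ht) as [c1 c2].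
assert (h1 : (s x t ^ 2 - s x0 t ^ 2) * X <= (L * Rabs (x - x0) * (2 * La)) * Rabs X).
{ apply abs_prod_le; [|lra]. replace (s x t ^ 2 - s x0 t ^ 2) with ((s x t - s x0 t) * (s x t + s x0 t)) by ring.
  rewrite Rabs_mult. apply Rmult_le_compat; try apply Rabs_pos; [exact s2|].
  apply Rle_trans with (1 := Rabs_triang _ _). lra. }
assert (h2 : (b x t - b x0 t) * P <= (L * Rabs (x - x0)) * Rabs P) by (apply abs_prod_le; lra).
assert (h3 : b x t * (X * (x - x0)) <= La * (Rabs X * Rabs (x - x0))).
{ apply abs_prod_le; [lra|]. rewrite Rabs_mult. lra. }
assert (h4 : (c x t - c x0 t) * Rabs P <= (L * Rabs (x - x0)) * Rabs P).
{ apply abs_prod_le; [lra|rewrite Rabs_Rabsolu; lra]. }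
assert (h5 : c x t * (Rabs (P + X * (x - x0)) - Rabs P) <= La * (Rabs X * Rabs (x - x0))).
{ apply abs_prod_le; [lra|]. rewrite <- Rabs_mult. eapply Rle_trans; [apply Rabs_triang_inv2|].
  right. f_equal. ring. }
lra.
Qed.
End Ham.

(** * Comparison for coercive functions *)

Section Core.
Variables (T L La : R) (s b c u1 u2 : R -> R -> R) (B : R).
Hypothesis T_pos : 0 < T.
Hypothesis L_pos : 0 <= L.
Hypothesis La_pos : 0 <= La.
Hypothesis s_ok : coeffs_ok T L La s.
Hypothesis b_ok : coeffs_ok T L La b.
Hypothesis c_ok : coeffs_ok T L La c.
(** Negating a supersolution reverses the sign of the term in [|p|] and leaves the linear terms as
    they are. *)
Let c' (x t : R) : R := - c x t.
Hypothesis u1_cont : cont2 u1.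
Hypothesis u2_cont : cont2 u2.
Hypothesis u1_sub : subsol T (ham s b c) u1.
Hypothesis u2_sub : subsol T (ham s b c') u2.
Hypothesis u1_coercive : forall x t, u1 x t <= B - Rabs x.
Hypothesis u2_coercive : forall x t, u2 x t <= B - Rabs x.

Let c'_ok : coeffs_ok T L La c'.
Proof.
intros x y t ht. destruct (c_ok x y t ht) as [h1 h2]. unfold c'. rewrite Rabs_Ropp.
split; [exact h1|]. replace (- c x t - - c y t) with (- (c x t - c y t)) by ring. rewrite Rabs_Ropp. exact h2.
Qed.

Let Ph (k p t : R) : R -> R -> R := Phi (fun x => u1 x t) (fun x => u2 x t) k p.
Let Mx (k p t : R) : R -> R -> Prop := is_max (fun x => u1 x t) (fun x => u2 x t) k p.

Let lower_bound : exists A0, 0 <= A0 /\ forall t, 0 <= t <= T -> - A0 <= u1 0 t + u2 0 t.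
Proof.
destruct (max_rectangle (fun x t => - (u1 x t + u2 x t)) 0 0 0 T) as [x [t [_ [_ H]]]]; try lra.
{ intros x t. apply continuity_2d_pt_opp, continuity_2d_pt_plus; [apply u1_cont|apply u2_cont]. }
exists (Rmax 0 (- (u1 x t + u2 x t))). split; [apply Rmax_l|]. intros s' hs.
specialize (H 0 s' ltac:(lra) hs). pose proof (Rmax_r 0 (- (u1 x t + u2 x t))). lra.
Qed.

Section Bounded.
Variable A0 : R.
Hypothesis A0_pos : 0 <= A0.
Hypothesis A0_low : forall t, 0 <= t <= T -> - A0 <= u1 0 t + u2 0 t.
(** Radius of a box containing all maximizers with [|p| <= 1/2]: the tilt costs at most
    [(|x| + |y|) / 4], which coercivity outweighs. *)
Let r : R := 2 * (2 * B + A0).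

Let B_low : 0 <= 2 * B + A0.
Proof.
pose proof (A0_low 0 ltac:(lra)). pose proof (u1_coercive 0 0). pose proof (u2_coercive 0 0).
rewrite Rabs_R0 in *. lra.
Qed.

Let Ph_zero (k p t : R) : Ph k p t 0 0 = u1 0 t + u2 0 t.
Proof. unfold Ph, Phi. rewrite Rminus_diag. unfold Rdiv. ring. Qed.

Let tilt_le (p x y : R) : Rabs p <= / 2 -> Rabs (p * (x + y) / 2) <= (Rabs x + Rabs y) / 4.
Proof.
intro hp. unfold Rdiv. rewrite !Rabs_mult, (Rabs_pos_eq (/ 2)) by lra.
pose proof (Rabs_triang x y). pose proof (Rabs_pos p). pose proof (Rabs_pos (x + y)). nra.
Qed.

Let far (k p t x y : R) : 0 < k -> Rabs p <= / 2 -> 0 <= t <= T ->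
  Ph k p t 0 0 <= Ph k p t x y -> Rabs x <= r /\ Rabs y <= r.
Proof.
intros hk hp ht h. rewrite Ph_zero in h. pose proof (A0_low t ht).
unfold Ph, Phi in h. pose proof (u1_coercive x t). pose proof (u2_coercive y t).
pose proof (tilt_le p x y hp) as ht'. apply Rabs_le_between in ht'.
pose proof (pow2_ge_0 (x - y)). pose proof (Rabs_pos x). pose proof (Rabs_pos y).
unfold r. split; nra.
Qed.

Let Ph_cont (k p t : R) : cont2 (Ph k p t).
Proof. apply Phi_cont2; apply cont2_slice; assumption. Qed.

Let max_exists (k p t : R) : 0 < k -> Rabs p <= / 2 -> 0 <= t <= T ->
  exists x y, Mx k p t x y.
Proof.
intros hk hp ht. assert (hr : - r <= r) by (unfold r; lra).
destruct (max_rectangle (Ph k p t) (- r) r (- r) r (Ph_cont k p t) hr hr) as [x [y [_ [_ H]]]].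
exists x, y. intros x' y'.
change (Ph k p t x' y' <= Ph k p t x y).
assert (h0 : Ph k p t 0 0 <= Ph k p t x y) by (apply H; unfold r; lra).
destruct (Rle_lt_dec (Ph k p t 0 0) (Ph k p t x' y')) as [h|h]; [|lra].
destruct (far k p t x' y' hk hp ht h) as [hx hy].
apply H; apply Rabs_le_between; assumption.
Qed.

Let max_bound (k p t x y : R) : 0 < k -> Rabs p <= / 2 -> 0 <= t <= T -> Mx k p t x y ->
  Rabs x <= r /\ Rabs y <= r.
Proof. intros hk hp ht h. apply (far k p t x y hk hp ht). apply h. Qed.

(** Coercivity puts [u] below the paraboloid outside [R3], so [barrier] applies on [[- R3, R3]].
    What matters is that [C] is the same for all admissible [A], [p], [y] and times. *)
Let global_barrier (u : R -> R -> R) (c0 : R -> R -> R) (k R2 A' : R) : 0 < k -> 0 <= R2 -> 0 <= A' ->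
  cont2 u -> subsol T (ham s b c0) u -> coeffs_ok T L La c0 -> (forall x t, u x t <= B - Rabs x) ->
  exists C, 0 <= C /\ forall A p y t0 t1, - A' <= A -> Rabs p <= / 2 -> Rabs y <= R2 ->
    0 <= t0 -> t0 <= t1 -> t1 <= T ->
    (forall x, u x t0 <= quad A (p / 2) k y x) ->
    forall x, u x t1 <= quad A (p / 2) k y x + C * (t1 - t0).
Proof.
intros hk hR2 hA' hu hsub hc0 hco.
set (R3 := R2 + 2 * (Rabs B + A' + R2) + 1).
pose proof (Rabs_pos B) as hB0. pose proof (Rle_abs B) as hB1.
set (C := La ^ 2 * k + 2 * La * (1 + k * (R3 + R2))).
assert (hR3 : 0 < R3) by (unfold R3; lra).
exists C. split.
{ unfold C. pose proof (pow2_ge_0 La). assert (0 <= k * (R3 + R2)) by (apply Rmult_le_pos; lra).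
  apply Rplus_le_le_0_compat; [nra|]. repeat apply Rmult_le_pos; lra. }
intros A p y t0 t1 hA hp hy h0 h01 h1 hQ.
assert (hC : 0 <= C).
{ unfold C. pose proof (pow2_ge_0 La). assert (0 <= k * (R3 + R2)) by (apply Rmult_le_pos; lra).
  apply Rplus_le_le_0_compat; [nra|]. repeat apply Rmult_le_pos; lra. }
assert (hfar : forall x t, R3 <= Rabs x -> u x t <= quad A (p / 2) k y x).
{ intros x t hx. specialize (hco x t). unfold quad. pose proof (pow2_ge_0 (x - y)).
  assert (hpx : Rabs (p / 2 * (x - y)) <= (Rabs x + R2) / 4).
  { unfold Rdiv. rewrite !Rabs_mult, (Rabs_pos_eq (/ 2)) by lra.
    pose proof (Rabs_triang x (- y)). rewrite Rabs_Ropp in *. unfold Rminus.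
    pose proof (Rabs_pos p). pose proof (Rabs_pos (x + - y)). nra. }
  apply Rabs_le_between in hpx. unfold R3 in hx. nra. }
intro x. destruct (Rle_lt_dec R3 (Rabs x)) as [hx|hx].
{ specialize (hfar x t1 hx). assert (0 <= C * (t1 - t0)) by (apply Rmult_le_pos; lra). lra. }
apply (barrier T (ham s b c0) u A (p / 2) k y (- R3) R3 t0 t1 C); try assumption; try lra.
- intros z _. apply hQ.
- intros t ht. split; apply hfar; [rewrite Rabs_Ropp|]; rewrite Rabs_pos_eq; lra.
- intros z t hz ht. apply ham_le with T L; try assumption; [lra| |rewrite Rabs_pos_eq; lra].
  apply Rle_trans with (1 := Rabs_triang _ _). unfold Rdiv. rewrite !Rabs_mult, (Rabs_pos_eq (/ 2)), (Rabs_pos_eq k) by lra.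
  assert (Rabs (z - y) <= R3 + R2).
  { apply Rle_trans with (1 := Rabs_triang _ _). rewrite Rabs_Ropp.
    assert (Rabs z <= R3) by (apply Rabs_le; lra). lra. }
  pose proof (Rabs_pos p). nra.
- apply Rabs_def2 in hx. lra.
Qed.

(* The barriers are used twice: first in [x] with [y] frozen, then in [y] at the later time. *)
Let max_growth (k : R) : 0 < k -> exists C, 0 <= C /\ forall p t0 t1 x0 y0 x y,
  Rabs p <= / 2 -> 0 <= t0 -> t0 <= t1 -> t1 <= T -> Mx k p t0 x0 y0 -> Mx k p t1 x y ->
  Ph k p t1 x y <= Ph k p t0 x0 y0 + C * (t1 - t0).
Proof.
intro hk. pose proof B_low as hB. set (R2 := 2 * (2 * B + A0 + r)).
assert (hr : 0 <= r) by (unfold r; lra). assert (hR2 : 0 <= R2) by (unfold R2; lra).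
assert (hrR : r <= R2) by (unfold R2; lra).
set (A' := A0 + Rabs B + R2).
pose proof (Rabs_pos B) as hB0. pose proof (Rle_abs B) as hB1.
assert (hA' : 0 <= A') by (unfold A'; lra).
destruct (global_barrier u1 c k R2 A' hk hR2 hA' u1_cont u1_sub c_ok u1_coercive) as [C1 [hC1 H1]].
destruct (global_barrier u2 c' k R2 A' hk hR2 hA' u2_cont u2_sub c'_ok u2_coercive) as [C2 [hC2 H2]].
exists (C1 + C2). split; [lra|].
intros p t0 t1 x0 y0 x y hp h0 h01 h1 hm0 hm1.
set (M := Ph k p t0 x0 y0).
assert (hM : - A0 <= M).
{ apply Rle_trans with (u1 0 t0 + u2 0 t0); [apply A0_low; lra|]. rewrite <- (Ph_zero k p). apply hm0. }
assert (hpz : forall z, Rabs (p * z) <= / 2 * Rabs z).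
{ intro z. rewrite Rabs_mult. apply Rmult_le_compat_r; [apply Rabs_pos|exact hp]. }
assert (hC1t : 0 <= C1 * (t1 - t0)) by (apply Rmult_le_pos; lra).
assert (S1 : forall y', Rabs y' <= R2 -> forall x', u1 x' t1 + u2 y' t0 <=
  M + k / 2 * (x' - y') ^ 2 + p * (x' + y') / 2 + C1 * (t1 - t0)).
{ intros y' hy' x'. pose proof (u2_coercive y' t0). pose proof (hpz y') as hp'. apply Rabs_le_between in hp'.
  pose proof (Rabs_pos y').
  assert (h : u1 x' t1 <= quad (M - u2 y' t0 + p * y') (p / 2) k y' x' + C1 * (t1 - t0)).
  { apply (H1 _ p y' t0 t1); try assumption; [unfold A'; lra|].
    intro z. specialize (hm0 z y'). fold (Ph k p t0 z y') in hm0. unfold Mx, is_max in hm0.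
    change (Phi _ _ _ _ x0 y0) with M in hm0. unfold Ph, Phi in hm0. unfold quad. lra. }
  unfold quad in h. lra. }
destruct (max_bound k p t1 x y hk hp ltac:(lra) hm1) as [hx hy].
pose proof (u1_coercive x t1). pose proof (Rabs_pos x). pose proof (hpz x) as hp'. apply Rabs_le_between in hp'.
assert (h : u2 y t1 <= quad (M + C1 * (t1 - t0) - u1 x t1 + p * x) (p / 2) k x y + C2 * (t1 - t0)).
{ apply (H2 _ p x t0 t1); try assumption; [unfold A'; lra|lra|].
  intro z. unfold quad. destruct (Rle_lt_dec (Rabs z) R2) as [hz|hz].
  - specialize (S1 z hz x). replace ((z - x) ^ 2) with ((x - z) ^ 2) by ring. lra.
  - pose proof (u2_coercive z t0). pose proof (hpz (z - x)) as hq. apply Rabs_le_between in hq.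
    pose proof (Rabs_triang z (- x)) as htr. rewrite Rabs_Ropp in htr. unfold Rminus in hq at 1 2.
    pose proof (pow2_ge_0 (z - x)). assert (0 <= k / 2 * (z - x) ^ 2) by (apply Rmult_le_pos; lra).
    unfold R2 in hz. unfold Rminus in *. lra. }
unfold Ph at 1. unfold Phi. unfold quad in h. replace ((y - x) ^ 2) with ((x - y) ^ 2) in h by ring. lra.
Qed.

Let Ph_time (k e : R) : 0 < e -> exists d, 0 < d /\ forall p t t' x y,
  0 <= t <= T -> 0 <= t' <= T -> Rabs (t - t') < d -> Rabs x <= r -> Rabs y <= r ->
  Rabs (Ph k p t x y - Ph k p t' x y) < e.
Proof.
intro he. destruct (cont2_uniform u1 (- r) r 0 T (e / 2) u1_cont) as [d1 [hd1 H1]]; [lra|].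
destruct (cont2_uniform u2 (- r) r 0 T (e / 2) u2_cont) as [d2 [hd2 H2]]; [lra|].
exists (Rmin d1 d2). split; [apply Rmin_pos; lra|]. intros p t t' x y ht ht' htt hx hy.
apply Rabs_le_between in hx. apply Rabs_le_between in hy.
assert (z1 : Rabs (x - x) < d1) by (rewrite Rminus_diag, Rabs_R0; exact hd1).
assert (z2 : Rabs (y - y) < d2) by (rewrite Rminus_diag, Rabs_R0; exact hd2).
specialize (H1 x x t t' hx hx ht ht' z1 (Rlt_le_trans _ _ _ htt (Rmin_l _ _))).
specialize (H2 y y t t' hy hy ht ht' z2 (Rlt_le_trans _ _ _ htt (Rmin_r _ _))).
apply Rabs_def2 in H1. apply Rabs_def2 in H2. unfold Ph, Phi. apply Rabs_def1; lra.
Qed.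

(** The matrix inequality tested with [(s x0 t, s y0 t)] bounds the second order terms by
    [k (s x0 t - s y0 t)^2]. As both Hamiltonians are taken at the same [t], only regularity in
    space enters. The tilt contributes a term free of [k]. *)
Let ham_sum (k p x0 y0 X1 X2 t : R) : 0 < k -> 0 < t < T -> Rabs (x0 - y0) <= 2 * r ->
  (forall xi eta, X1 * xi ^ 2 + X2 * eta ^ 2 <= k * (xi - eta) ^ 2) ->
  ham s b c x0 t (k * (x0 - y0) + p / 2) X1 + ham s b c' y0 t (k * (y0 - x0) + p / 2) X2 <=
  (L ^ 2 + 2 * L) * (k * (x0 - y0) ^ 2) + (2 * La + L * r) * Rabs p.
Proof.
intros hk ht hd hX. unfold ham, c'.
destruct (s_ok x0 y0 t ht) as [_ s2]. destruct (b_ok x0 y0 t ht) as [b1 b2].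
destruct (b_ok y0 x0 t ht) as [b3 _]. destruct (c_ok x0 y0 t ht) as [c1 c2]. destruct (c_ok y0 x0 t ht) as [c3 _].
specialize (hX (s x0 t) (s y0 t)).
set (d := x0 - y0) in *. replace (y0 - x0) with (- d) by (unfold d; ring).
assert (e1 : k * (s x0 t - s y0 t) ^ 2 <= L ^ 2 * (k * d ^ 2)).
{ apply sqr_le_abs in s2. rewrite Rpow_mult_distr, pow2_abs in s2. nra. }
pose proof (Rabs_pos d) as hd0. pose proof (Rabs_pos p) as hp0.
assert (dd : Rabs d * Rabs d = d ^ 2) by (rewrite <- (pow2_abs d); ring).
assert (e2 : (b x0 t - b y0 t) * (k * d) <= (L * Rabs d) * (k * Rabs d)).
{ apply abs_prod_le; [exact b2|]. rewrite Rabs_mult, (Rabs_pos_eq k) by lra. lra. }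
assert (e3 : b x0 t * p <= La * Rabs p) by (apply abs_prod_le; lra).
assert (e3' : b y0 t * p <= La * Rabs p) by (apply abs_prod_le; lra).
assert (e4 : (c x0 t - c y0 t) * Rabs (k * d + p / 2) <= (L * Rabs d) * (k * Rabs d + Rabs p / 2)).
{ apply abs_prod_le; [exact c2|]. rewrite Rabs_Rabsolu. apply Rle_trans with (1 := Rabs_triang _ _).
  unfold Rdiv. rewrite !Rabs_mult, (Rabs_pos_eq k), (Rabs_pos_eq (/ 2)) by lra. lra. }
assert (e5 : c y0 t * (Rabs (k * d + p / 2) - Rabs (k * - d + p / 2)) <= La * Rabs p).
{ apply abs_prod_le; [exact c3|].
  replace (Rabs (k * - d + p / 2)) with (Rabs (k * d - p / 2)) by (rewrite <- Rabs_Ropp; f_equal; ring).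
  eapply Rle_trans; [apply Rabs_triang_inv2|]. right. f_equal. field. }
assert (e6 : L * Rabs d * (Rabs p / 2) <= L * r * Rabs p).
{ assert (L * Rabs d <= L * (2 * r)) by (apply Rmult_le_compat_l; lra). nra. }
replace ((L * Rabs d) * (k * Rabs d)) with (L * (k * d ^ 2)) in e2 by (rewrite <- dd; ring).
replace ((L * Rabs d) * (k * Rabs d + Rabs p / 2)) with (L * (k * d ^ 2) + L * Rabs d * (Rabs p / 2)) in e4 by (rewrite <- dd; ring).
lra.
Qed.

(** Differentiability in the tilt at [p0] gives both the paraboloids and uniqueness of the
    maximizer. Uniqueness keeps the maximizers at later times in the region where the paraboloids
    are valid, and [local_sum] bounds the growth there. *)
Let good_step (k p0 t0 d0 al be kap : R) (X Y : R -> R) : 0 < k -> Rabs p0 <= / 2 ->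
  0 <= t0 -> t0 < T -> 0 < d0 -> 0 <= al -> 0 <= be -> 0 < kap ->
  (forall r s, r <= s -> X s <= X r) -> (forall r s, r <= s -> Y s <= Y r) ->
  (forall r, Rabs r < d0 -> Mx k (p0 + r) t0 (X r) (Y r)) ->
  deriv0 X (- al) -> deriv0 Y (- be) ->
  (L ^ 2 + 2 * L) * (k * (X 0 - Y 0) ^ 2) + (2 * La + L * r) * Rabs p0 < kap ->
  exists tau, 0 < tau /\ forall t x y, t0 <= t <= t0 + tau -> t <= T -> Mx k p0 t x y ->
    Ph k p0 t x y <= Ph k p0 t0 (X 0) (Y 0) + kap * (t - t0).
Proof.
intros hk hp h0 hT hd hal hbe hkap mX mY hmax dX dY hrate.
assert (hmax0 : Mx k p0 t0 (X 0) (Y 0)).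
{ assert (h : Rabs 0 < d0) by (rewrite Rabs_R0; exact hd). specialize (hmax 0 h). rewrite Rplus_0_r in hmax. exact hmax. }
destruct (max_bound k p0 t0 _ _ hk hp ltac:(lra) hmax0) as [hx0 hy0].
destruct (good_expansion _ _ X Y k p0 d0 al be hk hd hal hbe mX mY hmax dX dY)
  as [X1 [X2 [m [l [hm [hl [E1 [E2 hXX]]]]]]]].
set (x0 := X 0) in *. set (y0 := Y 0) in *.
set (rate := (L ^ 2 + 2 * L) * (k * (x0 - y0) ^ 2) + (2 * La + L * r) * Rabs p0) in *.
(* By monotonicity any maximizer at [p0] lies between those at [p0 + d / 2] and [p0 - d / 2], and
   both of these converge to [(x0, y0)]. *)
assert (huniq : forall x y, Rabs x <= r -> Rabs y <= r -> Ph k p0 t0 x0 y0 <= Ph k p0 t0 x y -> x = x0 /\ y = y0).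
{ intros x y _ _ hxy.
  assert (hm' : Mx k p0 t0 x y).
  { intros x' y'. apply Rle_trans with (2 := hxy). apply hmax0. }
  assert (near : forall e, 0 < e -> exists d, 0 < d /\ forall r, Rabs r < d -> Rabs r < d0 /\ Rabs (X r - x0) < e /\ Rabs (Y r - y0) < e).
  { intros e he. destruct (dX 1 ltac:(lra)) as [d1 [hd1 D1]]. destruct (dY 1 ltac:(lra)) as [d2 [hd2 D2]].
    set (q := e / (al + be + 2)). assert (hq : 0 < q) by (apply Rdiv_lt_0_compat; lra).
    assert (hqe : q * (al + be + 2) = e) by (unfold q; field; lra).
    exists (Rmin (Rmin d0 q) (Rmin d1 d2)). split; [repeat apply Rmin_pos; lra|]. intros r' hr'.
    assert (a1 : Rabs r' < d0) by (eapply Rlt_le_trans; [exact hr'|eapply Rle_trans; [apply Rmin_l|apply Rmin_l]]).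
    assert (a2 : Rabs r' < q) by (eapply Rlt_le_trans; [exact hr'|eapply Rle_trans; [apply Rmin_l|apply Rmin_r]]).
    assert (a3 : Rabs r' < d1) by (eapply Rlt_le_trans; [exact hr'|eapply Rle_trans; [apply Rmin_r|apply Rmin_l]]).
    assert (a4 : Rabs r' < d2) by (eapply Rlt_le_trans; [exact hr'|eapply Rle_trans; [apply Rmin_r|apply Rmin_r]]).
    specialize (D1 r' a3). specialize (D2 r' a4). fold x0 in D1. fold y0 in D2. split; [exact a1|].
    pose proof (Rabs_pos r').
    assert (g : forall a, 0 <= a -> Rabs (- a * r') <= a * Rabs r').
    { intros a ha. rewrite Rabs_mult, Rabs_Ropp, (Rabs_pos_eq a) by exact ha. lra. }
    split.
    - replace (X r' - x0) with ((X r' - x0 - - al * r') + - al * r') by ring.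
      eapply Rle_lt_trans; [apply Rabs_triang|]. pose proof (g al hal). nra.
    - replace (Y r' - y0) with ((Y r' - y0 - - be * r') + - be * r') by ring.
      eapply Rle_lt_trans; [apply Rabs_triang|]. pose proof (g be hbe). nra. }
  assert (close : forall e, 0 < e -> Rabs (x - x0) <= e /\ Rabs (y - y0) <= e).
  { intros e he. destruct (near e he) as [d [hd' D]].
    assert (hplus : Rabs (d / 2) < d) by (rewrite Rabs_pos_eq; lra).
    assert (hminus : Rabs (- (d / 2)) < d) by (rewrite Rabs_Ropp; exact hplus).
    destruct (D _ hplus) as [p1 [p2 p3]]. destruct (D _ hminus) as [n1 [n2 n3]].
    destruct (is_max_mono _ _ k p0 (p0 + d / 2) x y _ _ hk ltac:(lra) hm' (hmax _ p1)) as [i1 i2].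
    destruct (is_max_mono _ _ k (p0 + - (d / 2)) p0 _ _ x y hk ltac:(lra) (hmax _ n1) hm') as [j1 j2].
    apply Rabs_def2 in p2. apply Rabs_def2 in p3. apply Rabs_def2 in n2. apply Rabs_def2 in n3.
    split; apply Rabs_le; lra. }
  split.
  - apply Rminus_diag_uniq. apply cond_eq. intros e he. rewrite Rminus_0_r.
    destruct (close (e / 2)) as [h _]; [lra|]. lra.
  - apply Rminus_diag_uniq. apply cond_eq. intros e he. rewrite Rminus_0_r.
    destruct (close (e / 2)) as [_ h]; [lra|]. lra. }
destruct (strict_max_gap (Ph k p0 t0) r x0 y0 l (Ph_cont k p0 t0) hl hx0 hy0 huniq) as [ga [hga Hga]].
destruct (Ph_time k (ga / 2)) as [dt [hdt Hdt]]; [lra|].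
destruct (ham_lipschitz T L La s b c L_pos La_pos s_ok b_ok c_ok x0 (k * (x0 - y0) + p0 / 2) X1 l) as [K1 [hK1 HK1]]; [lra|].
destruct (ham_lipschitz T L La s b c' L_pos La_pos s_ok b_ok c'_ok y0 (k * (y0 - x0) + p0 / 2) X2 l) as [K2 [hK2 HK2]]; [lra|].
set (P1 := k * (x0 - y0) + p0 / 2) in *. set (P2 := k * (y0 - x0) + p0 / 2) in *.
set (C := (La ^ 2 * Rabs X1 + 2 * La * Rabs P1) + (La ^ 2 * Rabs X2 + 2 * La * Rabs P2)).
assert (cc : forall Z P, 0 <= La ^ 2 * Rabs Z + 2 * La * Rabs P).
{ intros Z P. pose proof (Rabs_pos Z). pose proof (Rabs_pos P). pose proof (pow2_ge_0 La). nra. }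
pose proof (cc X1 P1) as cc1. pose proof (cc X2 P2) as cc2.
assert (hdist : Rabs (x0 - y0) <= 2 * r).
{ apply Rabs_le_between in hx0. apply Rabs_le_between in hy0. apply Rabs_le. lra. }
destruct (local_sum T (ham s b c) (ham s b c') u1 u2 (u1 x0 t0) P1 X1 x0 (u2 y0 t0) P2 X2 y0 l m (K1 + K2) C rate t0 (kap - rate))
  as [tau [htau Htau]]; try assumption; try reflexivity; try lra.
{ unfold C. lra. }
{ intros x t ht _. specialize (HK1 x t ht). pose proof (Rabs_pos (x - x0)). nra. }
{ intros x t ht _. specialize (HK2 x t ht). pose proof (Rabs_pos (x - y0)). nra. }
{ intros t ht. split; [|split].
  - apply Rle_trans with (La ^ 2 * Rabs X1 + 2 * La * Rabs P1); [|unfold C; lra].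
    apply ham_le with T L; try assumption; lra.
  - apply Rle_trans with (La ^ 2 * Rabs X2 + 2 * La * Rabs P2); [|unfold C; lra].
    apply ham_le with T L; try assumption; lra.
  - apply ham_sum; assumption. }
exists (Rmin tau (dt / 2)). split; [apply Rmin_pos; lra|]. intros t x y ht htT hxy.
assert (t1 : Rmin tau (dt / 2) <= tau) by apply Rmin_l. assert (t2 : Rmin tau (dt / 2) <= dt / 2) by apply Rmin_r.
destruct (max_bound k p0 t x y hk hp ltac:(lra) hxy) as [hx hy].
assert (htd : Rabs (t - t0) < dt) by (rewrite Rabs_pos_eq; lra).
pose proof (Hdt p0 t t0 x y ltac:(lra) ltac:(lra) htd hx hy) as g1.
pose proof (Hdt p0 t t0 x0 y0 ltac:(lra) ltac:(lra) htd hx0 hy0) as g2.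
pose proof (hxy x0 y0) as g3. fold (Ph k p0 t x0 y0) in g3.
change (Ph k p0 t x0 y0 <= Ph k p0 t x y) in g3.
apply Rabs_def2 in g1. apply Rabs_def2 in g2.
destruct (Hga x y hx hy ltac:(lra)) as [lx ly].
specialize (Htau t ltac:(lra) htT x y ltac:(lra) ltac:(lra)).
specialize (hXX (x - x0) (y - y0)).
unfold quad in Htau. unfold Ph, Phi.
(* The linear parts of the paraboloids cancel against those of the penalty and the tilt, and [hXX]
   absorbs the quadratic parts. *)
assert (id : k / 2 * (x - y) ^ 2 = k / 2 * (x0 - y0) ^ 2 + k * (x0 - y0) * ((x - x0) - (y - y0)) + k / 2 * ((x - x0) - (y - y0)) ^ 2) by field.
rewrite id. unfold P1, P2 in Htau. lra.
Qed.
(** Compare the maximizer with [(y, y)]: the penalty is at most the difference of two values of [u1]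
    plus the tilt. A crude bound first forces [|x - y| < d], and then uniform continuity makes the
    difference small. *)
Let penalization (eta : R) : 0 < eta -> exists k, 0 < k /\ forall p t x y,
  Rabs p <= / 2 -> 0 <= t <= T -> Mx k p t x y ->
  k * (x - y) ^ 2 <= eta + 2 * r * Rabs p /\ u1 x t - u1 y t <= eta.
Proof.
intro heta. pose proof B_low as hB. assert (hr : 0 <= r) by (unfold r; lra).
destruct (max_rectangle (fun x t => - u1 x t) (- r) r 0 T) as [xm [tm [_ [_ Hm]]]]; try lra.
{ intros x t. apply continuity_2d_pt_opp, u1_cont. }
set (D := Rabs B + Rabs (u1 xm tm) + r).
pose proof (Rabs_pos B) as hB0. pose proof (Rle_abs B) as hB1.
pose proof (Rabs_pos (u1 xm tm)) as hu0. pose proof (Rle_abs (- u1 xm tm)) as hu1. rewrite Rabs_Ropp in hu1.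
destruct (cont2_uniform u1 (- r) r 0 T (eta / 2) u1_cont) as [d [hd Hd]]; [lra|].
(* With this [k], [|x - y| >= d] would cost at least [D + 1], more than the crude bound [D]. *)
assert (hk : 0 < 2 * (D + 1) / d ^ 2).
{ apply Rdiv_lt_0_compat; [unfold D; lra|apply pow_lt; exact hd]. }
exists (2 * (D + 1) / d ^ 2). split; [exact hk|]. set (k := 2 * (D + 1) / d ^ 2) in *.
assert (kd : k * d ^ 2 = 2 * (D + 1)) by (unfold k; field; lra).
intros p t x y hp ht hm. destruct (max_bound k p t x y hk hp ht hm) as [hx hy].
pose proof (hm y y) as h. unfold Phi in h. rewrite Rminus_diag in h.
assert (h1 : k / 2 * (x - y) ^ 2 <= u1 x t - u1 y t - p * (x - y) / 2).
{ replace (k / 2 * 0 ^ 2) with 0 in h by ring. lra. }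
apply Rabs_le_between in hx. apply Rabs_le_between in hy.
assert (hpd : - (p * (x - y) / 2) <= Rabs p * r).
{ assert (- p * (x - y) <= Rabs p * (2 * r)).
  { apply abs_prod_le; [rewrite Rabs_Ropp; lra|apply Rabs_le; lra]. }
  lra. }
assert (hpr : Rabs p * r <= r) by (pose proof (Rabs_pos p); nra).
pose proof (u1_coercive x t) as hco. pose proof (Rabs_pos x).
specialize (Hm y t hy ht).
assert (hxy : Rabs (x - y) < d).
{ apply Rnot_le_lt. intro c0. assert (d ^ 2 <= (x - y) ^ 2).
  { rewrite <- (pow2_abs (x - y)). apply pow_incr. lra. }
  assert (k * d ^ 2 <= k * (x - y) ^ 2) by (apply Rmult_le_compat_l; lra).
  unfold D in kd. lra. }
assert (z : Rabs (t - t) < d) by (rewrite Rminus_diag, Rabs_R0; exact hd).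
specialize (Hd x y t t hx hy ht ht hxy z). apply Rabs_def2 in Hd.
split; lra.
Qed.

Lemma core_comparison_aux : (forall x, u1 x 0 + u2 x 0 <= 0) ->
  forall x t, 0 <= t <= T -> u1 x t + u2 x t <= 0.
Proof.
intros hinit x1 t1 ht1. apply Rnot_lt_le. intro he0. set (e0 := u1 x1 t1 + u2 x1 t1) in *.
assert (t1_pos : 0 < t1).
{ destruct (Req_dec t1 0) as [E|n]; [|lra]. specialize (hinit x1). unfold e0 in he0. rewrite E in he0. lra. }
pose proof B_low as hB. assert (hr : 0 <= r) by (unfold r; lra).
(* Budget for the positive value [e0]: the growth [2 kap t1], the initial error [eta] and the tilts
   at both ends take at most a quarter each. The bounds on [eta] and [de] also keep the rate in
   [good_step] below [kap]; neither depends on [k], which is chosen last. *)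
set (kap := e0 / (8 * t1)). assert (hkap : 0 < kap) by (apply Rdiv_lt_0_compat; lra).
assert (kt : kap * t1 = e0 / 8) by (unfold kap; field; lra).
set (L2 := L ^ 2 + 2 * L). assert (hL2 : 0 <= L2) by (unfold L2; pose proof (pow2_ge_0 L); lra).
set (eta := Rmin (e0 / 4) (kap / (4 * (L2 + 1)))).
assert (heta : 0 < eta) by (apply Rmin_pos; [lra|apply Rdiv_lt_0_compat; lra]).
assert (eta1 : eta <= e0 / 4) by apply Rmin_l.
assert (eta2 : eta * (4 * (L2 + 1)) <= kap).
{ apply Rle_trans with (kap / (4 * (L2 + 1)) * (4 * (L2 + 1))); [apply Rmult_le_compat_r; [lra|apply Rmin_r]|right; field; lra]. }
set (W := L2 * (2 * r) + 2 * La + L * r).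
assert (hW : 0 <= W).
{ unfold W. assert (0 <= L2 * (2 * r)) by (apply Rmult_le_pos; lra). assert (0 <= L * r) by (apply Rmult_le_pos; lra). lra. }
pose proof (Rabs_pos x1) as hx1.
set (de := Rmin (/ 4) (Rmin (e0 / (4 * (Rabs x1 + r + 1))) (kap / (4 * (W + 1))))).
assert (hde : 0 < de) by (repeat apply Rmin_pos; try lra; apply Rdiv_lt_0_compat; lra).
assert (de1 : de <= / 4) by apply Rmin_l.
assert (de2 : de * (4 * (Rabs x1 + r + 1)) <= e0).
{ apply Rle_trans with (e0 / (4 * (Rabs x1 + r + 1)) * (4 * (Rabs x1 + r + 1))); [apply Rmult_le_compat_r; [lra|]|right; field; lra].
  eapply Rle_trans; [apply Rmin_r|apply Rmin_l]. }
assert (de3 : de * (4 * (W + 1)) <= kap).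
{ apply Rle_trans with (kap / (4 * (W + 1)) * (4 * (W + 1))); [apply Rmult_le_compat_r; [lra|]|right; field; lra].
  eapply Rle_trans; [apply Rmin_r|apply Rmin_r]. }
destruct (penalization eta heta) as [k [hk Hpen]].
(* [averaging_stdlib] works with functions of all real [p] and [t]; clamping keeps the maximizers
   defined, and choosing them from the clamped pair makes them depend on it alone. *)
set (cl := clamp (- / 2) (/ 2)). set (ct := clamp 0 T).
assert (hcl : forall p, Rabs (cl p) <= / 2) by (intro p; apply Rabs_le, clamp_in; lra).
assert (hct : forall t, 0 <= ct t <= T) by (intro t; apply clamp_in; lra).
destruct (choice_fun (fun (q : R * R) (z : R * R) => Mx k (cl (fst q)) (ct (snd q)) (fst z) (snd z))) as [G HG].
{ intros [p t]. destruct (max_exists k (cl p) (ct t) hk (hcl p) (hct t)) as [x [y H]]. exists (x, y). exact H. }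
set (X := fun p t => fst (G (cl p, ct t))). set (Y := fun p t => snd (G (cl p, ct t))).
assert (clcl : forall p, cl (cl p) = cl p) by (intro p; apply clamp_id, clamp_in; lra).
assert (ctct : forall t, ct (ct t) = ct t) by (intro t; apply clamp_id, clamp_in; lra).
assert (HXY : forall p t, Mx k (cl p) (ct t) (X p t) (Y p t)).
{ intros p t. specialize (HG (cl p, ct t)). simpl in HG. rewrite clcl, ctct in HG. exact HG. }
assert (hbox : forall p t, Rabs (X p t) <= r /\ Rabs (Y p t) <= r).
{ intros p t. apply (max_bound k (cl p) (ct t)); auto. }
set (M := fun p t => Ph k (cl p) (ct t) (X p t) (Y p t)).
assert (cl_id : forall p, Rabs p <= / 2 -> cl p = p) by (intros p h; apply clamp_id, Rabs_le_between; exact h).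
assert (ct_id : forall t, 0 <= t <= T -> ct t = t) by (intros t h; apply clamp_id; exact h).
assert (mono : forall t p p', p <= p' -> X p' t <= X p t /\ Y p' t <= Y p t).
{ intros t p p' h. pose proof (clamp_mono (- / 2) (/ 2) p p' h) as hc. fold cl in hc.
  destruct (Req_dec (cl p) (cl p')) as [E|n]; [unfold X, Y; rewrite E; lra|].
  apply (is_max_mono _ _ k (cl p) (cl p') _ _ _ _ hk ltac:(lra) (HXY p t) (HXY p' t)). }
destruct (max_growth k hk) as [C [hC HC]].
(* The Lipschitz constant in [p] is [r], since the derivative of the tilt is [(x + y) / 2] on the
   box. *)
destruct (@averaging_stdlib M de t1 C r kap) as [p [hp Hp]]; try assumption.
- assert (half : forall p p' t, M p' t - M p t <= r * Rabs (p - p')).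
  { intros p p' t. pose proof (HXY p t (X p' t) (Y p' t)) as h.
    destruct (hbox p' t) as [hx hy]. unfold M, Ph in *. unfold Phi in *.
    assert (hs : (cl p - cl p') * ((X p' t + Y p' t) / 2) <= Rabs (p - p') * r).
    { apply abs_prod_le.
      - destruct (Rle_lt_dec p p') as [c0|c0].
        + pose proof (clamp_mono (- / 2) (/ 2) p p' c0). fold cl in H. rewrite !Rabs_left1; lra.
        + pose proof (clamp_mono (- / 2) (/ 2) p' p ltac:(lra)). fold cl in H. rewrite !Rabs_pos_eq; lra.
      - apply Rabs_le_between in hx. apply Rabs_le_between in hy. apply Rabs_le. lra. }
    lra. }
  intros p p' t. pose proof (half p p' t) as h1. pose proof (half p' p t) as h2.
  rewrite (Rabs_minus_sym p' p) in h2. apply Rabs_le. lra.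
- intros e he. destruct (Ph_time k e he) as [d [hd Hd]]. exists d. split; [exact hd|].
  intros p t s' ht hs hts. unfold M. rewrite (ct_id t), (ct_id s') by lra.
  pose proof (HXY p t) as m1. pose proof (HXY p s') as m2. rewrite (ct_id t) in m1 by lra. rewrite (ct_id s') in m2 by lra.
  destruct (hbox p t) as [b1 b2]. destruct (hbox p s') as [b3 b4].
  pose proof (Hd (cl p) t s' _ _ ltac:(lra) ltac:(lra) hts b1 b2) as g1.
  pose proof (Hd (cl p) t s' _ _ ltac:(lra) ltac:(lra) hts b3 b4) as g2.
  pose proof (m1 (X p s') (Y p s')) as g3. change (Ph k (cl p) t (X p s') (Y p s') <= Ph k (cl p) t (X p t) (Y p t)) in g3.
  pose proof (m2 (X p t) (Y p t)) as g4. change (Ph k (cl p) s' (X p t) (Y p t) <= Ph k (cl p) s' (X p s') (Y p s')) in g4.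
  apply Rabs_def2 in g1. apply Rabs_def2 in g2. apply Rabs_le. lra.
- intros p t s' hp ht hts hs.
  assert (hpp : Rabs p <= / 2) by (rewrite Rabs_pos_eq; lra).
  unfold M. pose proof (HXY p t) as m1. pose proof (HXY p s') as m2. rewrite (cl_id p hpp) in *.
  rewrite (ct_id t) in * by lra. rewrite (ct_id s') in * by lra.
  pose proof (HC p t s' _ _ _ _ hpp ht hts ltac:(lra) m1 m2). lra.
- intros t ht.
  (* Outside this null set both maximizers at time [t] are differentiable in [p], and [good_step]
     applies. *)
  apply null_sub with (F := fun p => ~ (exists D, straddle_deriv (fun p => - X p t) D p) \/ ~ (exists D, straddle_deriv (fun p => - Y p t) D p)).
  2:{ apply null_or; [apply (@monotone_diff (fun p => - X p t))|apply (@monotone_diff (fun p => - Y p t))]; intros p p' h; destruct (mono t p p' h); lra. }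
  intros p [hp hn]. apply NNPP. intro hnn. apply not_or_and in hnn. destruct hnn as [n1 n2].
  apply NNPP in n1. apply NNPP in n2. destruct n1 as [al hal]. destruct n2 as [be hbe]. apply hn. clear hn.
  assert (hpp : Rabs p <= / 2) by (rewrite Rabs_pos_eq; lra).
  destruct (straddle_deriv_mono _ al p (fun a b' h => Ropp_le_contravar _ _ (proj1 (mono t a b' h))) hal) as [al0 dX].
  destruct (straddle_deriv_mono _ be p (fun a b' h => Ropp_le_contravar _ _ (proj2 (mono t a b' h))) hbe) as [be0 dY].
  assert (hmt : forall r', Rabs r' < / 4 -> Mx k (p + r') t (X (p + r') t) (Y (p + r') t)).
  { intros r' hr'. pose proof (HXY (p + r') t) as h. rewrite (ct_id t) in h by lra.
    rewrite cl_id in h; [exact h|]. apply Rabs_def2 in hr'. apply Rabs_le. lra. }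
  destruct (good_step k p t (/ 4) al be kap (fun r' => X (p + r') t) (fun r' => Y (p + r') t)) as [tau [htau Htau]]; try assumption; try lra.
  + intros a b' h. apply (mono t). lra.
  + intros a b' h. apply (mono t). lra.
  + intros e he. destruct (dX e he) as [d [hd H]]. exists d. split; [exact hd|].
    intros r' hr'. specialize (H (p + r')). replace (p + r' - p) with r' in H by ring. specialize (H hr').
    rewrite Rplus_0_r. replace (X (p + r') t - X p t - - al * r') with (- (- X (p + r') t - - X p t - al * r')) by ring.
    rewrite Rabs_Ropp. exact H.
  + intros e he. destruct (dY e he) as [d [hd H]]. exists d. split; [exact hd|].
    intros r' hr'. specialize (H (p + r')). replace (p + r' - p) with r' in H by ring. specialize (H hr').
    rewrite Rplus_0_r. replace (Y (p + r') t - Y p t - - be * r') with (- (- Y (p + r') t - - Y p t - be * r')) by ring.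
    rewrite Rabs_Ropp. exact H.
  + assert (h0 : Rabs 0 < / 4) by (rewrite Rabs_R0; lra).
    pose proof (hmt 0 h0) as hm0. rewrite Rplus_0_r in *.
    destruct (Hpen p t _ _ hpp ltac:(lra) hm0) as [hq _]. fold L2.
    assert (hpd : Rabs p <= de) by (rewrite Rabs_pos_eq; lra). pose proof (Rabs_pos p) as hp0.
    assert (q1 : L2 * (k * (X p t - Y p t) ^ 2) <= L2 * (eta + 2 * r * Rabs p)) by (apply Rmult_le_compat_l; assumption).
    assert (q2 : W * Rabs p <= W * de) by (apply Rmult_le_compat_l; assumption).
    unfold W in q2 at 1. lra.
  + exists tau. split; [exact htau|]. intros s' hs hsT.
    pose proof (HXY p s') as m2. rewrite (cl_id p hpp), (ct_id s') in m2 by lra.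
    unfold M. rewrite (cl_id p hpp), (ct_id t), (ct_id s') by lra.
    specialize (Htau s' _ _ hs ltac:(lra) m2). rewrite Rplus_0_r in Htau. exact Htau.
- assert (hpp : Rabs p <= / 2) by (rewrite Rabs_pos_eq; lra).
  assert (a1 : e0 - p * x1 <= M p t1).
  { pose proof (HXY p t1 x1 x1) as h. unfold M. rewrite (cl_id p hpp), (ct_id t1) in * by lra.
    change (Ph k p t1 x1 x1 <= Ph k p t1 (X p t1) (Y p t1)) in h. eapply Rle_trans; [|exact h].
    unfold Ph, Phi, e0. rewrite Rminus_diag. right. field. }
  assert (a2 : M p 0 <= eta + p * r).
  { pose proof (HXY p 0) as h. destruct (hbox p 0) as [b1 b2].
    unfold M. rewrite (cl_id p hpp), (ct_id 0) in * by lra.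
    destruct (Hpen p 0 _ _ hpp ltac:(lra) h) as [_ h2]. pose proof (hinit (Y p 0)) as h3.
    unfold Ph, Phi. pose proof (pow2_ge_0 (X p 0 - Y p 0)).
    assert (0 <= k / 2 * (X p 0 - Y p 0) ^ 2) by (apply Rmult_le_pos; lra).
    apply Rabs_le_between in b1. apply Rabs_le_between in b2.
    assert (- (p * (X p 0 + Y p 0) / 2) <= p * r) by nra. lra. }
  assert (a3 : p * x1 <= de * Rabs x1).
  { apply abs_prod_le; [rewrite Rabs_pos_eq; lra|lra]. }
  assert (a4 : p * r <= de * r) by (apply Rmult_le_compat_r; lra).
  assert (a5 : de * Rabs x1 + de * r <= e0 / 4) by lra.
  lra.
Qed.
End Bounded.

Theorem core_comparison : (forall x, u1 x 0 + u2 x 0 <= 0) ->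
  forall x t, 0 <= t <= T -> u1 x t + u2 x t <= 0.
Proof. destruct lower_bound as [A0 [h1 h2]]. exact (core_comparison_aux A0 h1 h2). Qed.
End Core.

(** * Test functions in the original coordinates *)

(** The derivative of [f] minus the quadratic has the sign opposite to [y - x0] near [x0], because
    of the extra [k]; the mean value theorem concludes. *)
Lemma second_order_majorant (f f1 : R -> R) (x0 f2 d k : R) : 0 < d -> 0 < k ->
  (forall y, Rabs (y - x0) < d -> is_derive f y (f1 y)) -> is_derive f1 x0 f2 ->
  exists e, 0 < e /\ forall y, Rabs (y - x0) < e -> f y <= quad (f x0) (f1 x0) (f2 + k) x0 y.
Proof.
intros hd hk hf hf1. apply is_derive_Reals in hf1. destruct (hf1 k hk) as [[e he] He]. simpl in He.
exists (Rmin d e). split; [apply Rmin_pos; assumption|]. intros y hy.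
assert (y1 : Rabs (y - x0) < d) by (eapply Rlt_le_trans; [exact hy|apply Rmin_l]).
assert (y2 : Rabs (y - x0) < e) by (eapply Rlt_le_trans; [exact hy|apply Rmin_r]).
set (g := fun y => f y - quad (f x0) (f1 x0) (f2 + k) x0 y).
set (dg := fun y => f1 y - (f1 x0 + (f2 + k) * (y - x0))).
destruct (MVT_gen g x0 y dg) as [z [hz Hz]].
- intros z hz. assert (hz' : Rabs (z - x0) < d).
  { eapply Rle_lt_trans; [|exact y1].
    unfold Rmin, Rmax in hz; destruct (Rle_dec x0 y);
    [rewrite !Rabs_pos_eq|rewrite !Rabs_left1]; lra. }
  unfold g, dg. apply (is_derive_minus (K := R_AbsRing) (V := R_NormedModule) f (quad (f x0) (f1 x0) (f2 + k) x0) z); [apply hf; exact hz'|].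
  unfold quad. auto_derive; [exact I|]. simpl. field.
- intros z hz. assert (hz' : Rabs (z - x0) < d).
  { eapply Rle_lt_trans; [|exact y1].
    unfold Rmin, Rmax in hz; destruct (Rle_dec x0 y);
    [rewrite !Rabs_pos_eq|rewrite !Rabs_left1]; lra. }
  apply continuity_pt_minus; [|apply quad_continuous].
  apply derivable_continuous_pt. exists (f1 z). apply is_derive_Reals, hf, hz'.
- assert (hzy : Rabs (z - x0) <= Rabs (y - x0) /\ 0 <= (z - x0) * (y - x0)).
  { unfold Rmin, Rmax in hz; destruct (Rle_dec x0 y).
    - split; [rewrite !Rabs_pos_eq; lra|apply Rmult_le_pos; lra].
    - split; [rewrite !Rabs_left1; lra|]. replace ((z - x0) * (y - x0)) with ((x0 - z) * (x0 - y)) by ring. apply Rmult_le_pos; lra. }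
  destruct hzy as [z1 z2].
  assert (hg0 : g x0 = 0) by (unfold g, quad; ring).
  enough (g y <= 0) by (unfold g in H; lra).
  rewrite hg0 in Hz. enough (dg z * (y - x0) <= 0) by lra.
  destruct (Req_dec z x0) as [->|n].
  { unfold dg. replace (f1 x0 - (f1 x0 + (f2 + k) * (x0 - x0))) with 0 by ring. lra. }
  specialize (He (z - x0) ltac:(lra) ltac:(lra)). replace (x0 + (z - x0)) with z in He by ring.
  assert (hq : Rabs (f1 z - f1 x0 - f2 * (z - x0)) <= k * Rabs (z - x0)).
  { replace (f1 z - f1 x0 - f2 * (z - x0)) with (((f1 z - f1 x0) / (z - x0) - f2) * (z - x0)) by (field; lra).
    rewrite Rabs_mult. apply Rmult_le_compat_r; [apply Rabs_pos|lra]. }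
  unfold dg. destruct (Rle_lt_dec x0 y) as [c|c].
  + assert (0 <= z - x0) by (unfold Rmin, Rmax in hz; destruct (Rle_dec x0 y); lra).
    rewrite (Rabs_pos_eq (z - x0)) in hq by lra. apply Rabs_le_between in hq. nra.
  + assert (z - x0 <= 0) by (unfold Rmin, Rmax in hz; destruct (Rle_dec x0 y); lra).
    rewrite (Rabs_left1 (z - x0)) in hq by lra. apply Rabs_le_between in hq. nra.
Qed.

(** * Quadratic test functions with coefficients depending on time *)

Section QuadraticTest.
Variables (c0 c1 c2 d0 d1 d2 : R -> R) (S0 : R).
Hypothesis h0 : C1_pair c0 d0.
Hypothesis h1 : C1_pair c1 d1.
Hypothesis h2 : C1_pair c2 d2.

(** [C12] asks for smoothness on the whole plane, whereas [ln S] is singular at 0. Instead of being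
    composed with [ln], test functions are majorized near [S0] by quadratics in [S]. *)
Definition quad_test (S t : R) : R := quad (c0 t) (c1 t) (c2 t) S0 S.

Lemma quad_test_t (S t : R) :
  is_derive (fun s => quad_test S s) t (quad (d0 t) (d1 t) (d2 t) S0 S).
Proof.
unfold quad_test, quad.
assert (e : forall c d x, is_derive c t d -> is_derive (fun s => c s * x) t (d * x)).
{ intros c d x h. apply is_derive_Reals. apply is_derive_Reals in h. apply derivable_pt_lim_scal_right. exact h. }
apply (is_derive_plus (K := R_AbsRing) (V := R_NormedModule) (fun s => c0 s + c1 s * (S - S0)) (fun s => c2 s / 2 * (S - S0) ^ 2)).
- apply (is_derive_plus (K := R_AbsRing) (V := R_NormedModule) c0 (fun s => c1 s * (S - S0))); [apply h0|apply e, h1].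
- apply e, e, h2.
Qed.

Lemma quad_test_S (S t : R) : is_derive (fun s => quad_test s t) S (c1 t + c2 t * (S - S0)).
Proof. unfold quad_test, quad. auto_derive; [exact I|]. simpl. field. Qed.

Lemma quad_test_SS (S t : R) : is_derive (fun s => Derive (fun s' => quad_test s' t) s) S (c2 t).
Proof.
apply is_derive_ext with (f := fun s => c1 t + c2 t * (s - S0)).
- intro s. symmetry. apply is_derive_unique, quad_test_S.
- auto_derive; [exact I|ring].
Qed.

Lemma continuous_snd_comp (f : R -> R) (p : R * R) :
  (forall x, continuous f x) -> continuous (fun q : R * R => f (snd q)) p.
Proof. intro h. apply (continuous_comp snd f); [apply continuous_snd|apply h]. Qed.

Lemma quad_continuous2 (f0 f1 f2 : R -> R) (p : R * R) : (forall x, continuous f0 x) ->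
  (forall x, continuous f1 x) -> (forall x, continuous f2 x) ->
  continuous (fun q : R * R => quad (f0 (snd q)) (f1 (snd q)) (f2 (snd q)) S0 (fst q)) p.
Proof.
intros g0 g1 g2. unfold quad.
assert (hS : continuous (fun q : R * R => fst q - S0) p).
{ apply (continuous_minus (V := R_NormedModule) (fun q : R * R => fst q) (fun _ => S0)); [apply continuous_fst|apply continuous_const]. }
apply (continuous_plus (V := R_NormedModule) (fun q : R * R => f0 (snd q) + f1 (snd q) * (fst q - S0)) (fun q => f2 (snd q) / 2 * (fst q - S0) ^ 2)).
- apply (continuous_plus (V := R_NormedModule) (fun q : R * R => f0 (snd q)) (fun q => f1 (snd q) * (fst q - S0))); [apply continuous_snd_comp, g0|].
  apply (continuous_mult (K := R_AbsRing) (fun q : R * R => f1 (snd q))); [apply continuous_snd_comp, g1|exact hS].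
- apply (continuous_mult (K := R_AbsRing) (fun q : R * R => f2 (snd q) / 2)).
  + apply (continuous_mult (K := R_AbsRing) (fun q : R * R => f2 (snd q)) (fun _ => / 2)); [apply continuous_snd_comp, g2|apply continuous_const].
  + apply (continuous_ext (fun q : R * R => (fst q - S0) * (fst q - S0))); [intro q; change ((fst q - S0) * (fst q - S0) = (fst q - S0) ^ 2); ring|].
    apply (continuous_mult (K := R_AbsRing)); exact hS.
Qed.

Lemma C1_pair_cont (psi psi1 : R -> R) : C1_pair psi psi1 -> forall x, continuous psi x.
Proof. intros h x. apply (ex_derive_continuous (K := R_AbsRing) (V := R_NormedModule)). exists (psi1 x). apply h. Qed.

Lemma quad_test_C12 : C12 quad_test.
Proof.
pose proof (C1_pair_cont _ _ h0) as g0. pose proof (C1_pair_cont _ _ h1) as g1. pose proof (C1_pair_cont _ _ h2) as g2.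
intros S t. split; [eexists; apply quad_test_t|]. split; [eexists; apply quad_test_S|].
split; [eexists; apply quad_test_SS|]. split; [|split; [|split]].
- apply (quad_continuous2 c0 c1 c2); assumption.
- eapply continuous_ext; [intro p; symmetry; apply is_derive_unique, quad_test_t|].
  apply (quad_continuous2 d0 d1 d2); [apply h0|apply h1|apply h2].
- eapply continuous_ext; [intro p; symmetry; apply is_derive_unique, quad_test_S|].
  eapply continuous_ext; [|apply (quad_continuous2 c1 c2 (fun _ => 0)); try assumption; intro; apply continuous_const].
  intro p. unfold quad. simpl. field.
- eapply continuous_ext; [intro p; symmetry; apply is_derive_unique, quad_test_SS|].
  apply continuous_snd_comp, g2.
Qed.

Lemma quad_test_Lop r rho alpha mu sigma a b t v : Lop r rho alpha mu sigma a b quad_test S0 t v =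
  d0 t + mu_tilde r rho mu sigma a b S0 t * S0 * c1 t + / 2 * sigma S0 t ^ 2 * S0 ^ 2 * c2 t - r * v
    + alpha * sqrt (1 - rho ^ 2) * sigma S0 t * S0 * Rabs (c1 t).
Proof.
assert (e1 : Derive (fun s => quad_test S0 s) t = quad (d0 t) (d1 t) (d2 t) S0 S0) by apply is_derive_unique, quad_test_t.
assert (e2 : Derive (fun s => quad_test s t) S0 = c1 t + c2 t * (S0 - S0)) by apply is_derive_unique, quad_test_S.
assert (e3 : Derive (fun s => Derive (fun s' => quad_test s' t) s) S0 = c2 t) by apply is_derive_unique, quad_test_SS.
unfold Lop. cbv zeta. rewrite e1, e2, e3.
unfold quad. replace (c1 t + c2 t * (S0 - S0)) with (c1 t) by ring. replace (d0 t + d1 t * (S0 - S0) + d2 t / 2 * (S0 - S0) ^ 2) with (d0 t) by ring.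
reflexivity.
Qed.
End QuadraticTest.

(* Time is clamped so that [lift] is continuous on the whole plane. *)
Definition lift (T r be K : R) (P : R -> R -> R) (x t : R) : R :=
  exp (r * clamp 0 T t) * P (exp x) (T - clamp 0 T t) - be * exp (K * clamp 0 T t) * cosh x.

Lemma clamp_close (T t s : R) : Rabs (clamp 0 T t - clamp 0 T s) <= Rabs (t - s).
Proof.
destruct (Rle_lt_dec t s) as [h|h].
- pose proof (clamp_mono 0 T t s h). rewrite !Rabs_left1; lra.
- pose proof (clamp_mono 0 T s t ltac:(lra)). rewrite !Rabs_pos_eq; lra.
Qed.

Lemma clamp_continuity (T t : R) : continuity_pt (clamp 0 T) t.
Proof.
intros e he. exists e. split; [exact he|]. intros s [_ hs]. simpl in *. unfold Rdist in *.
eapply Rle_lt_trans; [apply clamp_close|exact hs].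
Qed.

Lemma cont2_of_x (f : R -> R) : (forall x, continuity_pt f x) -> cont2 (fun x _ => f x).
Proof. intros h x t. apply (continuity_1d_2d_pt_comp f (fun x _ => x)); [apply h|apply continuity_2d_pt_id1]. Qed.

Lemma cont2_of_t (f : R -> R) : (forall x, continuity_pt f x) -> cont2 (fun _ t => f t).
Proof. intros h x t. apply (continuity_1d_2d_pt_comp f (fun _ t => t)); [apply h|apply continuity_2d_pt_id2]. Qed.

Lemma derive_continuity_pt (f : R -> R) x : ex_derive f x -> continuity_pt f x.
Proof. intros [l h]. apply derivable_continuous_pt. exists l. apply is_derive_Reals, h. Qed.

Lemma cont2_exp_clamp (T r : R) : cont2 (fun _ t => exp (r * clamp 0 T t)).
Proof.
apply cont2_of_t. intro t.
apply (continuity_pt_comp (clamp 0 T) (fun s => exp (r * s))); [apply clamp_continuity|].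
apply derive_continuity_pt. auto_derive. exact I.
Qed.

Lemma cosh_derive x : ex_derive cosh x.
Proof. unfold cosh. auto_derive. exact I. Qed.

Lemma lift_cont2 (T r be K : R) P : 0 < T -> cont_on_dom T P -> cont2 (lift T r be K P).
Proof.
intros hT hP. unfold lift.
assert (c1 : cont2 (fun x t => P (exp x) (T - clamp 0 T t))).
{ intros x t [e he]. simpl.
  destruct (hP (exp x) (T - clamp 0 T t) (exp_pos x)) with (eps := e) as [d [hd Hd]]; [|exact he|].
  { pose proof (clamp_in 0 T t). lra. }
  destruct (continuity_pt_small exp x d) as [d' [hd' Hd']]; [apply derivable_continuous_pt, derivable_pt_exp|exact hd|].
  assert (hm : 0 < Rmin d d') by (apply Rmin_pos; assumption).
  exists (mkposreal _ hm). simpl. intros y s hy hs.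
  apply Hd; [apply exp_pos|pose proof (clamp_in 0 T s); lra| |].
  - apply Hd'. eapply Rlt_le_trans; [exact hy|apply Rmin_r].
  - replace (T - clamp 0 T s - (T - clamp 0 T t)) with (clamp 0 T t - clamp 0 T s) by ring.
    eapply Rle_lt_trans; [apply clamp_close|]. rewrite Rabs_minus_sym. eapply Rlt_le_trans; [exact hs|apply Rmin_l]. }
intros x t. apply continuity_2d_pt_minus.
- apply continuity_2d_pt_mult; [apply cont2_exp_clamp|apply c1].
- apply continuity_2d_pt_mult; [apply continuity_2d_pt_mult; [apply continuity_2d_pt_const|apply cont2_exp_clamp]|].
  apply (cont2_of_x cosh). intro. apply derive_continuity_pt, cosh_derive.
Qed.

(** * Subsolutions under the change to logarithmic coordinates *)

Section LiftSubsol.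
Variables (T r rho alpha : R) (mu sigma : R -> R -> R) (a b : R -> R) (L La K be : R) (P : R -> R -> R).
(** Dividing by [sqrt 2] makes the square equal to the diffusion coefficient [sigma^2 / 2]; the
    drift [log_b] carries the usual correction from [x = ln S]. *)
Definition log_s (x t : R) : R := sigma (exp x) (T - t) / sqrt 2.
Definition log_b (x t : R) : R :=
  mu_tilde r rho mu sigma a b (exp x) (T - t) - sigma (exp x) (T - t) ^ 2 / 2.
Definition log_c (x t : R) : R := alpha * sqrt (1 - rho ^ 2) * sigma (exp x) (T - t).
Hypothesis s_ok : coeffs_ok T L La log_s.
Hypothesis b_ok : coeffs_ok T L La log_b.
Hypothesis c_ok : coeffs_ok T L La log_c.
Hypothesis be_pos : 0 <= be.
Hypothesis K_large : La ^ 2 + 2 * La <= K.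

(** These invert [lift] in the original time: [P] is [discount] times the lift plus [weight] times
    [cosh (ln S)]. *)
Let discount (t : R) : R := exp (- r * (T - t)).
Let weight (t : R) : R := be * exp ((K - r) * (T - t)).

Let discount_pos t : 0 < discount t. Proof. apply exp_pos. Qed.
Let weight_pos t : 0 <= weight t.
Proof. apply Rmult_le_pos; [exact be_pos|apply Rlt_le, exp_pos]. Qed.
Let discount_id t : exp (r * (T - t)) * discount t = 1.
Proof. unfold discount. rewrite <- exp_plus. replace (r * (T - t) + - r * (T - t)) with 0 by ring. apply exp_0. Qed.
Let weight_id t : weight t = be * exp (K * (T - t)) * discount t.
Proof. unfold weight, discount. rewrite Rmult_assoc, <- exp_plus. do 2 f_equal. ring. Qed.

Let combination_C1 (A C : R) : C1_pair (fun t => discount t * A + weight t * C)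
  (fun t => r * discount t * A - (K - r) * weight t * C).
Proof.
split; intro t.
- unfold discount, weight. auto_derive; [exact I|]. unfold Rminus. ring.
- apply (ex_derive_continuous (K := R_AbsRing) (V := R_NormedModule)). unfold discount, weight. auto_derive. exact I.
Qed.

Let product_C1 (psi psi1 : R -> R) : C1_pair psi psi1 ->
  C1_pair (fun t => discount t * psi (T - t)) (fun t => r * discount t * psi (T - t) - discount t * psi1 (T - t)).
Proof.
intro h. pose proof (C1_pair_cont _ _ h) as hc.
assert (cd : forall t, continuous discount t).
{ intro t. apply (ex_derive_continuous (K := R_AbsRing) (V := R_NormedModule)). unfold discount. auto_derive. exact I. }
assert (ct : forall (f : R -> R) (t : R), (forall x, continuous f x) -> continuous (fun t => f (T - t)) t).
{ intros f t hf. apply (continuous_comp (fun t => T - t) f); [|apply hf].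
  apply (ex_derive_continuous (K := R_AbsRing) (V := R_NormedModule)). auto_derive. exact I. }
split; intro t.
- unfold discount. auto_derive; [exists (psi1 (T - t)); apply h|].
  replace (Derive (fun x => psi x) (T + - t)) with (psi1 (T - t)) by (symmetry; apply is_derive_unique, h).
  unfold Rminus. ring.
- apply (continuous_minus (V := R_NormedModule) (fun t => r * discount t * psi (T - t))).
  + apply (continuous_mult (K := R_AbsRing) (fun t => r * discount t)); [|apply ct, hc].
    apply (continuous_mult (K := R_AbsRing) (fun _ => r)); [apply continuous_const|apply cd].
  + apply (continuous_mult (K := R_AbsRing) discount); [apply cd|apply ct, h].
Qed.

Let C1_pair_plus (f f1 g g1 : R -> R) : C1_pair f f1 -> C1_pair g g1 ->
  C1_pair (fun t => f t + g t) (fun t => f1 t + g1 t).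
Proof.
intros hf hg. split; intro t.
- apply (is_derive_plus (K := R_AbsRing) (V := R_NormedModule) f g); [apply hf|apply hg].
- apply (continuous_plus (V := R_NormedModule) f1 g1); [apply hf|apply hg].
Qed.

Let cosh_ln (S : R) : 0 < S -> cosh (ln S) = (S + / S) / 2.
Proof. intro h. unfold cosh. rewrite exp_Ropp, exp_ln by exact h. reflexivity. Qed.

(** A test function for the lift, transported back, is [discount] times a function of [ln S] plus
    [weight] times [cosh (ln S)]. Both spatial profiles are replaced by quadratic majorants with
    excess [ka], which disappears in the limit. *)
Lemma lift_subsol : 0 < T -> visc_sub T r rho alpha mu sigma a b P ->
  subsol T (ham log_s log_b log_c) (lift T r be K P).
Proof.
intros T_pos hP x0 t0 p X psi psi1 ht0 hpsi [e [he He]].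
set (S0 := exp x0). assert (hS0 : 0 < S0) by apply exp_pos.
set (tau0 := T - t0). set (u0 := lift T r be K P x0 t0).
(* The spatial part of the given touching function, seen in [S]; [g] is [cosh (ln S)]. *)
set (f := fun S => u0 - psi t0 + p * (ln S - x0) + X / 2 * (ln S - x0) ^ 2).
set (f1 := fun S => (p + X * (ln S - x0)) / S).
set (g := fun S => (S + / S) / 2).
set (g1 := fun S => (1 - / S ^ 2) / 2).
assert (lnS0 : ln S0 = x0) by apply ln_exp.
assert (posS : forall S, Rabs (S - S0) < S0 -> 0 < S).
{ intros S h. apply Rabs_def2 in h. lra. }
apply le_epsilon. intros eps heps.
set (E0 := be * exp (K * t0)). assert (hE0 : 0 <= E0) by (apply Rmult_le_pos; [exact be_pos|apply Rlt_le, exp_pos]).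
(* The factor with which the excess [ka] of the second derivatives enters the equation. *)
set (W := log_s x0 t0 ^ 2 * S0 ^ 2 * (1 + E0)).
assert (hW : 0 <= W).
{ unfold W. apply Rmult_le_pos; [apply Rmult_le_pos; apply pow2_ge_0|lra]. }
set (ka := eps / (W + 1)). assert (hka : 0 < ka) by (apply Rdiv_lt_0_compat; lra).
assert (kaW : ka * W <= eps).
{ assert (ka * (W + 1) = eps) by (unfold ka; field; lra). lra. }
destruct (second_order_majorant f f1 S0 ((X - p) / S0 ^ 2) S0 ka hS0 hka) as [ef [hef Hf]].
{ intros S hS. pose proof (posS S hS). unfold f, f1. auto_derive; [lra|]. simpl. field. lra. }
{ unfold f1. auto_derive; [split; [lra|split; [lra|exact I]]|]. rewrite lnS0. simpl. field. lra. }
destruct (second_order_majorant g g1 S0 (/ S0 ^ 3) S0 ka hS0 hka) as [eg [heg Hg]].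
{ intros S hS. pose proof (posS S hS). unfold g, g1. auto_derive; [lra|]. simpl. field. lra. }
{ unfold g1. auto_derive; [|field; lra]. apply (pow_nonzero S0 2). lra. }
assert (fS0 : f S0 = u0 - psi t0) by (unfold f; rewrite lnS0; ring).
assert (f1S0 : f1 S0 = p / S0) by (unfold f1; rewrite lnS0; field; lra).
rewrite fS0, f1S0 in Hf.
set (c0 := fun t => (discount t * (u0 - psi t0) + weight t * g S0) + discount t * psi (T - t)).
set (d0 := fun t => (r * discount t * (u0 - psi t0) - (K - r) * weight t * g S0) + (r * discount t * psi (T - t) - discount t * psi1 (T - t))).
set (c1 := fun t => discount t * (p / S0) + weight t * g1 S0).
set (c2 := fun t => discount t * ((X - p) / S0 ^ 2 + ka) + weight t * (/ S0 ^ 3 + ka)).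
assert (h0 : C1_pair c0 d0) by (apply C1_pair_plus; [apply combination_C1|apply product_C1, hpsi]).
pose proof (combination_C1 (p / S0) (g1 S0)) as h1. fold c1 in h1.
pose proof (combination_C1 ((X - p) / S0 ^ 2 + ka) (/ S0 ^ 3 + ka)) as h2. fold c2 in h2.
assert (htau : 0 < tau0 < T) by (unfold tau0; lra).
assert (ett : T - tau0 = t0) by (unfold tau0; ring).
assert (liftE : forall S t, 0 < S -> 0 <= T - t <= T -> P S t = discount t * lift T r be K P (ln S) (T - t) + weight t * g S).
{ intros S t hS ht. unfold lift. rewrite clamp_id by lra. rewrite exp_ln, cosh_ln by exact hS.
  replace (T - (T - t)) with t by ring. rewrite weight_id. fold (g S). pose proof (discount_id t) as i.
  transitivity ((exp (r * (T - t)) * discount t) * P S t); [rewrite i; ring|ring]. }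
assert (PS0 : P S0 tau0 = c0 tau0).
{ rewrite liftE; [|exact hS0|lra]. rewrite lnS0, ett. fold u0. unfold c0. rewrite ett. ring. }
assert (ht : loc_max P (quad_test c0 c1 c2 S0) S0 tau0).
{ destruct (continuity_pt_small ln S0 e) as [el [hel Hel]]; [|exact he|].
  { apply derive_continuity_pt. auto_derive. exact hS0. }
  set (dd := Rmin (Rmin e el) (Rmin (Rmin ef eg) (Rmin S0 (Rmin t0 (T - t0))))).
  assert (hdd : 0 < dd) by (unfold dd; repeat apply Rmin_pos; lra).
  assert (l : dd <= e /\ dd <= el /\ dd <= ef /\ dd <= eg /\ dd <= S0 /\ dd <= t0 /\ dd <= T - t0).
  { unfold dd. repeat split.
    - eapply Rle_trans; [apply Rmin_l|apply Rmin_l].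
    - eapply Rle_trans; [apply Rmin_l|apply Rmin_r].
    - eapply Rle_trans; [apply Rmin_r|]. eapply Rle_trans; [apply Rmin_l|apply Rmin_l].
    - eapply Rle_trans; [apply Rmin_r|]. eapply Rle_trans; [apply Rmin_l|apply Rmin_r].
    - eapply Rle_trans; [apply Rmin_r|]. eapply Rle_trans; [apply Rmin_r|apply Rmin_l].
    - eapply Rle_trans; [apply Rmin_r|]. eapply Rle_trans; [apply Rmin_r|]. eapply Rle_trans; [apply Rmin_r|apply Rmin_l].
    - eapply Rle_trans; [apply Rmin_r|]. eapply Rle_trans; [apply Rmin_r|]. eapply Rle_trans; [apply Rmin_r|apply Rmin_r]. }
  exists dd. split; [exact hdd|]. intros S t hS ht.
  assert (e1 : quad_test c0 c1 c2 S0 S0 tau0 = P S0 tau0) by (rewrite PS0; unfold quad_test, quad; ring).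
  rewrite e1.
  enough (P S t <= quad_test c0 c1 c2 S0 S t) by lra.
  assert (hSp : 0 < S) by (apply posS; lra).
  assert (htt : Rabs (T - t - t0) < dd).
  { replace (T - t - t0) with (- (t - tau0)) by (unfold tau0; ring). rewrite Rabs_Ropp. exact ht. }
  assert (ht2 : 0 <= T - t <= T) by (apply Rabs_def2 in htt; lra).
  rewrite liftE by assumption.
  specialize (Hel S ltac:(lra)). rewrite lnS0 in Hel.
  specialize (He (ln S) (T - t) Hel ltac:(lra)).
  specialize (Hf S ltac:(lra)). specialize (Hg S ltac:(lra)).
  assert (e2 : quad_test c0 c1 c2 S0 S t = discount t * (quad (u0 - psi t0) (p / S0) ((X - p) / S0 ^ 2 + ka) S0 S + psi (T - t))
    + weight t * quad (g S0) (g1 S0) (/ S0 ^ 3 + ka) S0 S).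
  { unfold quad_test, quad, c0, c1, c2. unfold Rdiv. ring. }
  rewrite e2. apply Rplus_le_compat.
  - apply Rmult_le_compat_l; [apply Rlt_le, discount_pos|]. unfold f in Hf. fold u0 in He. lra.
  - apply Rmult_le_compat_l; [apply weight_pos|exact Hg]. }
pose proof (hP _ S0 tau0 (quad_test_C12 c0 c1 c2 _ _ _ S0 h0 h1 h2) hS0 htau ht) as H.
rewrite (quad_test_Lop c0 c1 c2 _ _ _ S0 h0 h1 h2), PS0 in H.
set (D := discount tau0) in *. set (Wt := weight tau0) in *.
assert (hWt : Wt = E0 * D) by (unfold Wt; rewrite weight_id, ett; reflexivity).
assert (hD : 0 < D) by apply discount_pos.
destruct (s_ok x0 x0 t0 ht0) as [s1 _]. destruct (b_ok x0 x0 t0 ht0) as [b1 _]. destruct (c_ok x0 x0 t0 ht0) as [k1 _].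
assert (s2 : log_s x0 t0 ^ 2 = sigma S0 tau0 ^ 2 / 2).
{ unfold log_s. fold S0 tau0. replace ((sigma S0 tau0 / sqrt 2) ^ 2) with (sigma S0 tau0 ^ 2 / (sqrt 2 * sqrt 2)).
  - rewrite sqrt_def by lra. reflexivity.
  - field. apply Rgt_not_eq, sqrt_lt_R0. lra. }
assert (b2 : mu_tilde r rho mu sigma a b S0 tau0 = log_b x0 t0 + log_s x0 t0 ^ 2).
{ rewrite s2. unfold log_b. fold S0 tau0. field. }
assert (k2 : alpha * sqrt (1 - rho ^ 2) * sigma S0 tau0 = log_c x0 t0) by reflexivity.
rewrite b2, k2 in H. replace (/ 2 * sigma S0 tau0 ^ 2) with (log_s x0 t0 ^ 2) in H by (rewrite s2; field).
set (s := log_s x0 t0) in *. set (bb := log_b x0 t0) in *. set (cc := log_c x0 t0) in *.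
set (sh := (S0 - / S0) / 2). set (ch := g S0) in *.
assert (hc1 : S0 * c1 tau0 = D * (p + E0 * sh)).
{ unfold c1. fold D Wt. rewrite hWt. unfold g1, sh. field. lra. }
assert (hc2 : S0 ^ 2 * c2 tau0 = D * (X - p + E0 * (ch - sh) + ka * S0 ^ 2 * (1 + E0))).
{ unfold c2. fold D Wt. rewrite hWt. unfold ch, g, sh. field. lra. }
assert (hd0 : d0 tau0 - r * c0 tau0 = D * (- psi1 t0 - K * E0 * ch)).
{ unfold d0, c0. fold D Wt. rewrite hWt, ett. fold ch. ring. }
assert (hab : S0 * Rabs (c1 tau0) = D * Rabs (p + E0 * sh)).
{ rewrite <- (Rabs_pos_eq S0) at 1 by lra. rewrite <- Rabs_mult, hc1, Rabs_mult, (Rabs_pos_eq D) by lra. reflexivity. }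
assert (H' : 0 <= D * (- psi1 t0 - K * E0 * ch + (bb + s ^ 2) * (p + E0 * sh)
   + s ^ 2 * (X - p + E0 * (ch - sh) + ka * S0 ^ 2 * (1 + E0)) + cc * Rabs (p + E0 * sh))).
{ apply Rge_le in H. eapply Rle_trans; [exact H|]. right.
  transitivity ((d0 tau0 - r * c0 tau0) + (bb + s ^ 2) * (S0 * c1 tau0) + s ^ 2 * (S0 ^ 2 * c2 tau0) + cc * (S0 * Rabs (c1 tau0))); [ring|].
  rewrite hc1, hc2, hd0, hab. ring. }
assert (H2 : 0 <= - psi1 t0 - K * E0 * ch + (bb + s ^ 2) * (p + E0 * sh)
   + s ^ 2 * (X - p + E0 * (ch - sh) + ka * S0 ^ 2 * (1 + E0)) + cc * Rabs (p + E0 * sh)).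
{ apply Rmult_le_reg_l with D; [exact hD|]. lra. }
assert (hch : 0 <= ch /\ Rabs sh <= ch).
{ unfold ch, g, sh. assert (0 < / S0) by (apply Rinv_0_lt_compat; lra). split; [lra|apply Rabs_le; lra]. }
destruct hch as [ch0 hsh].
(* The derivatives of the [cosh] term contribute at most [(La ^ 2 + 2 * La) * (E0 * ch)], which is
   what the time derivative [K * E0 * ch] compensates. *)
assert (q1 : bb * (E0 * sh) <= La * (E0 * ch)).
{ apply abs_prod_le; [exact b1|]. rewrite Rabs_mult, (Rabs_pos_eq E0) by lra. apply Rmult_le_compat_l; lra. }
assert (q2 : cc * (Rabs (p + E0 * sh) - Rabs p) <= La * (E0 * ch)).
{ apply abs_prod_le; [exact k1|]. eapply Rle_trans; [apply Rabs_triang_inv2|].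
  replace (p + E0 * sh - p) with (E0 * sh) by ring. rewrite Rabs_mult, (Rabs_pos_eq E0) by lra. apply Rmult_le_compat_l; lra. }
assert (hEc : 0 <= E0 * ch) by (apply Rmult_le_pos; assumption).
assert (q3 : s ^ 2 * (E0 * ch) <= La ^ 2 * (E0 * ch)).
{ apply Rmult_le_compat_r; [exact hEc|]. apply sqr_le_abs, s1. }
assert (q4 : (La ^ 2 + 2 * La) * (E0 * ch) <= K * (E0 * ch)) by (apply Rmult_le_compat_r; lra).
unfold ham. fold s bb cc. unfold W in kaW. lra.
Qed.
End LiftSubsol.

(** * Comparison for the pricing equation *)

(** This is [y / m <= exp (y / m)] raised to the power [m]. *)
Lemma pow_exp_bound (m : nat) (y : R) : (0 < m)%nat -> 0 <= y -> y ^ m <= INR m ^ m * exp y.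
Proof.
intros hm hy. assert (hM : 0 < INR m) by (apply lt_0_INR; exact hm).
assert (E : exp y = exp (y / INR m) ^ m).
{ clear hy. 
  assert (G : forall n z, exp z ^ n = exp (INR n * z)).
  { intros n z. induction n as [|n IH]; [simpl; rewrite Rmult_0_l, exp_0; reflexivity|].
    rewrite <- tech_pow_Rmult, IH, <- exp_plus, S_INR. f_equal. ring. }
  rewrite G. f_equal. field. lra. }
rewrite E, <- Rpow_mult_distr. apply pow_incr. split; [exact hy|].
assert (0 <= y / INR m) by (apply Rdiv_le_0_compat; lra).
pose proof (exp_ineq1_le (y / INR m)).
apply Rle_trans with (INR m * (y / INR m)); [right; field; lra|]. apply Rmult_le_compat_l; lra.
Qed.

Lemma rpow_le_pow (y k : R) (n : nat) : 1 <= y -> k <= INR n -> rpow y k <= y ^ n.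
Proof.
intros hy hk. unfold rpow. destruct (Req_EM_T y 0); [lra|].
rewrite <- Rpower_pow by lra. apply Rle_Rpower; assumption.
Qed.

Lemma exp_abs_le_cosh (x : R) : exp (Rabs x) <= 2 * cosh x.
Proof.
unfold cosh. pose proof (exp_pos x). pose proof (exp_pos (- x)).
destruct (Rcase_abs x); [rewrite Rabs_left by lra|rewrite Rabs_right by lra]; lra.
Qed.

Lemma cosh_ge_1 (x : R) : 1 <= cosh x.
Proof.
pose proof (exp_abs_le_cosh x). unfold cosh.
assert (exp x * exp (- x) = 1) by (rewrite <- exp_plus, Rplus_opp_r, exp_0; reflexivity).
pose proof (exp_pos x). pose proof (exp_pos (- x)). pose proof (pow2_ge_0 (exp x - exp (- x))). nra.
Qed.

(** Far out, [cosh] dominates [y ^ (n + 1)]; the power beyond the growth [y ^ n] of [P] supplies a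
    factor [y] that outweighs all constants. On the remaining compact set the lift is bounded. *)
Lemma lift_coercive (T r be K : R) (P : R -> R -> R) : 0 < T -> 0 <= r -> 0 < be -> 0 <= K ->
  cont_on_dom T P -> growth_class T P -> exists B, forall x t, lift T r be K P x t <= B - Rabs x.
Proof.
intros hT hr hbe hK hc [_ [k [hk Hk]]].
destruct (Hk 1 ltac:(lra)) as [N HN].
destruct (INR_unbounded k) as [n hn].
assert (hn0 : (0 < n)%nat) by (apply INR_lt; simpl; lra).
(* The first summand covers the growth of [P], the additional 1 covers the required [Rabs x]. *)
set (A := 2 * exp (r * T) + 1). pose proof (exp_pos (r * T)) as hA0.
set (m := S n). set (Mm := INR m ^ m).
assert (hMm : 0 < Mm) by (apply pow_lt, lt_0_INR; unfold m; lia).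
set (R0 := Rmax 1 (Rmax (N + 1) (2 * A * Mm / be))).
assert (R1 : 1 <= R0) by apply Rmax_l.
assert (R2 : N + 1 <= R0) by (eapply Rle_trans; [|apply Rmax_r]; apply Rmax_l).
assert (R3 : 2 * A * Mm / be <= R0) by (eapply Rle_trans; [|apply Rmax_r]; apply Rmax_r).
assert (far : forall x t, R0 <= Rabs x -> lift T r be K P x t <= - Rabs x).
{ intros x t hx. set (y := Rabs x) in *. unfold lift. set (s := clamp 0 T t).
  assert (hs : 0 <= s <= T) by (apply clamp_in; lra).
  assert (g1 : P (exp x) (T - s) <= 1 + y ^ n).
  { specialize (HN (exp x) (T - s) (exp_pos x) ltac:(lra)). rewrite ln_exp in HN. fold y in HN.
    specialize (HN ltac:(lra)). pose proof (rpow_le_pow y k n ltac:(lra) ltac:(lra)).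
    pose proof (Rle_abs (P (exp x) (T - s))). lra. }
  assert (g2 : 1 <= y ^ n) by (apply pow_R1_Rle; lra).
  assert (g3 : exp (r * s) <= exp (r * T)).
  { assert (r * s <= r * T) by (apply Rmult_le_compat_l; lra). destruct H as [H|H]; [left; apply exp_increasing, H|right; f_equal; exact H]. }
  pose proof (exp_pos (r * s)) as g4.
  assert (g5 : exp (r * s) * P (exp x) (T - s) <= exp (r * T) * (2 * y ^ n)).
  { apply Rle_trans with (exp (r * s) * (2 * y ^ n)); [apply Rmult_le_compat_l; lra|apply Rmult_le_compat_r; lra]. }
  assert (g6 : y <= y ^ n).
  { rewrite <- (pow_1 y) at 1. apply Rle_pow; [lra|exact hn0]. }
  assert (g7 : 1 <= exp (K * s)).
  { pose proof (exp_ineq1_le (K * s)). assert (0 <= K * s) by (apply Rmult_le_pos; lra). lra. }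
  assert (g8 : be * cosh x <= be * exp (K * s) * cosh x).
  { pose proof (cosh_ge_1 x). assert (be * 1 <= be * exp (K * s)) by (apply Rmult_le_compat_l; lra).
    apply Rmult_le_compat_r; lra. }
  pose proof (pow_exp_bound m y ltac:(unfold m; lia) ltac:(lra)) as g9. fold Mm in g9.
  pose proof (exp_abs_le_cosh x) as g10. fold y in g10.
  assert (g11 : A * y ^ n <= be * cosh x).
  { assert (y * y ^ n <= Mm * (2 * cosh x)).
    { eapply Rle_trans; [exact g9|]. apply Rmult_le_compat_l; lra. }
    assert (2 * A * Mm <= be * y).
    { replace (2 * A * Mm) with (be * (2 * A * Mm / be)) by (field; lra). apply Rmult_le_compat_l; lra. }
    assert (2 * A * Mm * y ^ n <= be * y * y ^ n) by (apply Rmult_le_compat_r; lra).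
    assert (be * (y * y ^ n) <= be * (Mm * (2 * cosh x))) by (apply Rmult_le_compat_l; lra).
    apply Rmult_le_reg_l with (2 * Mm); lra. }
  unfold A in g11. lra. }
destruct (max_rectangle (lift T r be K P) (- R0) R0 0 T (lift_cont2 T r be K P hT hc)) as [xm [tm [_ [_ Hm]]]]; try lra.
exists (Rmax 0 (lift T r be K P xm tm + R0)). intros x t.
pose proof (Rmax_l 0 (lift T r be K P xm tm + R0)) as m1. pose proof (Rmax_r 0 (lift T r be K P xm tm + R0)) as m2.
destruct (Rle_lt_dec R0 (Rabs x)) as [h|h]; [specialize (far x t h); lra|].
assert (hs : 0 <= clamp 0 T t <= T) by (apply clamp_in; lra).
specialize (Hm x (clamp 0 T t) ltac:(apply Rabs_le_between; lra) hs).
assert (e : lift T r be K P x (clamp 0 T t) = lift T r be K P x t) by (unfold lift; rewrite (clamp_id 0 T (clamp 0 T t)) by exact hs; reflexivity).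
lra.
Qed.

(** * Negation of supersolutions *)

Definition opp2 (u : R -> R -> R) (S t : R) : R := - u S t.

Lemma C12_opp (phi : R -> R -> R) : C12 phi -> C12 (opp2 phi).
Proof.
unfold opp2. intros h S t. destruct (h S t) as [h1 [h2 [h3 [h4 [h5 [h6 h7]]]]]].
assert (e : forall S t, Derive (fun s => Derive (fun s' => - phi s' t) s) S = - Derive (fun s => Derive (fun s' => phi s' t) s) S).
{ intros S' t'. rewrite <- Derive_opp. apply Derive_ext. intro s. apply Derive_opp. }
split; [apply (ex_derive_opp (V := R_NormedModule)), h1|].
split; [apply (ex_derive_opp (V := R_NormedModule)), h2|].
split.
{ apply (ex_derive_ext (fun s => - Derive (fun s' => phi s' t) s)); [intro s; symmetry; apply Derive_opp|].
  apply (ex_derive_opp (V := R_NormedModule)), h3. }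
split; [apply (continuous_opp (V := R_NormedModule)), h4|].
split; [|split]; (eapply continuous_ext; [intro p; symmetry; (apply Derive_opp || apply e)|]);
  apply (continuous_opp (V := R_NormedModule)); assumption.
Qed.

(** The operator is odd except for [Rabs], which is even; changing the sign of [alpha] restores
    oddness. *)
Lemma Lop_opp r rho alpha mu sigma a b phi S t v :
  Lop r rho (- alpha) mu sigma a b phi S t (- v) = - Lop r rho alpha mu sigma a b (opp2 phi) S t v.
Proof.
unfold Lop, opp2. cbv zeta.
rewrite !Derive_opp, Rabs_Ropp.
replace (Derive (fun s => Derive (fun s' => - phi s' t) s) S) with (- Derive (fun s => Derive (fun s' => phi s' t) s) S).
- change (Derive (fun s => phi S s) t) with (Derive (phi S) t). ring.
- rewrite <- Derive_opp. apply Derive_ext. intro s. symmetry. apply Derive_opp.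
Qed.

Lemma visc_super_opp T r rho alpha mu sigma a b P : visc_super T r rho alpha mu sigma a b P ->
  visc_sub T r rho (- alpha) mu sigma a b (opp2 P).
Proof.
intros h phi S0 t0 hphi hS ht [e [he He]]. unfold opp2 at 1. rewrite Lop_opp.
enough (Lop r rho alpha mu sigma a b (opp2 phi) S0 t0 (P S0 t0) <= 0) by lra.
apply h; [apply C12_opp, hphi|exact hS|exact ht|].
exists e. split; [exact he|]. intros S t h1 h2. specialize (He S t h1 h2). unfold opp2 in *. lra.
Qed.

Lemma cont_on_dom_opp T P : cont_on_dom T P -> cont_on_dom T (opp2 P).
Proof.
intros h S0 t0 hS ht e he. destruct (h S0 t0 hS ht e he) as [d [hd Hd]]. exists d. split; [exact hd|].
intros S t h1 h2 h3 h4. unfold opp2. replace (- P S t - - P S0 t0) with (- (P S t - P S0 t0)) by ring.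
rewrite Rabs_Ropp. apply Hd; assumption.
Qed.

Lemma growth_class_opp T P : growth_class T P -> growth_class T (opp2 P).
Proof.
intros [h1 [k [hk Hk]]]. unfold opp2. split.
- intros S0 t0 hS ht. destruct (h1 S0 t0 hS ht) as [d [M [hd H]]]. exists d, M. split; [exact hd|].
  intros. rewrite Rabs_Ropp. apply H; assumption.
- exists k. split; [exact hk|]. intros e he. destruct (Hk e he) as [N HN]. exists N.
  intros. rewrite Rabs_Ropp. apply HN; assumption.
Qed.

(** * The standing assumptions in logarithmic coordinates *)

(** Ellipticity in the direction [(0, 1)] bounds [b^2] from below by [delta]. *)
Lemma standing_b_bound T r rho mu sigma a b g : 0 < T -> standing T r rho mu sigma a b g ->
  exists d, 0 < d /\ forall t, 0 <= t <= T -> d <= Rabs (b t).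
Proof.
intros hT [_ [_ [_ [_ [_ [_ [d [hd Hd]]]]]]]].
exists (sqrt d). split; [apply sqrt_lt_R0, hd|]. intros t ht.
specialize (Hd 1 t 0 1 ltac:(lra) ht).
rewrite <- sqrt_Rsqr_abs. apply sqrt_le_1_alt. unfold Rsqr. lra.
Qed.

Lemma standing_coeffs T r rho alpha mu sigma a b g : 0 < T -> -1 <= rho <= 1 ->
  standing T r rho mu sigma a b g -> exists L La, 0 <= L /\ 0 <= La /\
    coeffs_ok T L La (log_s T sigma) /\ coeffs_ok T L La (log_b T r rho mu sigma a b) /\
    coeffs_ok T L La (log_c T rho alpha sigma).
Proof.
intros hT hrho hst. destruct (standing_b_bound T r rho mu sigma a b g hT hst) as [d [hd Hd]].
destruct hst as [[C1 [C2 [hC1 [_ [Hs _]]]]] [_ [[_K [C5 [_ [hC5 [_ Hm]]]]] [_ [_ [[M HM] _]]]]]].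
assert (hM : 0 <= M).
{ destruct (HM 1 0 ltac:(lra) ltac:(lra)) as [h _]. pose proof (Rabs_pos (mu 1 0)). lra. }
set (q := Rabs (alpha * sqrt (1 - rho ^ 2))). assert (hq : 0 <= q) by apply Rabs_pos.
(* A uniform bound for [mu_tilde]; dividing by [b] uses the lower bound [d]. *)
set (Mt := M + (M + Rabs r) * M / d).
assert (hr : 0 <= Rabs r) by apply Rabs_pos.
assert (hMt : 0 <= (M + Rabs r) * M / d) by (apply Rdiv_le_0_compat; [apply Rmult_le_pos; lra|exact hd]).
assert (hqC : 0 <= q * C1) by (apply Rmult_le_pos; lra).
assert (hqM : 0 <= q * M) by (apply Rmult_le_pos; lra).
assert (hMC : 0 <= M * C1) by (apply Rmult_le_pos; lra).
pose proof (pow2_ge_0 M) as hM2.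
assert (sq2 : 1 <= sqrt 2) by (rewrite <- sqrt_1 at 1; apply sqrt_le_1_alt; lra).
assert (isq : 0 < / sqrt 2 <= 1).
{ split; [apply Rinv_0_lt_compat; lra|]. rewrite <- Rinv_1. apply Rinv_le_contravar; lra. }
exists (C1 + (C5 + M * C1) + q * C1), (M + (Mt + M ^ 2) + q * M).
assert (hMt0 : 0 <= Mt) by (unfold Mt; lra).
split; [lra|]. split; [lra|].
assert (base : forall x y t, 0 < t < T -> let sx := sigma (exp x) (T - t) in let sy := sigma (exp y) (T - t) in
  Rabs sx <= M /\ Rabs sy <= M /\ Rabs (sx - sy) <= C1 * Rabs (x - y)).
{ intros x y t ht sx sy. split; [apply HM; [apply exp_pos|lra]|]. split; [apply HM; [apply exp_pos|lra]|].
  pose proof (Hs (exp x) (exp y) (T - t) (exp_pos x) (exp_pos y) ltac:(lra)) as h. rewrite !ln_exp in h. exact h. }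
split; [|split]; intros x y t ht; destruct (base x y t ht) as [s1 [s2 s3]]; pose proof (Rabs_pos (x - y)) as hxy.
- unfold log_s. set (sx := sigma (exp x) (T - t)) in *. set (sy := sigma (exp y) (T - t)) in *.
  assert (hh : forall z, Rabs (z / sqrt 2) <= Rabs z).
  { intro z. unfold Rdiv. rewrite Rabs_mult, (Rabs_pos_eq (/ sqrt 2)) by lra. pose proof (Rabs_pos z). nra. }
  split; [specialize (hh sx); lra|].
  replace (sx / sqrt 2 - sy / sqrt 2) with ((sx - sy) / sqrt 2) by (field; lra).
  specialize (hh (sx - sy)). 
  assert (0 <= (C5 + M * C1 + q * C1) * Rabs (x - y)) by (apply Rmult_le_pos; lra). lra.
- unfold log_b. set (sx := sigma (exp x) (T - t)) in *. set (sy := sigma (exp y) (T - t)) in *.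
  assert (hmt : Rabs (mu_tilde r rho mu sigma a b (exp x) (T - t)) <= Mt).
  { unfold mu_tilde. fold sx. destruct (HM (exp x) (T - t) (exp_pos x) ltac:(lra)) as [m1 [_ [m3 m4]]].
    specialize (Hd (T - t) ltac:(lra)).
    eapply Rle_trans; [apply Rabs_triang|]. rewrite Rabs_Ropp. unfold Mt.
    apply Rplus_le_compat; [exact m1|]. unfold Rdiv. rewrite !Rabs_mult, Rabs_inv.
    assert (rr : Rabs rho <= 1) by (apply Rabs_le; lra).
    assert (ar : Rabs (a (T - t) - r) <= M + Rabs r).
    { eapply Rle_trans; [apply Rabs_triang|]. rewrite Rabs_Ropp. lra. }
    pose proof (Rabs_pos rho). pose proof (Rabs_pos (a (T - t) - r)).
    apply Rmult_le_compat.
    - repeat apply Rmult_le_pos; apply Rabs_pos.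
    - left. apply Rinv_0_lt_compat. lra.
    - apply Rmult_le_compat; [apply Rmult_le_pos; apply Rabs_pos|apply Rabs_pos| |exact s1]. nra.
    - apply Rinv_le_contravar; lra. }
  assert (hsq : 0 <= sx ^ 2 <= M ^ 2) by (split; [apply pow2_ge_0|apply sqr_le_abs; exact s1]).
  assert (hml : Rabs (mu_tilde r rho mu sigma a b (exp x) (T - t) - mu_tilde r rho mu sigma a b (exp y) (T - t)) <= C5 * Rabs (x - y)).
  { pose proof (Hm (exp x) (exp y) (T - t) (exp_pos x) (exp_pos y) ltac:(lra)) as h. rewrite !ln_exp in h. exact h. }
  assert (hsl : Rabs (sx ^ 2 / 2 - sy ^ 2 / 2) <= M * C1 * Rabs (x - y)).
  { replace (sx ^ 2 / 2 - sy ^ 2 / 2) with ((sx + sy) / 2 * (sx - sy)) by field. rewrite Rabs_mult.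
    assert (Rabs ((sx + sy) / 2) <= M) by (apply Rabs_le_between in s1; apply Rabs_le_between in s2; apply Rabs_le; lra).
    rewrite Rmult_assoc. apply Rmult_le_compat; try apply Rabs_pos; assumption. }
  set (mx := mu_tilde r rho mu sigma a b (exp x) (T - t)) in *. set (my := mu_tilde r rho mu sigma a b (exp y) (T - t)) in *.
  split; [apply Rabs_le_between in hmt; apply Rabs_le; lra|].
  assert (0 <= (C1 + q * C1) * Rabs (x - y)) by (apply Rmult_le_pos; lra).
  apply Rabs_le_between in hml. apply Rabs_le_between in hsl. apply Rabs_le. lra.
- unfold log_c. set (sx := sigma (exp x) (T - t)) in *. set (sy := sigma (exp y) (T - t)) in *.
  rewrite <- Rmult_minus_distr_l, (Rabs_mult _ sx), (Rabs_mult _ (sx - sy)). fold q.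
  assert (q * Rabs sx <= q * M) by (apply Rmult_le_compat_l; lra).
  assert (q * Rabs (sx - sy) <= q * (C1 * Rabs (x - y))) by (apply Rmult_le_compat_l; lra).
  assert (0 <= (C1 + (C5 + M * C1)) * Rabs (x - y)) by (apply Rmult_le_pos; lra).
  split; lra.
Qed.

(** The core comparison applies to the lifts of [P] and [- Q] for each positive [be]. At a fixed
    point the correction by [cosh] is proportional to [be], which then tends to 0. *)
Theorem visc_comparison T r rho alpha mu sigma a b g P Q : 0 < T -> 0 <= r -> -1 <= rho <= 1 ->
  standing T r rho mu sigma a b g -> cont_on_dom T P -> cont_on_dom T Q ->
  growth_class T P -> growth_class T Q ->
  visc_sub T r rho alpha mu sigma a b P -> visc_super T r rho alpha mu sigma a b Q ->
  (forall S, 0 < S -> P S T <= Q S T) ->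
  forall S t, 0 < S -> 0 <= t <= T -> P S t <= Q S t.
Proof.
intros hT hr hrho hst cP cQ gP gQ vP vQ hPQ S t hS ht.
destruct (standing_coeffs T r rho alpha mu sigma a b g hT hrho hst) as [L [La [hL [hLa [s_ok [b_ok c_ok]]]]]].
set (K := La ^ 2 + 2 * La). assert (hK : 0 <= K) by (unfold K; pose proof (pow2_ge_0 La); lra).
assert (copp : forall x t, log_c T rho (- alpha) sigma x t = - log_c T rho alpha sigma x t) by (intros; unfold log_c; ring).
assert (c_ok' : coeffs_ok T L La (log_c T rho (- alpha) sigma)).
{ intros x y s hs. destruct (c_ok x y s hs) as [h1 h2]. rewrite !copp. rewrite Rabs_Ropp. split; [exact h1|].
  replace (- log_c T rho alpha sigma x s - - log_c T rho alpha sigma y s) with (- (log_c T rho alpha sigma x s - log_c T rho alpha sigma y s)) by ring.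
  rewrite Rabs_Ropp. exact h2. }
assert (key : forall be, 0 < be -> P S t - Q S t <= be * (2 * exp (K * T) * cosh (ln S))).
{ intros be hbe.
  destruct (lift_coercive T r be K P hT hr hbe hK cP gP) as [B1 HB1].
  destruct (lift_coercive T r be K (opp2 Q) hT hr hbe hK (cont_on_dom_opp T Q cQ) (growth_class_opp T Q gQ)) as [B2 HB2].
  assert (H : lift T r be K P (ln S) (T - t) + lift T r be K (opp2 Q) (ln S) (T - t) <= 0).
  { apply (core_comparison T L La (log_s T sigma) (log_b T r rho mu sigma a b) (log_c T rho alpha sigma)
      (lift T r be K P) (lift T r be K (opp2 Q)) (Rmax B1 B2)); try assumption.
    - apply lift_cont2; assumption.
    - apply lift_cont2; [exact hT|apply cont_on_dom_opp, cQ].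
    - apply lift_subsol with L La; try assumption; unfold K; lra.
    - assert (h : subsol T (ham (log_s T sigma) (log_b T r rho mu sigma a b) (log_c T rho (- alpha) sigma)) (lift T r be K (opp2 Q))).
      { apply lift_subsol with L La; try assumption; [lra|unfold K; lra|apply visc_super_opp, vQ]. }
      intros x0 t0 p X psi psi1 h0 hpsi htch. specialize (h x0 t0 p X psi psi1 h0 hpsi htch).
      unfold ham in *. rewrite copp in h. exact h.
    - intros x s. specialize (HB1 x s). pose proof (Rmax_l B1 B2). lra.
    - intros x s. specialize (HB2 x s). pose proof (Rmax_r B1 B2). lra.
    - intro x. unfold lift, opp2. rewrite (clamp_id 0 T 0), !Rmult_0_r, exp_0, Rminus_0_r by lra.
      specialize (hPQ (exp x) (exp_pos x)). pose proof (cosh_ge_1 x).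
      assert (0 <= be * cosh x) by (apply Rmult_le_pos; lra). lra.
    - lra. }
  unfold lift, opp2 in H. rewrite (clamp_id 0 T (T - t)), exp_ln in H by lra. replace (T - (T - t)) with t in H by ring.
  assert (h1 : 1 <= exp (r * (T - t))).
  { pose proof (exp_ineq1_le (r * (T - t))). assert (0 <= r * (T - t)) by (apply Rmult_le_pos; lra). lra. }
  assert (h2 : exp (K * (T - t)) <= exp (K * T)).
  { assert (K * (T - t) <= K * T) by (apply Rmult_le_compat_l; lra).
    destruct H0 as [h|h]; [left; apply exp_increasing, h|right; f_equal; exact h]. }
  pose proof (cosh_ge_1 (ln S)) as hch.
  assert (h3 : be * exp (K * (T - t)) * cosh (ln S) <= be * exp (K * T) * cosh (ln S)).
  { apply Rmult_le_compat_r; [lra|]. apply Rmult_le_compat_l; lra. }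
  assert (h4 : 0 <= be * exp (K * T) * cosh (ln S)).
  { pose proof (exp_pos (K * T)). apply Rmult_le_pos; [apply Rmult_le_pos|]; lra. }
  destruct (Rle_lt_dec (P S t - Q S t) 0) as [c|c]; [lra|].
  assert (1 * (P S t - Q S t) <= exp (r * (T - t)) * (P S t - Q S t)) by (apply Rmult_le_compat_r; lra).
  lra. }
apply Rminus_le. apply le_epsilon. intros e he.
set (W := 2 * exp (K * T) * cosh (ln S)) in *.
assert (hW : 0 < W).
{ unfold W. pose proof (exp_pos (K * T)). pose proof (cosh_ge_1 (ln S)). apply Rmult_lt_0_compat; lra. }
specialize (key (e / W) ltac:(apply Rdiv_lt_0_compat; lra)).
replace (e / W * W) with e in key by (field; lra). lra.
Qed.

(** * Passing from the equation of one volatility to the other *)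

Lemma loc_extremum_derive (u : R -> R) (phi : R -> R) (S0 e : R) : 0 < e ->
  ex_derive u S0 -> ex_derive phi S0 ->
  (forall S, Rabs (S - S0) < e -> u S - phi S <= u S0 - phi S0) -> Derive phi S0 = Derive u S0.
Proof.
intros he hu hphi hm.
assert (hd : is_derive (fun S => u S - phi S) S0 (Derive u S0 - Derive phi S0)).
{ apply (is_derive_minus (K := R_AbsRing) (V := R_NormedModule) u phi); apply Derive_correct; assumption. }
apply is_derive_Reals in hd.
pose proof (deriv_maximum (fun S => u S - phi S) (S0 - e) (S0 + e) S0 (exist _ _ hd) ltac:(lra) ltac:(lra)) as h.
simpl in h. enough (Derive u S0 - Derive phi S0 = 0) by lra. apply h.
intros S h1 h2. apply hm. apply Rabs_def1; lra.
Qed.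

(** A test function touching [P] has the same [S]-derivative as [P], because [P] is differentiable
    in [S]. So the sign known for [P] compares the drift terms of the test function. *)
Lemma visc_sub_change_b T r rho alpha mu sigma a b b' P : visc_sub T r rho alpha mu sigma a b P ->
  (forall S t, 0 < S -> 0 < t < T -> ex_derive (fun s => P s t) S /\
    mu_tilde r rho mu sigma a b S t * Derive (fun s => P s t) S
      <= mu_tilde r rho mu sigma a b' S t * Derive (fun s => P s t) S) ->
  visc_sub T r rho alpha mu sigma a b' P.
Proof.
intros h hP phi S0 t0 hphi hS ht hm. pose proof (h phi S0 t0 hphi hS ht hm) as H.
destruct hm as [e [he He]]. destruct (hP S0 t0 hS ht) as [h1 h2].
assert (E : Derive (fun s => phi s t0) S0 = Derive (fun s => P s t0) S0).
{ apply (loc_extremum_derive (fun s => P s t0) (fun s => phi s t0) S0 e); [exact he|exact h1|exact (proj1 (proj2 (hphi S0 t0)))|].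
  intros S hSS. apply He; [exact hSS|rewrite Rminus_diag, Rabs_R0; exact he]. }
unfold Lop in *. cbv zeta in *. rewrite E in *.
assert (S0 * (mu_tilde r rho mu sigma a b S0 t0 * Derive (fun s => P s t0) S0)
  <= S0 * (mu_tilde r rho mu sigma a b' S0 t0 * Derive (fun s => P s t0) S0)) by (apply Rmult_le_compat_l; lra).
lra.
Qed.

Lemma visc_super_change_b T r rho alpha mu sigma a b b' P : visc_super T r rho alpha mu sigma a b P ->
  (forall S t, 0 < S -> 0 < t < T -> ex_derive (fun s => P s t) S /\
    mu_tilde r rho mu sigma a b' S t * Derive (fun s => P s t) S
      <= mu_tilde r rho mu sigma a b S t * Derive (fun s => P s t) S) ->
  visc_super T r rho alpha mu sigma a b' P.
Proof.
intros h hP phi S0 t0 hphi hS ht hm. pose proof (h phi S0 t0 hphi hS ht hm) as H.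
destruct hm as [e [he He]]. destruct (hP S0 t0 hS ht) as [h1 h2].
assert (E : Derive (fun s => phi s t0) S0 = Derive (fun s => P s t0) S0).
{ assert (E : Derive (fun s => - phi s t0) S0 = Derive (fun s => - P s t0) S0).
  { apply (loc_extremum_derive (fun s => - P s t0) (fun s => - phi s t0) S0 e); [exact he|apply (ex_derive_opp (V := R_NormedModule)), h1|apply (ex_derive_opp (V := R_NormedModule)), (proj1 (proj2 (hphi S0 t0)))|].
    intros S hSS. assert (z : Rabs (t0 - t0) < e) by (rewrite Rminus_diag, Rabs_R0; exact he).
    specialize (He S t0 hSS z). lra. }
  rewrite !Derive_opp in E. lra. }
unfold Lop in *. cbv zeta in *. rewrite E in *.
assert (S0 * (mu_tilde r rho mu sigma a b' S0 t0 * Derive (fun s => P s t0) S0)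
  <= S0 * (mu_tilde r rho mu sigma a b S0 t0 * Derive (fun s => P s t0) S0)) by (apply Rmult_le_compat_l; lra).
lra.
Qed.

(** The two drift terms differ by [rho * D] times a nonnegative factor, since [/ b] decreases in
    [b]. *)
Lemma mu_tilde_mono r rho mu sigma a b1 b2 S t D : r <= a t -> 0 <= sigma S t -> 0 < b1 t <= b2 t ->
  (0 <= rho * D -> mu_tilde r rho mu sigma a b1 S t * D <= mu_tilde r rho mu sigma a b2 S t * D) /\
  (rho * D <= 0 -> mu_tilde r rho mu sigma a b2 S t * D <= mu_tilde r rho mu sigma a b1 S t * D).
Proof.
intros ha hs hb. unfold mu_tilde.
assert (hi : / b2 t <= / b1 t) by (apply Rinv_le_contravar; lra).
set (w := (a t - r) * sigma S t * (/ b1 t - / b2 t)).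
assert (hw : 0 <= w) by (unfold w; repeat apply Rmult_le_pos; lra).
assert (e : (mu S t - (a t - r) * rho * sigma S t / b2 t) * D
  = (mu S t - (a t - r) * rho * sigma S t / b1 t) * D + w * (rho * D)) by (unfold w, Rdiv; ring).
rewrite e. split; intro h.
- assert (0 <= w * (rho * D)) by (apply Rmult_le_pos; assumption). lra.
- assert (0 <= w * - (rho * D)) by (apply Rmult_le_pos; lra). lra.
Qed.

Theorem theorem2p12 (T r rho alpha : R) (mu sigma : R -> R -> R)
  (a b1 b2 : R -> R) (g : R -> R) (P1 P2 : R -> R -> R) :
  0 < T -> 0 <= r -> -1 <= rho <= 1 -> 0 <= alpha ->
  (forall t, 0 <= t <= T -> r <= a t) ->
  (forall t, 0 <= t <= T -> r <= b1 t <= b2 t) ->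
  (forall S t, 0 < S -> 0 <= t <= T -> 0 <= sigma S t) ->
  standing T r rho mu sigma a b1 g ->
  standing T r rho mu sigma a b2 g ->
  is_solution T r rho alpha mu sigma a b1 g P1 ->
  is_solution T r rho alpha mu sigma a b2 g P2 ->
  ((rhoPS_nonneg T rho P1 \/ rhoPS_nonneg T rho P2) ->
     forall S t, 0 < S -> 0 <= t <= T -> P1 S t <= P2 S t) /\
  ((rhoPS_nonpos T rho P1 \/ rhoPS_nonpos T rho P2) ->
     forall S t, 0 < S -> 0 <= t <= T -> P1 S t >= P2 S t).
Proof.
intros hT hr hrho _ ha hb hs st1 st2 [c1 [g1 [sub1 [sup1 t1]]]] [c2 [g2 [sub2 [sup2 t2]]]].
(* From [r <= b1] one gets only nonnegativity when [r = 0]; ellipticity makes [b1] positive. *)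
assert (hb' : forall t, 0 < t < T -> 0 < b1 t <= b2 t).
{ destruct (standing_b_bound _ _ _ _ _ _ _ _ hT st1) as [d [hd Hd]].
  intros t ht. specialize (Hd t ltac:(lra)). specialize (hb t ltac:(lra)).
  rewrite Rabs_pos_eq in Hd; lra. }
assert (mono : forall S t D, 0 < S -> 0 < t < T -> 
  (0 <= rho * D -> mu_tilde r rho mu sigma a b1 S t * D <= mu_tilde r rho mu sigma a b2 S t * D) /\
  (rho * D <= 0 -> mu_tilde r rho mu sigma a b2 S t * D <= mu_tilde r rho mu sigma a b1 S t * D)).
{ intros S t D hS ht. apply mu_tilde_mono; [apply ha; lra|apply hs; lra|apply hb'; exact ht]. }
assert (t12 : forall S, 0 < S -> P1 S T <= P2 S T) by (intros S hS; rewrite t1, t2 by exact hS; lra).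
assert (t21 : forall S, 0 < S -> P2 S T <= P1 S T) by (intros S hS; rewrite t1, t2 by exact hS; lra).
(* The solution whose derivative has a sign is carried over to the equation of the other solution,
   and the comparison is made there. *)
split; intros [h|h] S t hS ht; [| |apply Rle_ge|apply Rle_ge].
- apply (visc_comparison T r rho alpha mu sigma a b2 g); try assumption.
  apply (visc_sub_change_b T r rho alpha mu sigma a b1); [exact sub1|].
  intros S' t' hS' ht'. destruct (h S' t' hS' ltac:(lra)) as [e1 e2]. split; [exact e1|apply mono; assumption].
- apply (visc_comparison T r rho alpha mu sigma a b1 g); try assumption.
  apply (visc_super_change_b T r rho alpha mu sigma a b2); [exact sup2|].
  intros S' t' hS' ht'. destruct (h S' t' hS' ltac:(lra)) as [e1 e2]. split; [exact e1|apply mono; assumption].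
- apply (visc_comparison T r rho alpha mu sigma a b2 g); try assumption.
  apply (visc_super_change_b T r rho alpha mu sigma a b1); [exact sup1|].
  intros S' t' hS' ht'. destruct (h S' t' hS' ltac:(lra)) as [e1 e2]. split; [exact e1|apply mono; assumption].
- apply (visc_comparison T r rho alpha mu sigma a b1 g); try assumption.
  apply (visc_sub_change_b T r rho alpha mu sigma a b2); [exact sub2|].
  intros S' t' hS' ht'. destruct (h S' t' hS' ltac:(lra)) as [e1 e2]. split; [exact e1|apply mono; assumption].
Qed.
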